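(* Let $c,d$ be integers with $d\geq 1$, $c\equiv 1\pmod{12}$ and $\gcd(c,d)=1$. Then there exists a prime $p\equiv c\pmod{12d}$ such that the polynomial $y^8+360y^4-48$ has no root in $\mathbb{F}_p$. *)

(* Defs.v *)
From mathcomp Require Import all_boot all_order all_algebra.
Set Implicit Arguments. Unset Strict Implicit. Unset Printing Implicit Defensive.
Import GRing.Theory Num.Theory.
Local Open Scope ring_scope.

Definition P8 (R : nzRingType) : {poly R} :=
  'X^8 + 360%:R *: 'X^4 - 48%:R%:P.

(* Main.v *)
Require Import Defs.
From HB Require Import structures.
From mathcomp Require Import all_boot all_order all_algebra.
From mathcomp Require Import all_fingroup all_solvable finfield closed_field.
From mathcomp Require Import zify ring lra.
From mathcomp Require Import boolp classical_sets reals sequences exp Rstruct.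
Set Implicit Arguments. Unset Strict Implicit. Unset Printing Implicit Defensive.
Import Order.TTheory GRing.Theory Num.Theory.
Local Open Scope ring_scope.

(** Put [M = 12 d]. If [p = u^2 + 3 v^2] is a prime with [p = 1] mod 12, [u = 1] mod 3 and
    [u + v = 3] mod 4, then quadratic reciprocity applied to the prime factors of [u] and [v] shows
    that [u v] is not a square mod [p]; since [(u / v)^2 = -3], this says that [-3] is not a fourth
    power mod [p].  A root [y] of [y^8 + 360 y^4 - 48] would give one: [y^4 = -180 + 104 w] with
    [w^2 = 3], and [-360 + 208 w = w (1 - w)^6], so [2 w] is a square and [12 = (2 w)^2] and
    [-3 = 12 / (1 + i)^4] are fourth powers.

    Such a prime in the class of [c] mod [M] comes from a Dirichlet-type theorem for the monoid of
    [u + v sqrt(-3)] with [u = 1] mod 3 and norm prime to [M], which has unique factorization, graded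
    by the classes (norm mod [M], [u + v] mod 4) in a finite abelian group [G].  Instead of
    characters, consider the real functions [f] of sum zero on [G] all of whose translates satisfy
    [sum f(a) / N(a) = 0].  Call a class charged when the sum of [Lam(a) / N(a)] over it diverges.
    If no [f <> 0] exists, all classes are charged; in general charged classes generate [G] and
    [f (c k) = - f k] for each charged class [c].  For the integers prime to [M] this makes [f] a
    quadratic character, excluded by Mertens' argument, and Dirichlet's theorem follows.  For the
    monoid above, Dirichlet's theorem gives charged classes over 1 and 7 mod 12; a prime of norm
    7 mod 12 and its conjugate have classes differing by [z = (1, -1)], which forces [f = 0]. *)

(** * Partial sums and summation by parts *)

(** The obstacle is to reach a prescribed class without the L-functions of complex characters; a
    maximum principle replaces them. The sum of [Lam R a / nm a] over a ball is [ln x] up to a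
    bounded error. For [f] as in the overview, Möbius inversion shows that the same sum weighted by
    [f (k * cl a)] is [- f k * ln x] up to a bounded error. Where the absolute value of [f] is
    largest, the two are compatible only if every charged class carries the opposite value. So only
    sign changes survive, and only real characters have to be excluded. Z[sqrt(-3)] adds two
    difficulties. It is not factorial, as 4 = 2 * 2 = (1 + s)(1 - s) with s = sqrt(-3); restricting
    to odd norms avoids this. Its units 1 and -1 have to go, which the condition u = 1 mod 3
    achieves. The value of u + v mod 4 is recorded because the quadratic character of u v modulo p
    depends on it, and Dirichlet's theorem, which sees only norms, cannot prescribe it. *)

Section RealEstimates.
Variable R : realType.
Implicit Types (s u e w phi : nat -> R) (x y n m : nat).

(** The supremum of the lower bounds [u n - e n] serves as [l], since each [u m + e m] is an upper
    bound for them. The error stays explicit at every index. *)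
Lemma limit_of_mutual_error u e :
  (forall m n, (0 < m)%N -> (0 < n)%N -> `|u m - u n| <= e m + e n) ->
  exists l, forall n, (0 < n)%N -> `|u n - l| <= e n.
Proof.
move=> H.
pose E : set R := [set z | exists2 n, (0 < n)%N & z = u n - e n]%classic.
have ubE m : (0 < m)%N -> ubound E (u m + e m).
  move=> m0 z [n n0 ->]; have := H n m n0 m0; rewrite ler_norml => /andP[_ ?]; lra.
have hE : has_sup E.
  split; first by exists (u 1%N - e 1%N); exists 1%N.
  by exists (u 1%N + e 1%N); exact: ubE.
exists (sup E) => n n0; rewrite ler_norml.
have : sup E <= u n + e n by apply: ge_sup; [case: hE | exact: ubE].
have : u n - e n <= sup E by apply: ub_le_sup; [case: hE | exists n].
by move=> ? ?; apply/andP; split; lra.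
Qed.

Definition psum s x := \sum_(1 <= n < x.+1) s n.

Lemma psum0 s : psum s 0 = 0.
Proof. by rewrite /psum big_geq. Qed.

Lemma psumS s x : psum s x.+1 = psum s x + s x.+1.
Proof. by rewrite /psum big_nat_recr. Qed.

Lemma ler_psum s u x : (forall n, (0 < n <= x)%N -> s n <= u n) ->
  psum s x <= psum u x.
Proof. by move=> H; apply: ler_sum_nat => n; rewrite ltnS; exact: H. Qed.

Lemma psum_norm s x : `|psum s x| <= psum (fun n => `|s n|) x.
Proof. exact: ler_norm_sum. Qed.

Lemma psumZ a s x : psum (fun n => a * s n) x = a * psum s x.
Proof. by rewrite /psum mulr_sumr. Qed.

Lemma psum_abel s phi x :
  psum (fun n => s n * phi n) x =
  psum s x * phi x.+1 + psum (fun n => psum s n * (phi n - phi n.+1)) x.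
Proof.
elim: x => [|x IH]; first by rewrite !psum0 mul0r addr0.
rewrite psumS IH [psum (fun n => _ * (_ - _)) x.+1]psumS [psum s x.+1]psumS; ring.
Qed.

(** Summation by parts turns both sides into combinations of partial sums with the same nonnegative
    weights [phi n - phi n.+1]; the right side is the case of the constant sequence [C]. *)
Lemma psum_abel_le s phi (C : R) x :
  (forall n, psum s n <= C * n%:R) ->
  (forall n, (0 < n)%N -> phi n.+1 <= phi n) -> (forall n, 0 <= phi n) ->
  psum (fun n => s n * phi n) x <= C * psum phi x.
Proof.
move=> H1 H2 H3; rewrite -psumZ.
have cst n : psum (fun=> C) n = C * n%:R.
  by rewrite /psum sumr_const_nat subn1 /= mulr_natr.
have -> := psum_abel (fun=> C) phi x.
rewrite psum_abel; apply: lerD; first by apply: ler_wpM2r => //; rewrite cst.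
apply: ler_psum => n /andP[n0 _]; apply: ler_wpM2r; last by rewrite cst.
by rewrite subr_ge0 H2.
Qed.

Definition rt n : R := Num.sqrt n%:R.

Lemma rt_ge0 n : 0 <= rt n. Proof. exact: sqrtr_ge0. Qed.
Lemma rt_gt0 n : (0 < n)%N -> 0 < rt n.
Proof. by move=> n0; rewrite sqrtr_gt0 ltr0n. Qed.
Lemma rt_sqr n : rt n ^+ 2 = n%:R. Proof. by rewrite sqr_sqrtr. Qed.
Lemma ler_rt n m : (n <= m)%N -> rt n <= rt m.
Proof. by move=> nm; rewrite ler_sqrt // ler_nat. Qed.
Lemma rt_ge1 n : (0 < n)%N -> 1 <= rt n.
Proof. by move=> n0; rewrite -(@sqrtr1 R) ler_sqrt // ler1n. Qed.
Lemma rt_le n : rt n <= n%:R.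
Proof.
case: n => [|n]; first by rewrite /rt sqrtr0.
have := rt_ge1 (ltn0Sn n); have := rt_sqr n.+1; nra.
Qed.

Lemma psum_rtV x : psum (fun n => (rt n)^-1) x <= 2 * rt x.
Proof.
elim: x => [|x IH]; first by rewrite psum0 /rt sqrtr0 mulr0.
rewrite psumS.
suff : (rt x.+1)^-1 <= 2 * (rt x.+1 - rt x) by lra.
have p := rt_gt0 (ltn0Sn x); rewrite -div1r ler_pdivrMr //.
have := rt_sqr x; have := rt_sqr x.+1; have := ler_rt (leqnSn x); have := rt_ge0 x.
rewrite -natr1; nra.
Qed.

Definition rt4 n : R := Num.sqrt (rt n).

Lemma rt4_gt0 n : (0 < n)%N -> 0 < rt4 n.
Proof. by move=> n0; rewrite sqrtr_gt0 rt_gt0. Qed.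
Lemma rt4_ge0 n : 0 <= rt4 n. Proof. exact: sqrtr_ge0. Qed.
Lemma rt4_sqr n : rt4 n ^+ 2 = rt n. Proof. by rewrite sqr_sqrtr // rt_ge0. Qed.
Lemma ler_rt4 n m : (n <= m)%N -> rt4 n <= rt4 m.
Proof. by move=> nm; rewrite ler_sqrt // ?rt_ge0 // ler_rt. Qed.

Lemma psum_rt4V x : psum (fun n => (rt4 n ^+ 3)^-1) x <= 4 * rt4 x.
Proof.
elim: x => [|x IH]; first by rewrite psum0 /rt4 /rt !sqrtr0 mulr0.
rewrite psumS.
suff : (rt4 x.+1 ^+ 3)^-1 <= 4 * (rt4 x.+1 - rt4 x) by lra.
have p := rt4_gt0 (ltn0Sn x); rewrite -div1r ler_pdivrMr ?exprn_gt0 //.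
have e : rt4 x.+1 ^+ 4 - rt4 x ^+ 4 = 1.
  by rewrite -[4%N]/(2 * 2)%N !exprM !rt4_sqr !rt_sqr -natr1; ring.
have q := ler_rt4 (leqnSn x); have r := rt4_ge0 x.
move: (rt4 x.+1) (rt4 x) p e q r => a b a0 e ba b0.
rewrite -[leLHS]e.
have -> : a ^+ 4 - b ^+ 4 = (a - b) * (a ^+ 3 + a ^+ 2 * b + a * b ^+ 2 + b ^+ 3) by ring.
have -> : 4 * (a - b) * a ^+ 3 = (a - b) * (4 * a ^+ 3) by ring.
apply: ler_wpM2l; first lra.
have h1 : b ^+ 2 <= a ^+ 2 by rewrite lerXn2r ?nnegrE //; lra.
have h2 : b ^+ 3 <= a ^+ 3 by rewrite lerXn2r ?nnegrE //; lra.
have h3 : a ^+ 2 * b <= a ^+ 3 by rewrite [a ^+ 3]exprSr; apply: ler_wpM2l => //; nra.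
have h4 : a * b ^+ 2 <= a ^+ 3 by rewrite exprS; apply: ler_wpM2l => //; nra.
lra.
Qed.

Lemma rtV_succ n : (0 < n)%N ->
  (rt n * n.+1%:R)^-1 <= 2 * ((rt n)^-1 - (rt n.+1)^-1).
Proof.
move=> n0; have a0 := rt_gt0 n0; have b0 := rt_gt0 (ltn0Sn n).
have ab := ler_rt (leqnSn n); have := rt_sqr n.+1; have := rt_sqr n.
rewrite -natr1; move: (rt n) (rt n.+1) a0 b0 ab => a b a0 b0 ab ea eb.
rewrite -eb -[leLHS]div1r ler_pdivrMr ?mulr_gt0 ?exprn_gt0 //.
have -> : 2 * (a^-1 - b^-1) * (a * b ^+ 2) = 2 * b * (b - a) by field; lra.
nra.
Qed.

Lemma sum_rtV_tail x y : (0 < x)%N -> (x <= y)%N ->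
  \sum_(x.+1 <= n < y.+1) (rt n * n.+1%:R)^-1 <= 2 * (rt x)^-1.
Proof.
move=> x0 xy.
suff : \sum_(x.+1 <= n < y.+1) (rt n * n.+1%:R)^-1 <= 2 * ((rt x.+1)^-1 - (rt y.+1)^-1).
  have : (rt x.+1)^-1 <= (rt x)^-1 by rewrite lef_pV2 ?posrE ?rt_gt0 // ler_rt.
  have : 0 <= (rt y.+1)^-1 by rewrite invr_ge0 rt_ge0.
  lra.
move/subnKC: xy => <-; elim: (y - x)%N => [|k IH].
  by rewrite addn0 big_geq // subrr mulr0.
rewrite addnS big_nat_recr /=; last by lia.
apply: le_trans (lerD IH (rtV_succ _)) _ => //; lra.
Qed.

(** By parts, the difference of two partial sums consists of two boundary terms, at most [C / rt y]
    and [C / rt x], and a tail that [sum_rtV_tail] bounds by [2 * C / rt x]; hence the factor 3. *)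
Lemma psum_inv_cvg s (C : R) : 0 <= C -> (forall n, `|psum s n| <= C * rt n) ->
  exists L, forall x, (0 < x)%N ->
    `|psum (fun n => s n / n%:R) x - L| <= 3 * C / rt x.
Proof.
move=> C0 H; set E := psum (fun n => s n / n%:R).
apply: limit_of_mutual_error => y x.
have bnd n : (0 < n)%N -> `|psum s n / n.+1%:R| <= C / rt n.
  move=> n0; rewrite normrM normfV [X in _ / X]ger0_norm //.
  have p := rt_gt0 n0; rewrite ler_pdivrMr // mulrAC ler_pdivlMr //.
  apply: le_trans (ler_wpM2r (ltW p) (H n)) _.
  rewrite -mulrA; apply: ler_wpM2l => //; rewrite -expr2 rt_sqr ler_nat //.
suff W x' y' : (0 < x')%N -> (x' <= y')%N ->
    `|E y' - E x'| <= 3 * C / rt y' + 3 * C / rt x'.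
  move=> y0 x0; case: (leqP x y) => [xy|/ltnW yx]; first exact: W.
  by rewrite distrC [leRHS]addrC; apply: W.
move=> {x y} x0 xy; move: x' y' x0 xy => x y x0 xy.
have y0 : (0 < y)%N by exact: leq_trans xy.
have e z : E z = psum s z / z.+1%:R + psum (fun n => psum s n * (n%:R^-1 - n.+1%:R^-1)) z.
  exact: (psum_abel s (fun n => n%:R^-1)).
have cat g : psum g y = psum g x + \sum_(x.+1 <= n < y.+1) g n.
  by rewrite /psum -big_cat_nat.
rewrite !e [psum _ y in X in _ + X - _]cat.
set A := (X in `|X + _ - _|); set B := (X in `|_ + (X + _) - _|); set D := (X in `|_ + (_ + X) - _|).
set F := (X in `|_ - (X + _)|).
have hA : `|A| <= C / rt y by exact: bnd.
have hF : `|F| <= C / rt x by exact: bnd.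
have hD : `|D| <= 2 * C / rt x.
  apply: le_trans (ler_norm_sum _ _ _) _.
  rewrite [2 * C]mulrC -mulrA; apply: le_trans _ (ler_wpM2l C0 (sum_rtV_tail x0 xy)).
  rewrite mulr_sumr; apply: ler_sum_nat => n /andP[xn _].
  have n0 : (0 < n)%N by lia.
  have -> : n%:R^-1 - n.+1%:R^-1 = (n%:R * n.+1%:R)^-1 :> R.
    have pn : 0 < n%:R :> R by rewrite ltr0n.
    by rewrite -natr1; field; lra.
  have nn : 0 <= n%:R * n.+1%:R :> R by rewrite -natrM.
  rewrite normrM normfV [X in _ / X]ger0_norm //.
  apply: le_trans (ler_wpM2r _ (H n)) _; first by rewrite invr_ge0.
  rewrite -mulrA; apply: ler_wpM2l => //.
  have p := rt_gt0 n0; rewrite -(rt_sqr n).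
  by rewrite le_eqVlt; apply/orP; left; apply/eqP; field; have := ler0n R n; lra.
have h0 : 0 <= C / rt y by rewrite divr_ge0 // rt_ge0.
have -> : A + (B + D) - (F + B) = A + D - F by ring.
have := ler_normB (A + D) F; have := ler_normD A D; lra.
Qed.

Lemma ln_succ_le n : (0 < n)%N -> ln n.+1%:R - ln n%:R <= n%:R^-1 :> R.
Proof.
move=> n0; have p : 0 < n%:R :> R by rewrite ltr0n.
have q : 0 < n%:R^-1 :> R by rewrite invr_gt0.
rewrite -ln_div ?posrE ?ltr0n //.
have -> : n.+1%:R / n%:R = 1 + n%:R^-1 :> R by rewrite -natr1; field; lra.
apply: le_ln1Dx; lra.
Qed.

Lemma ler_lnn n m : (0 < n)%N -> (n <= m)%N -> ln n%:R <= ln m%:R :> R.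
Proof. by move=> n0 nm; rewrite ler_ln ?posrE ?ltr0n ?ler_nat //; lia. Qed.

Lemma lnn_ge0 n : 0 <= ln n%:R :> R.
Proof. by case: n => [|n]; [rewrite ln0 | apply: ln_ge0; rewrite ler1n]. Qed.

Lemma ln_le_rt n : (0 < n)%N -> ln n.+1%:R <= 4 * rt n.
Proof.
move=> n0; rewrite -(rt_sqr n.+1) lnXn ?rt_gt0 // -mulr_natl.
have := ln_sublinear (rt_gt0 (ltn0Sn n)).
have : rt n.+1 <= 2 * rt n.
  rewrite -(@ler_pXn2r _ 2) ?nnegrE ?mulr_ge0 ?rt_ge0 // exprMn !rt_sqr -natr1.
  have : 1 <= n%:R :> R by rewrite ler1n.
  lra.
lra.
Qed.

Lemma ln_le_rt4 (z : R) : 0 < z -> ln z <= 4 * Num.sqrt (Num.sqrt z).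
Proof.
move=> z0; have p : 0 < Num.sqrt (Num.sqrt z) by rewrite !sqrtr_gt0.
have -> : ln z = ln (Num.sqrt (Num.sqrt z) ^+ 4).
  by rewrite -[4%N]/(2 * 2)%N exprM !sqr_sqrtr ?sqrtr_ge0 ?ltW.
by rewrite lnXn // -[leLHS]mulr_natl ler_pM2l // ltW // ln_sublinear.
Qed.

Lemma psum_inv_ln_bounded s (L D : R) : 0 <= D ->
  (forall x, (0 < x)%N -> `|psum (fun n => s n / n%:R) x - L| <= D / rt x) ->
  forall x, `|psum (fun n => s n / n%:R * ln n%:R) x| <= 12 * D.
Proof.
move=> D0 H [|x]; first by rewrite psum0 normr0 mulr_ge0.
set E := psum (fun n => s n / n%:R) in H *.
have tele y : psum (fun n => ln n%:R - ln n.+1%:R) y = - ln y.+1%:R :> R.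
  elim: y => [|y IH]; first by rewrite psum0 ln1 oppr0.
  by rewrite psumS IH; ring.
rewrite (psum_abel (fun n => s n / n%:R) (fun n => ln n%:R)) -/E.
(* The increments of [ln] telescope, so [E] may be replaced by [E - L] throughout. This makes the
   sum bounded: [E - L] decays like an inverse square root, against a logarithm that is at most
   [4 * rt]. *)
have -> : E x.+1 * ln x.+2%:R + psum (fun n => E n * (ln n%:R - ln n.+1%:R)) x.+1 =
  (E x.+1 - L) * ln x.+2%:R + psum (fun n => (E n - L) * (ln n%:R - ln n.+1%:R)) x.+1.
  have -> : psum (fun n => (E n - L) * (ln n%:R - ln n.+1%:R)) x.+1 =
    psum (fun n => E n * (ln n%:R - ln n.+1%:R)) x.+1 -
      L * psum (fun n => ln n%:R - ln n.+1%:R) x.+1.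
    by rewrite -psumZ /psum -sumrB; apply: eq_bigr => n _; ring.
  rewrite tele; ring.
have h1 : `|(E x.+1 - L) * ln x.+2%:R| <= 4 * D.
  rewrite normrM [`|ln _|]ger0_norm ?lnn_ge0 //.
  have p := rt_gt0 (ltn0Sn x).
  have := ler_pM (normr_ge0 _) (lnn_ge0 _) (H x.+1 isT) (@ln_le_rt x.+1 isT).
  move/le_trans; apply; have -> : D / rt x.+1 * (4 * rt x.+1) = 4 * D by field; lra.
  by [].
have h2 : `|psum (fun n => (E n - L) * (ln n%:R - ln n.+1%:R)) x.+1| <= 8 * D.
  apply: le_trans (psum_norm _ _) _.
  suff : psum (fun n => `|(E n - L) * (ln n%:R - ln n.+1%:R)|) x.+1 <=
         D * (2 * psum (fun n => (rt n * n.+1%:R)^-1) x.+1).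
    move/le_trans; apply.
    rewrite [8 * D]mulrC; apply: ler_wpM2l => //.
    suff : psum (fun n => (rt n * n.+1%:R)^-1) x.+1 <= 4 by lra.
    rewrite /psum big_ltn //.
    have := @sum_rtV_tail 1 x.+1 isT isT.
    have -> : rt 1 = 1 by rewrite /rt sqrtr1.
    rewrite invr1 mul1r; lra.
  rewrite -!psumZ; apply: ler_psum => n /andP[n0 _].
  rewrite normrM; have p := rt_gt0 n0.
  have nR : 1 <= n%:R :> R by rewrite ler1n.
  apply: le_trans (ler_pM (normr_ge0 _) (normr_ge0 _) (H n n0) (_ : _ <= n%:R^-1)) _.
    rewrite distrC ger0_norm ?subr_ge0 ?ler_lnn // ln_succ_le //.
  rewrite -mulrA; apply: ler_wpM2l => //.
  rewrite invfM mulrCA; apply: ler_wpM2l; first by rewrite invr_ge0 ltW.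
  rewrite -[leLHS]div1r ler_pdivrMr ?ltr0n // mulrAC ler_pdivlMr ?ltr0n // -natr1; lra.
have := ler_normD ((E x.+1 - L) * ln x.+2%:R) (psum (fun n => (E n - L) * (ln n%:R - ln n.+1%:R)) x.+1).
lra.
Qed.

Lemma psum_ln_asymp s (A C : R) : 0 <= A -> 0 <= C ->
  (forall n, `|psum s n - A * n%:R| <= C * rt n) ->
  forall x, (0 < x)%N ->
    `|psum (fun n => s n * ln n%:R) x - A * x%:R * ln x%:R| <= (2 * A + 5 * C) * x%:R.
Proof.
move=> A0 C0 H x x0; rewrite psum_abel.
set D := psum (fun n => psum s n * _) x.
have hD : `|D| <= (A + C) * x%:R.
  rewrite /D; apply: le_trans (psum_norm _ _) _.
  have -> : (A + C) * x%:R = psum (fun=> A + C) x.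
    by rewrite /psum sumr_const_nat subn1 mulr_natr.
  apply: ler_psum => n /andP[n0 _].
  have p : 0 < n%:R :> R by rewrite ltr0n.
  rewrite normrM distrC [X in _ * X]ger0_norm ?subr_ge0 ?ler_lnn //.
  have h : `|psum s n| <= (A + C) * n%:R.
    have := ler_normD (psum s n - A * n%:R) (A * n%:R); rewrite subrK.
    rewrite [`|A * _|]ger0_norm ?mulr_ge0 //; have := H n.
    have := ler_wpM2l C0 (rt_le n); lra.
  apply: le_trans (ler_pM (normr_ge0 _) _ h (ln_succ_le n0)) _.
    by rewrite subr_ge0 ler_lnn.
  by rewrite mulfK // gt_eqF.
have -> : psum s x * ln x.+1%:R + D - A * x%:R * ln x%:R =
  (psum s x - A * x%:R) * ln x.+1%:R + A * x%:R * (ln x.+1%:R - ln x%:R) + D by ring.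
have h1 : `|(psum s x - A * x%:R) * ln x.+1%:R| <= 4 * C * x%:R.
  rewrite normrM [`|ln _|]ger0_norm ?lnn_ge0 //.
  have := ler_pM (normr_ge0 _) (lnn_ge0 _) (H x) (ln_le_rt x0).
  have := rt_sqr x; move=> e; have -> : C * rt x * (4 * rt x) = 4 * C * x%:R by rewrite -e; ring.
  by [].
have h2 : `|A * x%:R * (ln x.+1%:R - ln x%:R)| <= A * x%:R.
  rewrite ger0_norm ?mulr_ge0 // ?subr_ge0 ?ler_lnn //.
  apply: ler_piMr; first by rewrite mulr_ge0.
  apply: le_trans (ln_succ_le x0) _; rewrite invf_le1 ?ltr0n // ler1n //.
have := ler_normD ((psum s x - A * x%:R) * ln x.+1%:R + A * x%:R * (ln x.+1%:R - ln x%:R)) D.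
have := ler_normD ((psum s x - A * x%:R) * ln x.+1%:R) (A * x%:R * (ln x.+1%:R - ln x%:R)).
lra.
Qed.

Lemma rt_divn x n : (0 < n <= x)%N -> (rt (x %/ n))^-1 <= 2 * rt n / rt x.
Proof.
move=> /andP[n0 nx]; have x0 : (0 < x)%N by lia.
have q0 : (0 < x %/ n)%N by rewrite divn_gt0.
have p := rt_gt0 q0; have px := rt_gt0 x0.
rewrite -[leLHS]div1r ler_pdivrMr // mulrAC ler_pdivlMr // mul1r.
rewrite -(@ler_pXn2r _ 2) ?nnegrE ?mulr_ge0 ?rt_ge0 // !exprMn !rt_sqr -!natrX -!natrM ler_nat.
have := divn_eq x n; have := ltn_pmod x n0; nia.
Qed.

Lemma psum_div_error w (C : R) x : 0 <= C -> (forall n, 0 <= w n) ->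
  (forall n, psum w n <= C * n%:R) ->
  psum (fun n => w n / n%:R / rt (x %/ n)) x <= 4 * C.
Proof.
move=> C0 w0 H; case: (posnP x) => [->|x0]; first by rewrite psum0 mulr_ge0.
have p := rt_gt0 x0.
apply: (@le_trans _ _ (2 / rt x * psum (fun n => w n * (rt n)^-1) x)).
  rewrite -psumZ; apply: ler_psum => n nx.
  apply: le_trans (ler_wpM2l _ (rt_divn nx)) _; first by rewrite divr_ge0.
  case/andP: nx => n0 _; rewrite -(rt_sqr n); have := rt_gt0 n0; move: (rt n) => a a0.
  by rewrite le_eqVlt; apply/orP; left; apply/eqP; field; lra.
have := @psum_abel_le w (fun n => (rt n)^-1) C x H.
have -> : 4 * C = 2 / rt x * (C * (2 * rt x)) by field; lra.
move=> h; apply: ler_wpM2l; first by rewrite divr_ge0 // ltW.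
apply: le_trans (h _ _) _.
- by move=> n n0; rewrite lef_pV2 ?posrE ?rt_gt0 // ler_rt.
- by move=> n; rewrite invr_ge0 rt_ge0.
by apply: ler_wpM2l => //; exact: psum_rtV.
Qed.

(** The logarithm is bounded by 4 times the fourth root of [x / n], so the summand is at most
    [8 / rt4 x] times [w n / rt4 n ^+ 3]; [psum_rt4V] contributes the remaining factor 4. *)
Lemma psum_div_ln_error w (C : R) x : 0 <= C -> (forall n, 0 <= w n) ->
  (forall n, psum w n <= C * n%:R) ->
  psum (fun n => w n / n%:R * ln (x%:R / n%:R) / rt (x %/ n)) x <= 32 * C.
Proof.
move=> C0 w0 H; case: (posnP x) => [->|x0]; first by rewrite psum0 mulr_ge0.
have p := rt4_gt0 x0.
apply: (@le_trans _ _ (8 / rt4 x * psum (fun n => w n * (rt4 n ^+ 3)^-1) x)).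
  rewrite -psumZ; apply: ler_psum => n nx.
  have l0 : 0 <= ln (x%:R / n%:R) :> R.
    by apply: ln_ge0; case/andP: nx => n0 nx; rewrite ler_pdivlMr ?ltr0n // mul1r ler_nat.
  apply: le_trans (ler_wpM2l _ (rt_divn nx)) _.
    by rewrite mulr_ge0 // divr_ge0.
  case/andP: nx => n0 nx; have q := rt4_gt0 n0.
  have l1 : ln (x%:R / n%:R) <= 4 * (rt4 x / rt4 n).
    apply: le_trans (ln_le_rt4 _) _; first by rewrite divr_gt0 ?ltr0n.
    by rewrite !sqrtrM ?sqrtrV ?sqrtr_ge0 ?sqrtrV ?sqrtr_ge0.
  apply: (@le_trans _ _ (w n / n%:R * (4 * (rt4 x / rt4 n)) * (2 * rt n / rt x))).
    apply: ler_wpM2r; first by rewrite divr_ge0 ?mulr_ge0 ?rt_ge0.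
    by apply: ler_wpM2l => //; rewrite divr_ge0.
  rewrite -(rt_sqr n) -!rt4_sqr -exprM.
  by rewrite le_eqVlt; apply/orP; left; apply/eqP; field; lra.
have -> : 32 * C = 8 / rt4 x * (C * (4 * rt4 x)) by field; lra.
apply: ler_wpM2l; first by rewrite divr_ge0 // ltW.
apply: le_trans (@psum_abel_le w (fun n => (rt4 n ^+ 3)^-1) C x H _ _) _.
- by move=> n n0; rewrite lef_pV2 ?posrE ?exprn_gt0 ?rt4_gt0 // lerXn2r ?nnegrE ?rt4_ge0 // ler_rt4.
- by move=> n; rewrite invr_ge0 exprn_ge0 // rt4_ge0.
by apply: ler_wpM2l => //; exact: psum_rt4V.
Qed.

End RealEstimates.

(** * Normed monoids with unique factorization *)

Definition irreducible_in (T : Type) (mul : T -> T -> T) (e p : T) :=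
  p <> e /\ forall a b, p = mul a b -> a = e \/ b = e.

(** Only the identity has norm 1, so there are no units to divide out, and [um_euclid] says that
    irreducibles are prime. The list [el n] of all elements of norm [n] turns every sum over bounded
    norm into a finite big operator. *)
Record normUFD := NormUFD {
  carrier :> choiceType;
  um : carrier -> carrier -> carrier;
  u1 : carrier;
  nm : carrier -> nat;
  el : nat -> seq carrier;
  umA : associative um;
  umC : commutative um;
  u1m : left_id u1 um;
  umI : right_injective um;
  nmM : {morph nm : a b / um a b >-> (a * b)%N};
  nm_gt0 : forall a, (0 < nm a)%N;
  nm_eq1 : forall a, nm a = 1%N -> a = u1;
  el_uniq : forall n, uniq (el n);
  mem_el : forall n a, (a \in el n) = (nm a == n);
  um_euclid : forall p a b c, irreducible_in um u1 p -> um a b = um p c ->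
    (exists d, a = um p d) \/ (exists d, b = um p d) }.

Section NormUFDTheory.
Variable T : normUFD.
Implicit Types (a b c d p : T) (n x : nat).
Local Notation "a ** b" := (um a b) (at level 40, left associativity).
Local Notation "'e1" := (u1 T).

Lemma um1 a : a ** 'e1 = a. Proof. by rewrite umC u1m. Qed.

Lemma umCA a b c : a ** (b ** c) = b ** (a ** c).
Proof. by rewrite !umA (umC a). Qed.

Lemma nm1 : nm 'e1 = 1%N.
Proof. by have := nmM 'e1 'e1; have := nm_gt0 'e1; rewrite u1m; nia. Qed.

Lemma nm_gt1 a : a <> 'e1 -> (1 < nm a)%N.
Proof. by move=> a1; rewrite ltn_neqAle nm_gt0 andbT; apply/eqP => /esym/nm_eq1. Qed.

Definition ball x : seq T := flatten [seq el T n | n <- index_iota 1 x.+1].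

Lemma mem_ball x a : (a \in ball x) = (nm a <= x)%N.
Proof.
apply/flattenP/idP => [[s /mapP[n]]|ax].
  by rewrite mem_index_iota => nx -> ; rewrite mem_el => /eqP ->; lia.
exists (el T (nm a)); last by rewrite mem_el.
by apply/mapP; exists (nm a) => //; rewrite mem_index_iota nm_gt0.
Qed.

Lemma ball_uniq x : uniq (ball x).
Proof.
rewrite /ball; have := iota_uniq 1 (x.+1 - 1); rewrite -/(index_iota 1 x.+1).
elim: (index_iota 1 x.+1) => //= n s IH /andP[ns us].
rewrite cat_uniq el_uniq IH // andbT /=; apply/hasPn => a /flattenP[t /mapP[m ms ->]].
by rewrite !mem_el => /eqP ->; apply: contraNN ns => /eqP <-.
Qed.

Lemma sum_ball (V : nmodType) (F : T -> V) x :
  \sum_(a <- ball x) F a = \sum_(1 <= n < x.+1) \sum_(a <- el T n) F a.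
Proof. by rewrite /ball big_flatten big_map. Qed.

Definition udvd a b := b \in [seq a ** c | c <- ball (nm b)].

Lemma udvdP a b : reflect (exists c, b = a ** c) (udvd a b).
Proof.
apply: (iffP mapP) => [[c _ ->]|[c ->]]; first by exists c.
by exists c => //; rewrite mem_ball nmM leq_pmull // nm_gt0.
Qed.

Lemma udvd_leq a b : udvd a b -> (nm a <= nm b)%N.
Proof. by move=> /udvdP[c ->]; rewrite nmM leq_pmulr // nm_gt0. Qed.

Lemma udvd_mulr a b : udvd a (a ** b). Proof. by apply/udvdP; exists b. Qed.
Lemma udvd_mull a b : udvd a (b ** a). Proof. by rewrite umC udvd_mulr. Qed.
Lemma udvd_refl a : udvd a a. Proof. by rewrite -{2}[a]um1 udvd_mulr. Qed.

Lemma udvd_trans a b c : udvd a b -> udvd b c -> udvd a c.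
Proof. by move=> /udvdP[d ->] /udvdP[e ->]; rewrite -umA udvd_mulr. Qed.

Lemma udvd1 a : udvd a 'e1 -> a = 'e1.
Proof. by move/udvd_leq; rewrite nm1 => h; apply: nm_eq1; have := nm_gt0 a; lia. Qed.

Definition uirr p := `[< irreducible_in (@um T) 'e1 p >].

Lemma uirr_neq1 p : uirr p -> p <> 'e1. Proof. by move=> /asboolP[]. Qed.

Lemma uirr_euclid p a b : uirr p -> udvd p (a ** b) = udvd p a || udvd p b.
Proof.
move=> pp; apply/idP/orP => [/udvdP[c e]|[]].
- by move/asboolP: pp => /um_euclid - /(_ a b c e) [[d ->]|[d ->]]; [left|right]; rewrite udvd_mulr.
- by move/udvd_trans; apply; rewrite udvd_mulr.
- by move/udvd_trans; apply; rewrite udvd_mull.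
Qed.

Lemma uirr_dvd p a : uirr p -> udvd a p -> a = 'e1 \/ a = p.
Proof.
move=> /asboolP[_ H] /udvdP[c e]; case: (H a c e); first by left.
by right; rewrite e b um1.
Qed.

Lemma exists_uirr a : a <> 'e1 -> exists2 p, uirr p & udvd p a.
Proof.
elim: {a}_.+1 {-2}a (ltnSn (nm a)) => // n IH a an a1.
case: (pselect (uirr a)) => [ia|nia]; first by exists a => //; exact: udvd_refl.
have [b [c [e b1 c1]]] : exists b c, [/\ a = b ** c, b <> 'e1 & c <> 'e1].
  apply: contrapT => H; apply: nia; apply/asboolP; split => // b c e.
  apply: contrapT => /not_orP[b1 c1]; apply: H; by exists b, c.
have [|p pp pb] := IH b _ b1.
  by have := nm_gt1 c1; have := nm_gt0 b; move: an; rewrite e nmM; nia.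
by exists p => //; apply: udvd_trans pb _; rewrite e udvd_mulr.
Qed.

Definition upow p k := iter k (um p) 'e1.

Lemma upowD p j k : upow p (j + k) = upow p j ** upow p k.
Proof. by elim: j => [|j IH] /=; [rewrite u1m | rewrite IH umA]. Qed.

Lemma nm_upow p k : nm (upow p k) = (nm p ^ k)%N.
Proof. by elim: k => [|k IH] /=; rewrite ?nm1 // nmM IH expnS. Qed.

Lemma upow_decomp p a : p <> 'e1 -> exists k b, a = upow p k ** b /\ ~~ udvd p b.
Proof.
move=> p1; elim: {a}_.+1 {-2}a (ltnSn (nm a)) => // n IH a an.
case: (boolP (udvd p a)) => [/udvdP[c e]|nd]; last first.
  by exists 0%N, a; rewrite /= u1m.
have [|k [b [ec nb]]] := IH c.
  by move: an; rewrite e nmM; have := nm_gt1 p1; have := nm_gt0 c; nia.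
by exists k.+1, b; rewrite e ec /= umA.
Qed.

Lemma upow_decomp_inj p j k a b : ~~ udvd p a -> ~~ udvd p b ->
  upow p j ** a = upow p k ** b -> j = k /\ a = b.
Proof.
move=> na nb; elim: j k => [|j IH] [|k] /=; rewrite ?u1m //.
- by move=> ea; rewrite ea -umA udvd_mulr in na.
- by move=> ea; rewrite -ea -umA udvd_mulr in nb.
- by rewrite -!umA => /umI/IH[-> ->].
Qed.

Definition divs a := [seq d <- ball (nm a) | udvd d a].

Lemma mem_divs a d : (d \in divs a) = udvd d a.
Proof. by rewrite mem_filter mem_ball; case: (boolP (udvd d a)) => // /udvd_leq. Qed.

Lemma divs_uniq a : uniq (divs a). Proof. by rewrite filter_uniq // ball_uniq. Qed.

Lemma divs_decomp p k b : uirr p -> ~~ udvd p b ->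
  perm_eq (divs (upow p k ** b)) [seq upow p j ** d | j <- iota 0 k.+1, d <- divs b].
Proof.
move=> pp nb; have p1 := uirr_neq1 pp.
have ndd d : udvd d b -> ~~ udvd p d.
  by move=> db; apply: contraNN nb => /udvd_trans; apply.
apply: uniq_perm; first exact: divs_uniq.
  apply: allpairs_uniq_dep => [|j _|]; [exact: iota_uniq | exact: divs_uniq | ].
  move=> [i d] [j e] /allpairsPdep[i' [d' [_ d'b [-> ->]]]] /allpairsPdep[j' [e' [_ e'b [-> ->]]]] /=.
  rewrite !mem_divs in d'b e'b.
  by move/(upow_decomp_inj (ndd _ d'b) (ndd _ e'b)) => [-> ->].
move=> d; rewrite mem_divs; apply/idP/allpairsPdep => [/udvdP[e]|[j [d' [jk d'b ->]]]].
  have [j [d' [-> nd']]] := upow_decomp d p1.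
  have [i [e' [-> ne']]] := upow_decomp e p1.
  move=> E.
  have {}E : upow p k ** b = upow p (j + i) ** (d' ** e').
    by rewrite E upowD -!umA; congr (_ ** _); rewrite umCA.
  have nde : ~~ udvd p (d' ** e') by rewrite uirr_euclid // negb_or nd' ne'.
  have [-> ->] := upow_decomp_inj nb nde E.
  by exists j, d'; split => //; [rewrite mem_iota; lia | rewrite mem_divs udvd_mulr].
move: jk d'b; rewrite mem_iota mem_divs => jk /udvdP[e ->].
apply/udvdP; exists (upow p (k - j) ** e).
have -> : upow p k = upow p j ** upow p (k - j) by rewrite -upowD subnKC //; lia.
by rewrite -!umA; congr (_ ** _); rewrite umCA.
Qed.

Lemma big_divs_decomp (V : nmodType) (F : T -> V) p k b : uirr p -> ~~ udvd p b ->
  \sum_(d <- divs (upow p k ** b)) F d =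
  \sum_(0 <= j < k.+1) \sum_(d <- divs b) F (upow p j ** d).
Proof.
move=> pp nb; rewrite (perm_big _ (divs_decomp k pp nb)).
by rewrite big_allpairs_dep /index_iota subn0.
Qed.

Lemma divs1 : divs 'e1 = [:: 'e1].
Proof.
apply: perm_small_eq => //; apply: uniq_perm => //; first exact: divs_uniq.
move=> d; rewrite mem_divs inE; apply/idP/eqP => [/udvd1 //|->]; exact: udvd_refl.
Qed.

(** The interchange behind Dirichlet convolutions: cancellation makes the cofactor [e] of [d]
    unique, and [nm a <= x] becomes [nm e <= x %/ nm d]. *)
Lemma sum_ball_divs (V : nmodType) (F : T -> T -> V) x :
  \sum_(a <- ball x) \sum_(d <- divs a) F d a =
  \sum_(d <- ball x) \sum_(e <- ball (x %/ nm d)) F d (d ** e).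
Proof.
transitivity (\sum_(a <- ball x) \sum_(d <- ball x | udvd d a) F d a).
  rewrite big_seq [RHS]big_seq; apply: eq_bigr => a; rewrite mem_ball => ax.
  rewrite -[RHS]big_filter; apply: perm_big; apply: uniq_perm.
  - exact: divs_uniq.
  - by rewrite filter_uniq // ball_uniq.
  move=> d; rewrite mem_divs mem_filter mem_ball.
  by case: (boolP (udvd d a)) => // /udvd_leq h /=; rewrite (leq_trans h).
rewrite (exchange_big_dep xpredT) //=; apply: eq_bigr => d _.
rewrite -big_filter -(big_map (um d) xpredT (F d)); apply: perm_big.
apply: uniq_perm; first by rewrite filter_uniq // ball_uniq.
  by rewrite map_inj_uniq ?ball_uniq //; exact: umI.
move=> a; rewrite mem_filter mem_ball; apply/andP/mapP => [[/udvdP[e ->]]|[e eb ->]].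
  by rewrite nmM => h; exists e => //; rewrite mem_ball leq_divRL ?nm_gt0 // mulnC.
rewrite udvd_mulr; split => //.
by move: eb; rewrite mem_ball leq_divRL ?nm_gt0 // nmM mulnC.
Qed.

Definition usqfree a := `[< forall p, uirr p -> ~~ udvd (p ** p) a >].
Definition uomega a := size [seq p <- ball (nm a) | uirr p && udvd p a].

Lemma uomega_decomp p j b : uirr p -> ~~ udvd p b ->
  uomega (upow p j.+1 ** b) = (uomega b).+1.
Proof.
move=> pp nb.
rewrite /uomega -[RHS]/(size (p :: [seq q <- ball (nm b) | uirr q && udvd q b])).
apply: perm_size; apply: uniq_perm; first by rewrite filter_uniq // ball_uniq.
  by rewrite /= filter_uniq ?ball_uniq // mem_filter (negbTE nb) andbF.
move=> q; rewrite inE !mem_filter !mem_ball.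
have E c : [&& uirr q && udvd q c & (nm q <= nm c)%N] = uirr q && udvd q c.
  by case: (boolP (udvd q c)) => [/udvd_leq ->|_]; rewrite ?andbF ?andbT.
rewrite !E; case: (boolP (uirr q)) => [iq|niq] /=; last first.
  by rewrite orbF; apply/esym/negbTE/eqP => qp; rewrite qp pp in niq.
have -> : udvd q (upow p j.+1 ** b) = (q == p) || udvd q b; last by [].
rewrite uirr_euclid //; congr (_ || _); apply/idP/eqP => [|->]; last by rewrite /= udvd_mulr.
elim: j.+1 => [/udvd1 q1|i IH] /=; first by case: (uirr_neq1 iq).
by rewrite uirr_euclid // => /orP[/(uirr_dvd pp)[/(uirr_neq1 iq)|]|].
Qed.

End NormUFDTheory.

(** * The Möbius and von Mangoldt functions *)

Section Arithmetic.
Variables (R : realType) (T : normUFD).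
Implicit Types (a b c d p : T) (n x : nat).
Local Notation "a ** b" := (um a b) (at level 40, left associativity).
Local Notation "'e1" := (u1 T).

Definition umu a : R := if usqfree a then (-1) ^+ uomega a else 0.

Lemma umu_norm a : `|umu a| <= 1.
Proof. by rewrite /umu; case: ifP; rewrite ?normr0 // normrX normrN1 expr1n. Qed.

Lemma umu1 : umu 'e1 = 1.
Proof.
rewrite /umu; have -> : usqfree 'e1.
  by apply/asboolP => p pp; apply/negP => /udvd1 /(congr1 (@nm T));
     rewrite nmM nm1; have := nm_gt1 (uirr_neq1 pp); nia.
rewrite /uomega (@eq_in_filter _ _ pred0) ?filter_pred0 // => p _ /=.
by apply/negbTE/negP => /andP[pp /udvd1/(uirr_neq1 pp)].
Qed.

Lemma umu_irr p b : uirr p -> ~~ udvd p b -> umu (p ** b) = - umu b.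
Proof.
move=> pp nb; rewrite /umu.
have -> : usqfree (p ** b) = usqfree b.
  apply/asboolP/asboolP => H q qq; apply: contraTN isT => /udvdP[c].
    by move=> e; have /negP[] := H q qq; rewrite e; apply/udvdP; exists (p ** c); rewrite umCA.
  move=> e; case: (eqVneq q p) => [qp|qp].
    by move: e nb; rewrite qp -umA => /umI ->; rewrite udvd_mulr.
  have : udvd q (p ** b) by rewrite e -umA udvd_mulr.
  rewrite uirr_euclid // => /orP[/(uirr_dvd pp)[/(uirr_neq1 qq)//|/eqP]|].
    by rewrite (negbTE qp).
  move/udvdP => [d db]; move: e; rewrite db umCA -umA => /umI e.
  have : udvd q (p ** d) by rewrite e udvd_mulr.
  rewrite uirr_euclid // => /orP[/(uirr_dvd pp)[/(uirr_neq1 qq)//|/eqP]|].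
    by rewrite (negbTE qp).
  move/udvdP => [f fd]; have /negP[] := H q qq; rewrite db fd umA; exact: udvd_mulr.
have := @uomega_decomp T p 0 b pp nb; rewrite /= um1 => ->.
by case: ifP; rewrite ?oppr0 // exprS mulN1r.
Qed.

Lemma umu_sqr p j b : uirr p -> umu (upow p j.+2 ** b) = 0.
Proof.
move=> pp; rewrite /umu; case: ifP => // /asboolP/(_ p pp)/negP[].
by apply/udvdP; exists (upow p j ** b); rewrite -[upow p j.+2]/(p ** (p ** upow p j)) !umA.
Qed.

Lemma sum_divs_umu a : \sum_(d <- divs a) umu d = (a == 'e1)%:R.
Proof.
case: eqP => [->|a1]; first by rewrite divs1 big_seq1 umu1.
have [p pp pa] := exists_uirr a1.
have [k [b [e nb]]] := upow_decomp a (uirr_neq1 pp).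
case: k e => [e|k e]; first by move: pa; rewrite e u1m (negbTE nb).
rewrite e big_divs_decomp // big_ltn // big_ltn //= [X in _ + (_ + X)]big1_seq.
  rewrite addr0 -big_split /= big_seq big1 // => d; rewrite mem_divs => db.
  rewrite u1m um1 umu_irr ?addrN //; by apply: contraNN nb => /udvd_trans; apply.
move=> [|[|j]] /andP[_]; rewrite mem_index_iota // => _; apply: big1 => d _; exact: umu_sqr.
Qed.

(** The von Mangoldt function. Summing over all irreducibles of which [a] is a power avoids choosing
    one; by [upow_uirr_inj] at most one term occurs. *)
Definition Lam a : R :=
  \sum_(p <- ball T (nm a) | uirr p && `[< exists k, a = upow p k.+1 >]) ln (nm p)%:R.

Lemma Lam_ge0 a : 0 <= Lam a.
Proof. by apply: sumr_ge0 => p _; exact: lnn_ge0. Qed.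

Lemma upow_uirr_inj p q i j : uirr p -> uirr q -> upow p i.+1 = upow q j.+1 -> p = q.
Proof.
move=> pp qq e; have : udvd p (upow q j.+1) by rewrite -e udvd_mulr.
elim: j.+1 => [/udvd1/(uirr_neq1 pp) //|n IH] /=.
by rewrite uirr_euclid // => /orP[/(uirr_dvd qq)[/(uirr_neq1 pp)|]|].
Qed.

Lemma Lam_upow p k : uirr p -> Lam (upow p k.+1) = ln (nm p)%:R.
Proof.
move=> pp; rewrite /Lam -big_filter.
rewrite (_ : [seq _ <- _ | _] = [:: p]) ?big_seq1 //.
apply: perm_small_eq => //; apply: uniq_perm => //; first by rewrite filter_uniq // ball_uniq.
move=> q; rewrite mem_filter mem_ball inE; apply/idP/eqP => [|->].
  by move=> /andP[/andP[qq /asboolP[j e]] _]; exact: upow_uirr_inj (esym e).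
rewrite pp andTb nm_upow expnS leq_pmulr ?expn_gt0 ?nm_gt0 // andbT.
by apply/asboolP; exists k.
Qed.

Lemma Lam_neq0 a : Lam a != 0 -> exists p k, uirr p /\ a = upow p k.+1.
Proof.
move=> L; apply: contrapT => H; move/eqP: L; apply; apply: big1 => p /andP[pp /asboolP[k e]].
by case: H; exists p, k.
Qed.

Lemma Lam_decomp p j b : uirr p -> ~~ udvd p b -> b <> 'e1 -> Lam (upow p j.+1 ** b) = 0.
Proof.
move=> pp nb b1; apply/eqP/contraT => /Lam_neq0 [q [k [qq e]]].
have pq : p = q.
  have : udvd p (upow q k.+1) by rewrite -e /= -umA udvd_mulr.
  elim: k.+1 => [/udvd1/(uirr_neq1 pp) //|n IH] /=.
  by rewrite uirr_euclid // => /orP[/(uirr_dvd qq)[/(uirr_neq1 pp)|]|].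
case: b1; move: e; rewrite -pq -[upow p k.+1]um1 => /upow_decomp_inj[]//.
by apply/negP => /udvd1/(uirr_neq1 pp).
Qed.

Lemma Lam1 : Lam 'e1 = 0.
Proof.
apply/eqP/contraT => /Lam_neq0 [q [k [qq e]]]; case: (uirr_neq1 qq).
by apply: udvd1; rewrite e /= udvd_mulr.
Qed.

Lemma lnM_nm a b : ln (nm (a ** b))%:R = ln (nm a)%:R + ln (nm b)%:R :> R.
Proof. by rewrite nmM natrM lnM // posrE ltr0n nm_gt0. Qed.

Lemma sum_divs_Lam a : \sum_(d <- divs a) Lam d = ln (nm a)%:R.
Proof.
elim: {a}_.+1 {-2}a (ltnSn (nm a)) => // n IH a an.
case: (eqVneq a 'e1) => [->|/eqP a1]; first by rewrite divs1 big_seq1 Lam1 nm1 ln1.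
have [p pp pa] := exists_uirr a1.
have [k [b [e nb]]] := upow_decomp a (uirr_neq1 pp).
case: k e => [e|k e]; first by move: pa; rewrite e u1m (negbTE nb).
have bn : (nm b < n)%N.
  move: an; rewrite e nmM nm_upow expnS; have := nm_gt1 (uirr_neq1 pp); have := nm_gt0 b.
  have : (0 < nm p ^ k)%N by rewrite expn_gt0 nm_gt0.
  move: (nm p) (nm b) (nm p ^ k)%N => A B C C0 B0 A1.
  have : (2 * 1 * B <= A * C * B)%N by rewrite !leq_mul.
  lia.
rewrite e big_divs_decomp // big_ltn //.
have -> : \sum_(d <- divs b) Lam (upow p 0 ** d) = ln (nm b)%:R.
  by rewrite -IH //; apply: eq_bigr => d _; rewrite /= u1m.
rewrite lnM_nm nm_upow natrX lnXn ?ltr0n ?nm_gt0 // addrC; congr (_ + _).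
rewrite big_add1 /= (eq_bigr (fun=> ln (nm p)%:R)); last first.
  move=> j _; rewrite (bigD1_seq 'e1) ?divs_uniq ?mem_divs //; last first.
    by apply/udvdP; exists b; rewrite u1m.
  rewrite um1 Lam_upow // big_seq_cond big1 /= ?addr0 //.
  move=> d /andP[]; rewrite mem_divs => db /eqP d1; apply: (@Lam_decomp p j d) => //.
  by apply: contraNN nb => /udvd_trans; apply.
by rewrite sumr_const_nat subn0.
Qed.

Lemma sum_divs_umu_ln a : \sum_(d <- divs a) umu d * ln (nm d)%:R = - Lam a.
Proof.
case: (eqVneq a 'e1) => [->|/eqP a1].
  by rewrite divs1 big_seq1 Lam1 nm1 ln1 mulr0 oppr0.
have [p pp pa] := exists_uirr a1.
have [k [b [e nb]]] := upow_decomp a (uirr_neq1 pp).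
case: k e => [e|k e]; first by move: pa; rewrite e u1m (negbTE nb).
rewrite e big_divs_decomp // big_ltn // big_ltn //= [X in _ + (_ + X)]big1_seq.
  rewrite addr0 -big_split /= big_seq.
  rewrite (eq_bigr (fun d => - ln (nm p)%:R * umu d)).
    rewrite -big_seq -mulr_sumr sum_divs_umu; case: (eqVneq b 'e1) => [->|/eqP b1].
      by rewrite um1 -[p ** _]/(upow p k.+1) Lam_upow // mulr1.
    by rewrite -[p ** _]/(upow p k.+1) Lam_decomp // mulr0 oppr0.
  move=> d; rewrite mem_divs => db.
  rewrite u1m um1 umu_irr ?lnM_nm //; last by apply: contraNN nb => /udvd_trans; apply.
  ring.
by move=> [|[|j]] /andP[_]; rewrite mem_index_iota // => _; apply: big1 => d _; rewrite umu_sqr // mul0r.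
Qed.

End Arithmetic.

(** * Charged classes *)

Section ClassDistribution.
Variables (R : realType) (T : normUFD) (gT : finGroupType) (cl : T -> gT).
Variables (A Cc CL : R).
Hypothesis gTC : forall g h : gT, (g * h = h * g)%g.
Hypothesis clM : forall a b, cl (um a b) = (cl a * cl b)%g.
Hypothesis A0 : 0 < A.
Hypothesis Cc0 : 0 <= Cc.
Hypothesis count_cl : forall g x,
  `|\sum_(a <- ball T x | cl a == g) 1 - A * x%:R| <= Cc * rt R x.
Hypothesis CL0 : 0 <= CL.
Hypothesis sum_Lam : forall x, \sum_(a <- ball T x) Lam R a <= CL * x%:R.

Implicit Types (f : gT -> R) (g h k c : gT) (x n : nat) (a b d : T).

Lemma sum_ball_psum (F : T -> R) (phi : nat -> R) x :
  \sum_(a <- ball T x) F a * phi (nm a) =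
  psum (fun n => (\sum_(a <- el T n) F a) * phi n) x.
Proof.
rewrite sum_ball; apply: eq_bigr => n _; rewrite mulr_suml big_seq [RHS]big_seq.
by apply: eq_bigr => a; rewrite mem_el => /eqP ->.
Qed.

Lemma psum_el (F : T -> R) x : psum (fun n => \sum_(a <- el T n) F a) x = \sum_(a <- ball T x) F a.
Proof. by rewrite sum_ball. Qed.

Definition mean f x := \sum_(a <- ball T x) f (cl a) / (nm a)%:R.
Definition l1 f := \sum_g `|f g|.

Lemma l1_ge0 f : 0 <= l1 f. Proof. exact: sumr_ge0. Qed.

Lemma sum_ball_class (F : T -> R) (G : gT -> R) x :
  \sum_(a <- ball T x) F a * G (cl a) =
  \sum_g G g * \sum_(a <- ball T x | cl a == g) F a.
Proof.
rewrite (partition_big cl xpredT) //=; apply: eq_bigr => g _.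
rewrite mulr_sumr; apply: eq_bigr => a /eqP ->; exact: mulrC.
Qed.

Lemma sum_class_bound f x : \sum_g f g = 0 ->
  `|\sum_(a <- ball T x) f (cl a)| <= Cc * l1 f * rt R x.
Proof.
move=> f0; have -> : \sum_(a <- ball T x) f (cl a) =
    \sum_g f g * (\sum_(a <- ball T x | cl a == g) 1 - A * x%:R).
  under [RHS]eq_bigr do rewrite mulrBr.
  rewrite sumrB -mulr_suml f0 mul0r subr0 -sum_ball_class.
  by apply: eq_bigr => a _; rewrite mul1r.
apply: le_trans (ler_norm_sum _ _ _) _.
rewrite /l1 mulr_sumr mulr_suml; apply: ler_sum => g _.
by rewrite normrM mulrAC [leRHS]mulrC; apply: ler_wpM2l.
Qed.

Lemma meanE f x : mean f x = psum (fun n => (\sum_(a <- el T n) f (cl a)) / n%:R) x.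
Proof. exact: (sum_ball_psum (fun a => f (cl a)) (fun n => n%:R^-1)). Qed.

Lemma mean_cvg1 f : \sum_g f g = 0 ->
  exists L, forall x, (0 < x)%N -> `|mean f x - L| <= 3 * (Cc * l1 f) / rt R x.
Proof.
move=> f0.
have [||L HL] := @psum_inv_cvg R (fun n => \sum_(a <- el T n) f (cl a)) (Cc * l1 f).
- by rewrite mulr_ge0 // l1_ge0.
- by move=> n; rewrite psum_el; exact: sum_class_bound.
by exists L => x x0; rewrite meanE; exact: HL.
Qed.

Lemma card_gT_gt0 : 0 < #|gT|%:R :> R.
Proof. by rewrite ltr0n; apply/card_gt0P; exists 1%g. Qed.

(** The limit of [mean f] is linear in [f], hence represented by a vector [gam], which matters only
    up to an additive constant as it is paired with functions of sum zero. The error depends on [f]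
    only through [l1 f], so all translates share it. *)
Lemma mean_cvg : exists (gam : gT -> R) (D : R), 0 <= D /\
  forall f, \sum_g f g = 0 -> forall x, (0 < x)%N ->
    `|mean f x - \sum_g f g * gam g| <= D * l1 f / rt R x.
Proof.
(* The indicator of [g], centred to have sum zero; an [f] of sum zero is the combination of the
   [del g] with coefficients [f g]. *)
pose del g := fun h : gT => (h == g)%:R - #|gT|%:R^-1 : R.
have del0 g : \sum_h del g h = 0.
  rewrite sumrB (bigD1 g) //= eqxx big1 => [|h /negbTE -> //].
  by rewrite sumr_const -[X in _ - X]mulr_natr mulVf ?gt_eqF ?card_gT_gt0 // addr0 subrr.
have /choice[gam Hgam] g := mean_cvg1 (del0 g).
pose D := 3 * (Cc * \sum_g l1 (del g)).
have D0 : 0 <= D by rewrite !mulr_ge0 // sumr_ge0 // => g _; exact: l1_ge0.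
exists gam, D; split => // f f0 x x0.
have -> : mean f x = \sum_g f g * mean (del g) x.
  have fE h : f h = \sum_g f g * del g h.
    under eq_bigr do rewrite mulrBr.
    rewrite sumrB -mulr_suml f0 mul0r subr0 (bigD1 h) //= eqxx mulr1 big1 ?addr0 //.
    by move=> g; rewrite eq_sym => /negbTE ->; rewrite mulr0.
  rewrite /mean; under eq_bigr do rewrite fE mulr_suml.
  rewrite exchange_big; apply: eq_bigr => g _; rewrite mulr_sumr.
  by apply: eq_bigr => a _; rewrite mulrA.
rewrite -sumrB; apply: le_trans (ler_norm_sum _ _ _) _.
rewrite [D * _]mulrC /l1 -mulrA mulr_suml; apply: ler_sum => g _.
rewrite -mulrBr normrM; apply: ler_wpM2l => //.
apply: le_trans (Hgam g x x0) _; apply: ler_wpM2r; first by rewrite invr_ge0 rt_ge0.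
rewrite /D ler_pM2l //; apply: ler_wpM2l => //.
by rewrite (bigD1 g) //= lerDl sumr_ge0 // => h _; exact: l1_ge0.
Qed.

Definition shift k f : gT -> R := fun g => f (k * g)%g.

Lemma sum_shift k f : \sum_g shift k f g = \sum_g f g.
Proof. by rewrite [RHS](reindex_inj (mulgI k)). Qed.

Lemma l1_shift k f : l1 (shift k f) = l1 f.
Proof. by rewrite /l1 [RHS](reindex_inj (mulgI k)). Qed.

(** All translates have limit 0, expressed by the rate that the convolution estimates consume, so
    that no limit appears. *)
Definition vanishing f := \sum_g f g = 0 /\ exists C : R, 0 <= C /\
  forall k x, (0 < x)%N -> `|mean (shift k f) x| <= C / rt R x.

Definition Rcl g x := \sum_(a <- ball T x | cl a == g) Lam R a / (nm a)%:R.
Definition charged g := forall B : R, exists x, B < Rcl g x.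
Definition Rtot x := \sum_(a <- ball T x) Lam R a / (nm a)%:R.

Lemma Lam_div_ge0 a : 0 <= Lam R a / (nm a)%:R.
Proof. by rewrite divr_ge0 // Lam_ge0. Qed.

Lemma Rcl_ge0 g x : 0 <= Rcl g x.
Proof. by apply: sumr_ge0 => a _; exact: Lam_div_ge0. Qed.

Lemma Rtot_ge0 x : 0 <= Rtot x.
Proof. by apply: sumr_ge0 => a _; exact: Lam_div_ge0. Qed.

Lemma Rtot_sum_Rcl x : Rtot x = \sum_g Rcl g x.
Proof. by rewrite /Rtot (partition_big cl xpredT). Qed.

Lemma not_charged g : ~ charged g -> exists2 B, 0 <= B & forall x, Rcl g x <= B.
Proof.
move=> /existsNP[B H]; exists (Num.max 0 B); first by rewrite le_max lexx.
by move=> x; rewrite le_max; apply/orP; right; rewrite leNgt; apply/negP => h; apply: H; exists x.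
Qed.

Lemma Lam_div_rt x :
  \sum_(d <- ball T x) Lam R d / (nm d)%:R / rt R (x %/ nm d) <= 4 * CL.
Proof.
have := @psum_div_error R (fun n => \sum_(a <- el T n) Lam R a) CL x CL0.
move=> H; apply: le_trans (H _ _).
- under eq_bigr do rewrite -mulrA.
  by rewrite (sum_ball_psum (fun a => Lam R a) (fun n => n%:R^-1 / rt R (x %/ n))); apply: ler_psum => n _; rewrite mulrA.
- by move=> n; apply: sumr_ge0 => a _; exact: Lam_ge0.
- by move=> n; rewrite psum_el.
Qed.

Lemma count_ball x : `|\sum_(a <- ball T x) 1 - A * #|gT|%:R * x%:R| <= Cc * #|gT|%:R * rt R x.
Proof.
rewrite (partition_big cl xpredT) //=.
have -> : A * #|gT|%:R * x%:R = \sum_(g : gT) A * x%:R.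
  by rewrite sumr_const -mulr_natr; ring.
rewrite -sumrB; apply: le_trans (ler_norm_sum _ _ _) _.
have -> : Cc * #|gT|%:R * rt R x = \sum_(g : gT) Cc * rt R x.
  by rewrite sumr_const -mulr_natr; ring.
by apply: ler_sum => g _; exact: count_cl.
Qed.

(** Mertens' first theorem. The sum of [ln (nm a)] over the ball is evaluated twice: by the density
    [A * #|gT|] of all elements, and as a convolution of 1 with [Lam], where it is
    [A * #|gT| * x * Rtot x] up to [O(x)]. *)
Lemma mertens_total : exists2 C : R, 0 <= C &
  forall x, (0 < x)%N -> `|Rtot x - ln x%:R| <= C.
Proof.
set q : R := #|gT|%:R; have q0 : 0 < q := card_gT_gt0.
pose A' := A * q; pose C' := Cc * q.
have A'0 : 0 < A' by rewrite mulr_gt0.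
have C'0 : 0 <= C' by rewrite mulr_ge0 // ltW.
exists (((2 * A' + 5 * C') + 4 * (A' + C') * CL) / A').
  by rewrite divr_ge0 ?addr_ge0 ?mulr_ge0 ?addr_ge0 // ltW.
move=> x x0; rewrite ler_pdivlMr //.
have px : 0 < x%:R :> R by rewrite ltr0n.
rewrite -(ler_pM2r px) -[X in _ * X * _ <= _](gtr0_norm A'0) -[X in _ * _ * X <= _](gtr0_norm px) -!normrM.
have E1 : `|\sum_(a <- ball T x) ln (nm a)%:R - A' * x%:R * ln x%:R| <= (2 * A' + 5 * C') * x%:R.
  have := @psum_ln_asymp R (fun n => \sum_(a <- el T n) 1) A' C' (ltW A'0) C'0 _ x x0.
  rewrite -(sum_ball_psum (fun=> 1) (fun n => ln n%:R)).
  under eq_bigr do rewrite mul1r.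
  by apply => n; rewrite (psum_el (fun=> 1)); exact: count_ball.
have E2 : `|\sum_(a <- ball T x) ln (nm a)%:R - A' * x%:R * Rtot x| <= 4 * (A' + C') * CL * x%:R.
  have -> : \sum_(a <- ball T x) ln (nm a)%:R =
      \sum_(d <- ball T x) Lam R d * \sum_(e <- ball T (x %/ nm d)) 1.
    under eq_bigr do rewrite -(@sum_divs_Lam R).
    rewrite (@sum_ball_divs T R (fun d _ => Lam R d)); apply: eq_bigr => d _.
    by rewrite mulr_sumr; apply: eq_bigr => e _; rewrite mulr1.
  rewrite /Rtot mulr_sumr -sumrB; apply: le_trans (ler_norm_sum _ _ _) _.
  have -> : 4 * (A' + C') * CL * x%:R = (A' + C') * x%:R * (4 * CL) by ring.
  apply: le_trans _ (ler_wpM2l _ (Lam_div_rt x)); last by rewrite mulr_ge0 ?addr_ge0 // ltW.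
  rewrite mulr_sumr big_seq [leRHS]big_seq; apply: ler_sum => d; rewrite mem_ball => dx.
  have -> : Lam R d * (\sum_(e <- ball T (x %/ nm d)) 1) - A' * x%:R * (Lam R d / (nm d)%:R) =
    Lam R d * (\sum_(e <- ball T (x %/ nm d)) 1 - A' * (x%:R / (nm d)%:R)).
    by ring.
  rewrite normrM [`|Lam R d|]ger0_norm ?Lam_ge0 //.
  have -> : (A' + C') * x%:R * (Lam R d / (nm d)%:R / rt R (x %/ nm d)) =
     Lam R d * ((A' + C') * (x%:R / (nm d)%:R / rt R (x %/ nm d))) by ring.
  apply: ler_wpM2l; first exact: Lam_ge0.
  have n0 := nm_gt0 d; set n := nm d in n0 dx *.
  have pn : 0 < n%:R :> R by rewrite ltr0n.
  have m0 : (0 < x %/ n)%N by rewrite divn_gt0.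
  have h := count_ball (x %/ n); rewrite -/A' -/C' -/q in h.
  have p := rt_ge1 R m0.
  set m := (x %/ n)%N in h m0 p *; set r := rt R m in h p *.
  have lo : m%:R <= x%:R / n%:R :> R by rewrite ler_pdivlMr // -natrM ler_nat leq_divM.
  have hi : x%:R / n%:R <= m%:R + 1 :> R.
    by rewrite ler_pdivrMr // natr1 -natrM ler_nat ltnW // ltn_ceil.
  have r2 : r ^+ 2 = m%:R by exact: rt_sqr.
  have lo' : r <= x%:R / n%:R / r by rewrite ler_pdivlMr; [rewrite -expr2 r2 | lra].
  have := ler_distD (A' * m%:R) (\sum_(e <- ball T m) 1) (A' * (x%:R / n%:R)).
  have : `|A' * m%:R - A' * (x%:R / n%:R)| <= A' * 1.
    rewrite -mulrBr normrM gtr0_norm // ler_pM2l // distrC ger0_norm ?subr_ge0 //; lra.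
  have : C' * r <= C' * (x%:R / n%:R / r) by apply: ler_wpM2l.
  have : A' * 1 <= A' * (x%:R / n%:R / r) by rewrite ler_pM2l //; lra.
  rewrite mulr1 [(A' + C') * _]mulrDl; lra.
have -> : (Rtot x - ln x%:R) * A' * x%:R =
  (\sum_(a <- ball T x) ln (nm a)%:R - A' * x%:R * ln x%:R) -
  (\sum_(a <- ball T x) ln (nm a)%:R - A' * x%:R * Rtot x) by ring.
apply: le_trans (ler_normB _ _) _; rewrite mulrDl; lra.
Qed.

Lemma ln_unbounded (B : R) : exists2 x, (0 < x)%N & B < ln x%:R.
Proof.
have [n nB] : exists n, expR B < n%:R :> R.
  by exists (Num.bound (expR B)); apply: archi_boundP; exact: expR_ge0.
exists n; first by rewrite -(ltr0n R); apply: lt_trans nB; exact: expR_gt0.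
by rewrite -ltr_expR lnK // posrE; apply: lt_trans nB; exact: expR_gt0.
Qed.

Lemma exists_charged : exists c, charged c.
Proof.
apply: contrapT => /forallNP H.
have /choice[B HB] g : exists B, forall x, Rcl g x <= B.
  by have [B _ hB] := not_charged (H g); exists B.
have [C _ HC] := mertens_total.
have [x x0 hx] := ln_unbounded (C + \sum_g B g).
have := HC x x0; rewrite Rtot_sum_Rcl ler_norml => /andP[h _].
have : \sum_g Rcl g x <= \sum_g B g by apply: ler_sum.
lra.
Qed.

Section Gamma.
Variables (gam : gT -> R) (D : R).
Hypothesis D0 : 0 <= D.
Hypothesis gamP : forall f, \sum_g f g = 0 -> forall x, (0 < x)%N ->
    `|mean f x - \sum_g f g * gam g| <= D * l1 f / rt R x.

Definition Lop f k := \sum_g f (k * g)%g * gam g.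

(* [log = 1 * Lam]: twisting by [f] and summing, the inner sums converge to [Lop f]. *)
Lemma Lam_Lop f : \sum_g f g = 0 -> exists2 C : R, 0 <= C &
  forall x, `|\sum_(a <- ball T x) Lam R a / (nm a)%:R * Lop f (cl a)| <= C.
Proof.
move=> f0; pose D' := D * l1 f.
have D'0 : 0 <= D' by rewrite mulr_ge0 // l1_ge0.
exists (12 * D' + D' * (4 * CL)); first by apply: addr_ge0; apply: mulr_ge0 => //; exact: mulr_ge0.
move=> x.
have E1 : `|\sum_(a <- ball T x) f (cl a) / (nm a)%:R * ln (nm a)%:R| <= 12 * D'.
  have -> : \sum_(a <- ball T x) f (cl a) / (nm a)%:R * ln (nm a)%:R =
     psum (fun n => (\sum_(a <- el T n) f (cl a)) / n%:R * ln n%:R) x.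
    under eq_bigr do rewrite -mulrA.
    rewrite (sum_ball_psum (fun a => f (cl a)) (fun n => n%:R^-1 * ln n%:R)).
    by apply: eq_bigr => n _; rewrite mulrA.
  apply: (psum_inv_ln_bounded (L := \sum_g f g * gam g)) => // y y0.
  by rewrite -meanE; exact: gamP.
have E2 : \sum_(a <- ball T x) f (cl a) / (nm a)%:R * ln (nm a)%:R =
   \sum_(d <- ball T x) Lam R d / (nm d)%:R * mean (shift (cl d) f) (x %/ nm d).
  under eq_bigr do rewrite -(@sum_divs_Lam R) mulr_sumr.
  rewrite (@sum_ball_divs T R (fun d a => f (cl a) / (nm a)%:R * Lam R d)).
  apply: eq_bigr => d _; rewrite /mean mulr_sumr; apply: eq_bigr => e _.
  by rewrite clM nmM natrM invfM /shift; ring.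
have E3 : `|\sum_(a <- ball T x) Lam R a / (nm a)%:R * Lop f (cl a) -
           \sum_(d <- ball T x) Lam R d / (nm d)%:R * mean (shift (cl d) f) (x %/ nm d)| <= D' * (4 * CL).
  rewrite -sumrB; apply: le_trans (ler_norm_sum _ _ _) _.
  apply: le_trans _ (ler_wpM2l D'0 (Lam_div_rt x)).
  rewrite mulr_sumr big_seq [leRHS]big_seq; apply: ler_sum => d; rewrite mem_ball => dx.
  rewrite -mulrBr normrM [X in X * _]ger0_norm ?Lam_div_ge0 // mulrCA.
  apply: ler_wpM2l; first exact: Lam_div_ge0.
  rewrite distrC /D' -(l1_shift (cl d)); apply: gamP; first by rewrite sum_shift.
  by rewrite divn_gt0 ?nm_gt0.
rewrite E2 in E1; set X := \sum_(a <- _) _ in E3 *; set Y := \sum_(d <- _) _ in E1 E3.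
have := ler_normD (X - Y) Y; rewrite subrK; lra.
Qed.

Lemma vanishing_Lop f : \sum_g f g = 0 -> (forall k, Lop f k = 0) -> vanishing f.
Proof.
move=> f0 H; split => //; exists (D * l1 f); split; first by rewrite mulr_ge0 // l1_ge0.
move=> k x x0; have := @gamP (shift k f) _ x x0.
rewrite sum_shift l1_shift => /(_ f0).
by rewrite -[\sum_g shift k f g * gam g]/(Lop f k) H subr0.
Qed.

End Gamma.

(* [Lam = - mu log * 1]: since all [mean (shift k f)] are small, so is the sum of [f (1 * (mu log(x/.)))]. *)
Lemma Lam_vanishing f : vanishing f -> exists2 C : R, 0 <= C &
  forall k x, (0 < x)%N ->
   `|f k * ln x%:R + \sum_(a <- ball T x) Lam R a / (nm a)%:R * f (k * cl a)%g| <= C.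
Proof.
move=> [f0 [C [C0 HC]]].
pose W := (A + Cc) * #|gT|%:R : R.
have W0 : 0 <= W by rewrite mulr_ge0 // addr_ge0 // ltW.
exists (C * (32 * W)); first by apply: mulr_ge0 => //; exact: mulr_ge0.
move=> k x x0.
have cl1 : cl (u1 T) = 1%g by apply: (mulgI (cl (u1 T))); rewrite -clM u1m mulg1.
have -> : f k * ln x%:R + \sum_(a <- ball T x) Lam R a / (nm a)%:R * f (k * cl a)%g =
  \sum_(d <- ball T x) umu R d / (nm d)%:R * ln (x%:R / (nm d)%:R) *
     mean (shift (k * cl d)%g f) (x %/ nm d).
  transitivity (\sum_(a <- ball T x) \sum_(d <- divs a)
     umu R d * ln (x%:R / (nm d)%:R) * (f (k * cl a)%g / (nm a)%:R)).
    have E a : \sum_(d <- divs a) umu R d * ln (x%:R / (nm d)%:R) * (f (k * cl a)%g / (nm a)%:R) =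
        (a == u1 T)%:R * ln x%:R * (f (k * cl a)%g / (nm a)%:R) + Lam R a / (nm a)%:R * f (k * cl a)%g.
      rewrite -mulr_suml.
      have -> : \sum_(d <- divs a) umu R d * ln (x%:R / (nm d)%:R) = (a == u1 T)%:R * ln x%:R + Lam R a.
        rewrite -(@sum_divs_umu R) mulr_suml -[Lam R a]opprK -sum_divs_umu_ln -sumrB.
        apply: eq_bigr => d _; rewrite ln_div ?posrE ?ltr0n ?nm_gt0 //; ring.
      by ring.
    under [RHS]eq_bigr do rewrite E.
    rewrite big_split /=; congr (_ + _).
    rewrite (bigD1_seq (u1 T)) ?ball_uniq ?mem_ball ?nm1 //= big1 => [|a /negbTE ->]; last by rewrite !mul0r.
    by rewrite eqxx cl1 mulg1 addr0 ?nm1 mul1r invr1 mulr1 mulrC.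
  rewrite (@sum_ball_divs T R (fun d a => umu R d * ln (x%:R / (nm d)%:R) * (f (k * cl a)%g / (nm a)%:R))).
  apply: eq_bigr => d _; rewrite /mean mulr_sumr; apply: eq_bigr => e _.
  by rewrite clM nmM natrM invfM /shift mulgA; ring.
apply: le_trans (ler_norm_sum _ _ _) _.
have := @psum_div_ln_error R (fun n => \sum_(a <- el T n) 1) W x W0.
move=> H; apply: le_trans _ (ler_wpM2l C0 (H _ _)).
- have -> : psum (fun n => (\sum_(a <- el T n) 1) / n%:R * ln (x%:R / n%:R) / rt R (x %/ n)) x =
    \sum_(a <- ball T x) 1 * ((nm a)%:R^-1 * ln (x%:R / (nm a)%:R) / rt R (x %/ nm a)).
    rewrite (sum_ball_psum (fun=> 1) (fun n => n%:R^-1 * ln (x%:R / n%:R) / rt R (x %/ n))).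
    by apply: eq_bigr => n _; rewrite !mulrA.
  rewrite mulr_sumr big_seq [leRHS]big_seq; apply: ler_sum => d; rewrite mem_ball => dx.
  have l0 : 0 <= ln (x%:R / (nm d)%:R) :> R.
    by apply: ln_ge0; rewrite ler_pdivlMr ?ltr0n ?nm_gt0 // mul1r ler_nat.
  rewrite mul1r 3!normrM [`|ln _|]ger0_norm // normfV [`|(nm d)%:R|]ger0_norm //.
  have -> : C * ((nm d)%:R^-1 * ln (x%:R / (nm d)%:R) / rt R (x %/ nm d)) =
     (1 * (nm d)%:R^-1 * ln (x%:R / (nm d)%:R)) * (C / rt R (x %/ nm d)) by ring.
  apply: ler_pM => //; first by rewrite !mulr_ge0 ?invr_ge0.
    apply: ler_wpM2r => //; apply: ler_wpM2r; first by rewrite invr_ge0.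
    exact: umu_norm.
  by apply: HC; rewrite divn_gt0 ?nm_gt0.
- by move=> n; apply: sumr_ge0.
- move=> n; rewrite (psum_el (fun=> 1)).
  have := count_ball n; rewrite ler_norml => /andP[_].
  have : Cc * #|gT|%:R * rt R n <= Cc * #|gT|%:R * n%:R.
    by apply: ler_wpM2l; [rewrite mulr_ge0 | exact: rt_le].
  rewrite /W; lra.
Qed.

Lemma vanishingN f : vanishing f -> vanishing (fun g => - f g).
Proof.
move=> [f0 [C [C0 HC]]]; split; first by rewrite sumrN f0 oppr0.
exists C; split => // k x x0.
suff -> : mean (shift k (fun g => - f g)) x = - mean (shift k f) x by rewrite normrN; exact: HC.
by rewrite /mean -sumrN; apply: eq_bigr => a _; rewrite /shift mulNr.
Qed.

Lemma vanishingD f1 f2 : vanishing f1 -> vanishing f2 -> vanishing (fun g => f1 g + f2 g).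
Proof.
move=> [f0 [C [C0 HC]]] [f0' [C' [C'0 HC']]]; split; first by rewrite big_split /= f0 f0' addr0.
exists (C + C'); split; first by rewrite addr_ge0.
move=> k x x0.
have -> : mean (shift k (fun g => f1 g + f2 g)) x = mean (shift k f1) x + mean (shift k f2) x.
  by rewrite /mean -big_split; apply: eq_bigr => a _; rewrite /shift mulrDl.
by apply: le_trans (ler_normD _ _) _; rewrite mulrDl; apply: lerD; [apply: HC | apply: HC'].
Qed.

Lemma vanishing_shift c f : vanishing f -> vanishing (shift c f).
Proof.
move=> [f0 [C [C0 HC]]]; split; first by rewrite sum_shift.
exists C; split => // k x x0; have := HC (c * k)%g x x0.
by rewrite /mean /shift; under eq_bigr do rewrite -mulgA.
Qed.

(** Adding [f k * Rtot x] to the estimate of [Lam_vanishing] removes the logarithm and bounds the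
    sum of [Lam R a / nm a * (f (k * cl a) + f k)] from above. At a maximum of the absolute value
    all terms are nonnegative, so a class [c] with [f (k * c) + f k] positive cannot be charged. *)
Lemma vanishing_at_max f c k : vanishing f -> charged c ->
  (forall h, `|f h| <= f k) -> f (k * c)%g = - f k.
Proof.
move=> vf cc fm; apply/eqP; rewrite -addr_eq0 -[_ == 0]negbK; apply/negP => nz.
have f_ge h : 0 <= f h + f k by have := fm h; rewrite ler_norml => /andP[]; lra.
have pos : 0 < f (k * c)%g + f k by rewrite lt_neqAle eq_sym nz f_ge.
have [C1 C10 H1] := Lam_vanishing vf; have [C2 C20 H2] := mertens_total.
have fk0 : 0 <= f k by have := f_ge k; lra.
have [x hx] := cc ((C1 + f k * C2) / (f (k * c)%g + f k)).
have x0 : (0 < x)%N.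
  rewrite lt0n; apply/eqP => x0; move: hx; rewrite x0 /Rcl /ball big_nil.
  by rewrite ltNge (divr_ge0 (addr_ge0 C10 (mulr_ge0 fk0 C20)) (ltW pos)).
move: hx; rewrite ltr_pdivrMr //.
have : Rcl c x * (f (k * c)%g + f k) <=
    \sum_(a <- ball T x) Lam R a / (nm a)%:R * (f (k * cl a)%g + f k).
  rewrite [leRHS](bigID (fun a => cl a == c)) /= /Rcl mulr_suml.
  rewrite (eq_bigr (fun a => Lam R a / (nm a)%:R * (f (k * cl a)%g + f k))); last by move=> a /eqP ->.
  by rewrite lerDl; apply: sumr_ge0 => a _; rewrite mulr_ge0 // Lam_div_ge0.
have -> : \sum_(a <- ball T x) Lam R a / (nm a)%:R * (f (k * cl a)%g + f k) =
  \sum_(a <- ball T x) Lam R a / (nm a)%:R * f (k * cl a)%g + Rtot x * f k.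
  by rewrite /Rtot mulr_suml -big_split; apply: eq_bigr => a _; rewrite mulrDr.
have := H1 k x x0; have := H2 x x0; rewrite !ler_norml => /andP[_ h2] /andP[_ h1].
have : f k * (Rtot x - ln x%:R) <= f k * C2 by apply: ler_wpM2l.
nra.
Qed.

Lemma vanishing_at_max_norm f c k : vanishing f -> charged c ->
  (forall h, `|f h| <= `|f k|) -> f (k * c)%g = - f k.
Proof.
move=> vf cc fm; case: (lerP 0 (f k)) => fk.
  by apply: vanishing_at_max => // h; rewrite -[leRHS]ger0_norm.
have := @vanishing_at_max (fun g => - f g) c k (vanishingN vf) cc.
rewrite opprK => h; rewrite -[LHS]opprK h ?opprK // => g.
by rewrite normrN -(ltr0_norm fk).
Qed.

(** The sign change is known only where the absolute value is largest, so it is applied to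
    [F = f + shift c f]. From a maximum [k0] of the absolute value of [F], the values of [F]
    alternate along the powers of [c], and [f (k0 * c ^+ j)] becomes
    [(-1) ^+ j * (f k0 - j * F k0)]. The finite order of [c] forbids this linear growth, so [F] is
    0. *)
Theorem vanishing_charged f c k : vanishing f -> charged c -> f (c * k)%g = - f k.
Proof.
move=> vf cc; pose F g := f g + shift c f g.
have vF : vanishing F by apply: vanishingD => //; exact: vanishing_shift.
pose k0 := [arg max_(g > 1%g) `|F g|]%O.
have Fm h : `|F h| <= `|F k0| by rewrite /k0; case: arg_maxP => //= i _; apply.
have Fc j : F (k0 * c ^+ j)%g = (-1) ^+ j * F k0.
  elim: j => [|j IH]; first by rewrite expg0 mulg1 mul1r.
  rewrite expgSr mulgA (vanishing_at_max_norm vF cc) ?IH ?exprS; first by ring.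
  by move=> h; rewrite normrM normrX normrN1 expr1n mul1r.
have fc j : f (k0 * c ^+ j)%g = (-1) ^+ j * (f k0 - j%:R * F k0).
  elim: j => [|j IH]; first by rewrite expg0 mulg1 mul0r subr0 mul1r.
  have : F (k0 * c ^+ j)%g = f (k0 * c ^+ j)%g + f (k0 * c ^+ j.+1)%g.
    by rewrite /F /shift gTC -mulgA -expgSr.
  rewrite Fc IH exprS -natr1 => h.
  have -> : f (k0 * c ^+ j.+1)%g = (-1) ^+ j * F k0 - (-1) ^+ j * (f k0 - j%:R * F k0) by rewrite h; ring.
  by ring.
have F0 : F k0 = 0.
  have := fc (#[c]%g * 2)%N; rewrite expgM expg_order expg1n mulg1 mulnC exprM sqrrN !expr1n mul1r.
  move/eqP; rewrite -subr_eq0 opprB addrCA subrr addr0 mulf_eq0 pnatr_eq0 => /orP[|/eqP //].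
  by rewrite muln_eq0 /= -leqn0 leqNgt order_gt0.
have := Fm k; rewrite F0 normr0 normr_le0 /F /shift => /eqP; lra.
Qed.

(* The centred indicator of [H] is vanishing because the charged classes fix it, while they should also change its sign. *)
Theorem charged_gen (H : {group gT}) : (forall c, charged c -> c \in H) -> forall g, g \in H.
Proof.
move=> HC; have [gam [D [D0 gamP]]] := mean_cvg.
pose r : R := #|H|%:R / #|gT|%:R.
pose f g : R := (g \in H)%:R - r.
have q0 := card_gT_gt0.
have f0 : \sum_g f g = 0.
  rewrite sumrB sumr_const -mulr_natr /r mulfVK ?gt_eqF //.
  by rewrite -natr_sum -big_mkcond /= sum1_card subrr.
have fH h g : h \in H -> f (g * h)%g = f g by move=> hH; rewrite /f groupMr.
have LH h k : h \in H -> Lop gam f (k * h)%g = Lop gam f k.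
  move=> hH; apply: eq_bigr => g _; congr (_ * _).
  by rewrite -mulgA (gTC h) mulgA (fH h).
(* [Lop gam f] is constant on cosets of [H], and classes outside [H] are not charged, so they
   contribute a bounded amount. Up to [O(1)] the sum in [Lam_Lop] is therefore
   [Lop gam f k * Rtot x], which is bounded only if the first factor is 0. *)
have Lz k : Lop gam f k = 0.
  have fk0 : \sum_g shift k f g = 0 by rewrite sum_shift.
  have [C C0 HL] := Lam_Lop D0 gamP fk0; have [C2 C20 H2] := mertens_total.
  have /choice[B HB] g : exists B, 0 <= B /\ (g \notin H -> forall x, Rcl g x <= B).
    case: (boolP (g \in H)) => gH; first by exists 0.
    have [|B B0 hB] := @not_charged g; last by exists B.
    by move/HC; rewrite (negbTE gH).
  apply/eqP/contraT => nz; have pos : 0 < `|Lop gam f k| by rewrite normr_gt0.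
  pose M := \sum_g `|Lop gam f (k * g)%g - Lop gam f k| * B g.
  have [x x0] := ln_unbounded (C2 + (C + M) / `|Lop gam f k|).
  have := H2 x x0; rewrite ler_norml => /andP[h2 _].
  have {HL} := HL x; have -> : \sum_(a <- ball T x) Lam R a / (nm a)%:R * Lop gam (shift k f) (cl a) =
     \sum_(a <- ball T x) Lam R a / (nm a)%:R * (Lop gam f (k * cl a)%g - Lop gam f k) + Lop gam f k * Rtot x.
    rewrite /Rtot mulr_sumr -big_split; apply: eq_bigr => a _ /=.
    have -> : Lop gam (shift k f) (cl a) = Lop gam f (k * cl a)%g.
      by apply: eq_bigr => g _; rewrite /shift mulgA.
    by ring.
  set X := \sum_(a <- _) _ => h1 h3.
  have hX : `|X| <= M.
    rewrite /X (sum_ball_class _ (fun g => Lop gam f (k * g)%g - Lop gam f k)).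
    apply: le_trans (ler_norm_sum _ _ _) _; apply: ler_sum => g _.
    rewrite normrM; case: (boolP (g \in H)) => gH; first by rewrite LH // subrr normr0 !mul0r.
    apply: ler_wpM2l => //; rewrite ger0_norm; first exact: (HB g).2.
    exact: Rcl_ge0.
  have : `|Lop gam f k * Rtot x| <= C + M.
    have := ler_normB (X + Lop gam f k * Rtot x) X.
    have -> : X + Lop gam f k * Rtot x - X = Lop gam f k * Rtot x by ring.
    lra.
  rewrite normrM [`|Rtot x|]ger0_norm ?Rtot_ge0 // mulrC -ler_pdivlMr //; lra.
have vf := vanishing_Lop D0 gamP f0 Lz.
have [c cc] := exists_charged.
have := vanishing_charged 1 vf cc.
rewrite mulg1 /f HC // group1 => /eqP; rewrite -addr_eq0 => /eqP h.
have r1 : r = 1 by move: h; rewrite mulr1n; lra.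
have e : #|H| = #|gT|.
  have := congr1 (fun z => z * #|gT|%:R) r1.
  by rewrite /r mulfVK ?gt_eqF // mul1r => /eqP; rewrite eqr_nat => /eqP.
by move=> g; rewrite (subset_cardP e (subset_predT _)).
Qed.

(** Without nonzero vanishing functions, [Lop gam] is injective on functions of sum zero, so some
    [f] is mapped to the indicator of [g0] minus the constant [1 / #|gT|]. For this [f], [Lam_Lop]
    says that [Rcl g0 x] and [Rtot x / #|gT|] differ by a bounded amount. *)
Theorem all_charged : (forall f, vanishing f -> forall g, f g = 0) -> forall g, charged g.
Proof.
move=> K0 g0; have [gam [D [D0 gamP]]] := mean_cvg.
have q0 := card_gT_gt0; pose q : R := #|gT|%:R.
pose G0 := \sum_g gam g.
(* The matrix that centres [v], applies [Lop gam], and adds back the average of [v]. Adding the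
   average extends the map from functions of sum zero to an endomorphism of all functions, so that
   an inverse matrix makes sense. *)
pose Q := \matrix_(i < #|gT|, j < #|gT|)
  (gam ((enum_val j : gT)^-1 * enum_val i)%g - G0 / q + q^-1) : 'M[R]_(#|gT|).
pose fn (v : 'rV[R]_(#|gT|)) (g : gT) := v 0 (enum_rank g).
have QE v k : (v *m Q) 0 (enum_rank k) =
    Lop gam (fun g => fn v g - (\sum_h fn v h) / q) k + (\sum_h fn v h) / q.
  rewrite mxE (reindex (@enum_rank gT)) /=; last by apply: onW_bij; exact: enum_rank_bij.
  have LopE f : Lop gam f k = \sum_g f g * gam (k^-1 * g)%g.
    by rewrite [RHS](reindex_inj (mulgI k)); apply: eq_bigr => g _; rewrite mulKg.
  have G0E : G0 = \sum_g gam (k^-1 * g)%g by rewrite /G0 (reindex_inj (mulgI k^-1%g)).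
  set S := \sum_h fn v h.
  have -> : Lop gam (fun g => fn v g - S / q) k =
      \sum_g fn v g * gam (k^-1 * g)%g - S / q * G0.
    by rewrite LopE G0E mulr_sumr -sumrB; apply: eq_bigr => g _; rewrite mulrBl.
  have -> : \sum_(g : gT) v 0 (enum_rank g) * Q (enum_rank g) (enum_rank k) =
      \sum_g fn v g * gam (k^-1 * g)%g - S * (G0 / q) + S * q^-1.
    rewrite /S [X in _ - X + _]mulr_suml [X in _ + X]mulr_suml -sumrB -big_split; apply: eq_bigr => g _ /=.
    rewrite mxE !enum_rankK /fn; ring.
  ring.
have sumLop f : \sum_g f g = 0 -> \sum_k Lop gam f k = 0.
  move=> f0; rewrite /Lop exchange_big big1 //= => g _; rewrite -mulr_suml.
  by rewrite -(reindex_inj (mulIg g) (P := xpredT) (F := f)) f0 mul0r.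
have sum0 f : \sum_g (f g - (\sum_h f h) / q) = 0 :> R.
  by rewrite sumrB sumr_const -mulr_natr mulfVK ?gt_eqF // subrr.
have sumcst (z : R) : \sum_(k : gT) z / q = z by rewrite sumr_const -mulr_natr mulfVK ?gt_eqF.
have uQ : Q \in unitmx.
  rewrite -row_free_unit -kermx_eq0; apply/eqP/row_matrixP => i; rewrite row0.
  set v := row i (kermx Q).
  have vQ : v *m Q = 0 by apply/sub_kermxP; exact: row_sub.
  have h k : Lop gam (fun g => fn v g - (\sum_h fn v h) / q) k + (\sum_h fn v h) / q = 0.
    by rewrite -QE vQ mxE.
  have s0 : \sum_h fn v h = 0.
    have : \sum_(k : gT) (Lop gam (fun g => fn v g - (\sum_h fn v h) / q) k + (\sum_h fn v h) / q) = 0.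
      by apply: big1 => k _; exact: h.
    by rewrite big_split /= sumLop // add0r sumcst.
  have vv : vanishing (fn v).
    apply: (vanishing_Lop D0 gamP) => // k; have := h k; rewrite s0 mul0r addr0 => e.
    by rewrite -[RHS]e; apply: eq_bigr => g _; rewrite subr0.
  by apply/rowP => j; have := K0 _ vv (enum_val j); rewrite /fn enum_valK => ->; rewrite mxE.
pose t : 'rV[R]_(#|gT|) := \row_j (enum_val j == g0)%:R.
pose v := t *m invmx Q.
have vt k : Lop gam (fun g => fn v g - (\sum_h fn v h) / q) k + (\sum_h fn v h) / q = (k == g0)%:R.
  by rewrite -QE mulmxKV // mxE enum_rankK.
have s1 : \sum_h fn v h = 1.
  have : \sum_(k : gT) (Lop gam (fun g => fn v g - (\sum_h fn v h) / q) k + (\sum_h fn v h) / q) =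
      \sum_(k : gT) (k == g0)%:R by apply: eq_bigr => k _; exact: vt.
  rewrite big_split /= sumLop // add0r sumcst => ->.
  by rewrite (bigD1 g0) //= eqxx big1 ?addr0 // => k /negbTE ->.
have [C C0 HL] := Lam_Lop D0 gamP (sum0 (fn v)).
have [C2 C20 H2] := mertens_total.
move=> B; have [x x0 hx] := ln_unbounded (C2 + q * (B + C)).
exists x; have := HL x.
have -> : \sum_(a <- ball T x) Lam R a / (nm a)%:R *
     Lop gam (fun g => fn v g - (\sum_h fn v h) / q) (cl a) = Rcl g0 x - Rtot x / q.
  under eq_bigr => a _.
    have -> : Lop gam (fun g => fn v g - (\sum_h fn v h) / q) (cl a) = (cl a == g0)%:R - 1 / q.
      by rewrite -(vt (cl a)) s1; ring.
    rewrite mulrBr mul1r; over.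
  rewrite sumrB -mulr_suml; congr (_ - _).
  rewrite /Rcl [RHS]big_mkcond /=; apply: eq_bigr => a _.
  by case: ifP; rewrite ?mulr1 ?mulr0.
rewrite ler_norml => /andP[h _].
have := H2 x x0; rewrite ler_norml => /andP[h2 _].
have : B + C < Rtot x / q by rewrite ltr_pdivlMr // mulrC; lra.
lra.
Qed.

End ClassDistribution.

(** * Chebyshev's bound and prime powers *)

Lemma bin_le_exp2 n m : ('C(n, m) <= 2 ^ n)%N.
Proof.
elim: n m => [|n IH] [|m]; rewrite ?bin0 ?expn_gt0 //.
by rewrite binS expnS mul2n -addnn leq_add.
Qed.

Lemma prime_dvd_fact p n : prime p -> (p %| n`!)%N -> (p <= n)%N.
Proof.
move=> pp; elim: n => [|n IH]; first by rewrite dvdn1 => /eqP p1; rewrite p1 in pp.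
by rewrite factS Euclid_dvdM // => /orP[/dvdn_leq -> //|/IH/leqW].
Qed.

Lemma prod_primes_dvd (s : seq nat) m : uniq s -> all prime s ->
  all (fun p => p %| m)%N s -> (\prod_(p <- s) p %| m)%N.
Proof.
elim: s => [|p s IH] /=; first by rewrite big_nil dvd1n.
move=> /andP[ps us] /andP[pp ap] /andP[pm am]; rewrite big_cons Gauss_dvd ?pm ?IH //.
rewrite big_seq; elim/big_ind: _ => [||q qs]; first exact: coprimen1.
  by move=> x y cx cy; rewrite coprimeMr cx.
have pq : prime q by exact: (allP ap).
by rewrite prime_coprime // dvdn_prime2 //; apply: contraNN ps => /eqP ->.
Qed.

(** Every prime in the range divides the central binomial coefficient, because it divides the
    factorial of [n.*2] but not that of [n]. *)
Lemma prod_primes_le n : (\prod_(n.+1 <= p < n.*2.+1 | prime p) p <= 4 ^ n)%N.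
Proof.
rewrite -[4%N]/(2 ^ 2)%N -expnM mul2n; apply: leq_trans (bin_le_exp2 _ n).
apply: dvdn_leq; first by rewrite bin_gt0 -addnn leq_addr.
rewrite -big_filter; apply: prod_primes_dvd.
- by rewrite filter_uniq // iota_uniq.
- exact: filter_all.
apply/allP => p; rewrite mem_filter mem_index_iota => /and3P[pp np pn].
have := bin_fact (leq_addr n n); rewrite addKn addnn => e.
have : (p %| 'C(n.*2, n) * (n`! * n`!))%N.
  by rewrite e dvdn_fact // prime_gt0.
rewrite !Euclid_dvdM // => /orP[//|/orP[]/(prime_dvd_fact pp)]; lia.
Qed.

Lemma sum_subset_le (R : numDomainType) (I : eqType) (s1 s2 : seq I) (F : I -> R) :
  uniq s1 -> {subset s1 <= s2} -> (forall i, 0 <= F i) ->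
  \sum_(i <- s1) F i <= \sum_(i <- s2) F i.
Proof.
move=> + + F0; elim: s1 s2 => [|i s1 IH] s2 /=.
  by move=> _ _; rewrite big_nil sumr_ge0.
move=> /andP[is1 us] sub; rewrite big_cons.
rewrite (perm_big _ (perm_to_rem (sub i (mem_head _ _)))) big_cons lerD2l.
apply: IH => // j js1; have : j \in s2 by apply: sub; rewrite inE js1 orbT.
rewrite (perm_mem (perm_to_rem (sub i (mem_head _ _)))) inE => /orP[/eqP ji|//].
by rewrite -ji js1 in is1.
Qed.

Definition ppower n := `[< exists p k, prime p /\ n = (p ^ k.+1)%N >].

Section Chebyshev.
Variable R : realType.

Definition theta := psum (fun n => (prime n)%:R * ln n%:R : R).

Lemma theta_double n : theta n.*2 <= theta n + 2 * n%:R.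
Proof.
rewrite /theta /psum (@big_cat_nat _ _ _ n.+1 1 n.*2.+1) //=; last by lia.
rewrite lerD2l.
apply: (@le_trans _ _ (ln (\prod_(n.+1 <= p < n.*2.+1 | prime p) p)%:R)).
  rewrite le_eqVlt; apply/orP; left; apply/eqP.
  rewrite [in RHS]big_mkcond /=; elim: (index_iota _ _) => [|p s IH].
    by rewrite !big_nil ln1.
  rewrite !big_cons IH; case: ifP => pp; last by rewrite mul0r add0r mul1n.
  rewrite natrM lnM ?posrE ?ltr0n ?mul1r //; first exact: prime_gt0.
  elim/big_ind: _ => // [x y|i _]; first by rewrite muln_gt0 => -> ->.
  by case: ifP => // /prime_gt0.
apply: (@le_trans _ _ (ln (4 ^ n)%:R)).
  apply: ler_lnn (prod_primes_le n).
  elim/big_ind: _ => // [x y|i /prime_gt0 //]; by rewrite muln_gt0 => -> ->.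
rewrite natrX lnXn // -[leLHS]mulr_natr ler_wpM2r //.
have -> : 4 = 2 ^+ 2 :> R by ring.
rewrite lnXn // mulr2n; have := @le_ln1Dx R 1.
have -> : 1 + 1 = 2 :> R by ring.
by move=> /(_ ltac:(lra)); lra.
Qed.

(** Halving: [4 * k + 2 * k] stays below [8 * k], and an odd argument adds one more term, at most
    [2 * k] by [ln (1 + t) <= t]. *)
Lemma theta_le n : theta n <= 4 * n%:R.
Proof.
elim: {n}_.+1 {-2}n (ltnSn n) => // m IH n nm.
case: (posnP n) => [->|n0]; first by rewrite /theta psum0 mulr0.
have [k kn [e|e]] : exists2 k, (k < n)%N & n = k.*2 \/ n = k.*2.+1.
  exists n./2; first by lia.
  by have := odd_double_half n; case: (odd n) => /= <-; [right|left]; lia.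
  have := theta_double k; have := IH k; rewrite e -mul2n natrM => h.
  have := h (leq_trans kn (nm : (n <= m)%N)); have := ler0n R k; lra.
have := theta_double k; have := IH k (leq_trans kn (nm : (n <= m)%N)).
have es : theta k.*2.+1 = theta k.*2 + (prime k.*2.+1)%:R * ln k.*2.+1%:R by exact: psumS.
rewrite e es.
have : (prime k.*2.+1)%:R * ln k.*2.+1%:R <= 2 * k%:R :> R.
  apply: (@le_trans _ _ (ln k.*2.+1%:R)).
    by case: (prime _); rewrite ?mul1r ?mul0r ?lnn_ge0.
  have -> : k.*2.+1%:R = 1 + 2 * k%:R :> R by rewrite -natr1 -mul2n natrM; ring.
  by apply: le_ln1Dx; have := ler0n R k; lra.
have := ler0n R k; rewrite -natr1 -mul2n natrM; lra.
Qed.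

Lemma psum_rtV_succ_le x : psum (fun n => (rt R n * n.+1%:R)^-1) x <= 4.
Proof.
case: x => [|x]; first by rewrite psum0.
rewrite /psum big_ltn //; have := @sum_rtV_tail R 1 x.+1 isT isT.
have -> : rt R 1 = 1 by rewrite /rt sqrtr1.
rewrite invr1 mul1r; lra.
Qed.

(* A non-prime prime power is [a^2] or [a^2 q] with [q] the smallest prime factor of [a]. *)
Lemma sum_ppower_nonprime x :
  psum (fun n => (ppower n && ~~ prime n)%:R * (ln n%:R / n%:R)) x <= 160 :> R.
Proof.
pose F n : R := ln n%:R / n%:R.
have F0 n : 0 <= F n by rewrite divr_ge0 // lnn_ge0.
pose s := [seq a ^ 2 | a <- iota 1 x]%N ++ [seq a ^ 2 * pdiv a | a <- iota 1 x]%N.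
apply: (@le_trans _ _ (\sum_(n <- s) F n)).
  have -> : psum (fun n => (ppower n && ~~ prime n)%:R * F n) x =
      \sum_(n <- [seq n <- index_iota 1 x.+1 | ppower n && ~~ prime n]) F n.
    rewrite big_filter [RHS]big_mkcond; apply: eq_bigr => n _.
    by case: ifP; rewrite ?mul1r ?mul0r.
  apply: sum_subset_le => //; first by rewrite filter_uniq // iota_uniq.
  move=> n; rewrite mem_filter mem_index_iota => /andP[/andP[/asboolP[p [k [pp e]]] npn] nx].
  have k0 : (0 < k)%N.
    by rewrite lt0n; apply/eqP => k0; move: npn; rewrite e k0 expn1 pp.
  pose j := (k.+1)./2.
  have j0 : (0 < j)%N by rewrite /j; lia.
  have pj : pdiv (p ^ j) = p by rewrite -(prednK j0) pdiv_pfactor.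
  have jx : (p ^ j <= x)%N.
    apply: (@leq_trans n); last by lia.
    by rewrite e leq_pexp2l ?prime_gt0 // /j; lia.
  rewrite mem_cat; apply/orP; case: (boolP (odd k)) => ok.
    left; apply/mapP; exists (p ^ j)%N; first by rewrite mem_iota expn_gt0 prime_gt0 //=; lia.
    by rewrite e -expnM; congr (_ ^ _)%N; rewrite /j; lia.
  right; apply/mapP; exists (p ^ j)%N; first by rewrite mem_iota expn_gt0 prime_gt0 //=; lia.
  by rewrite pj e -expnM -expnSr; congr (_ ^ _)%N; rewrite /j; lia.
rewrite big_cat !big_map /= -big_split /=.
(* Each [a] contributes at most [5 * ln a / a ^+ 2]: twice [ln a] from [a ^ 2] and three times from
   [a ^ 2 * pdiv a]. With [ln a <= 4 * rt a] this is at most 40 times the inverse of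
   [rt a * (a + 1)], and those inverses sum to at most 4. *)
apply: (@le_trans _ _ (40 * psum (fun n => (rt R n * n.+1%:R)^-1) x)); last first.
  by have := psum_rtV_succ_le x; lra.
rewrite -psumZ /psum /index_iota subSS subn0 big_seq [leRHS]big_seq.
apply: ler_sum => a; rewrite mem_iota => /andP[a0 _].
have pa : 1 <= a%:R :> R by rewrite ler1n.
have la : ln a%:R <= 4 * rt R a by apply: le_trans (ln_le_rt R a0); exact: ler_lnn.
have e1 : F (a ^ 2)%N = 2 * ln a%:R / a%:R ^+ 2.
  by rewrite /F natrX lnXn ?ltr0n // -[ln _ *+ 2]mulr_natl.
have q0 := pdiv_gt0 a; have qa := pdiv_leq a0.
have e2 : F (a ^ 2 * pdiv a)%N <= 3 * ln a%:R / a%:R ^+ 2.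
  rewrite /F natrM natrX lnM ?posrE ?exprn_gt0 ?ltr0n // lnXn ?ltr0n // -[ln _ *+ 2]mulr_natl.
  have lq : ln (pdiv a)%:R <= ln a%:R :> R by exact: ler_lnn.
  have l0 := lnn_ge0 R a.
  have pq : 1 <= (pdiv a)%:R :> R by rewrite ler1n.
  apply: ler_pM.
  - by rewrite addr_ge0 ?mulr_ge0 ?lnn_ge0.
  - by rewrite invr_ge0 mulr_ge0 ?exprn_ge0.
  - lra.
  rewrite lef_pV2 ?posrE ?mulr_gt0 ?exprn_gt0 ?ltr0n //.
  by rewrite ler_peMr // exprn_ge0.
have : F (a ^ 2)%N + F (a ^ 2 * pdiv a)%N <= 5 * (4 * rt R a) / a%:R ^+ 2.
  have -> : 5 * (4 * rt R a) / a%:R ^+ 2 = 2 * (4 * rt R a) / a%:R ^+ 2 + 3 * (4 * rt R a) / a%:R ^+ 2 by ring.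
  rewrite e1; apply: lerD; last apply: (le_trans e2);
    by rewrite ler_wpM2r ?invr_ge0 ?exprn_ge0 ?ler_pM2l.
move/le_trans; apply; have := rt_gt0 R a0; have := rt_sqr R a.
rewrite -[a.+1%:R]natr1; move: (rt R a) => r e r0; rewrite -e in pa *.
have r20 : 0 < r ^+ 2 by lra.
rewrite ler_pdivrMr ?exprn_gt0 // mulrAC ler_pdivlMr; last by apply: mulr_gt0; lra.
have -> : 5 * (4 * r) * (r * (r ^+ 2 + 1)) = 20 * r ^+ 2 * (r ^+ 2 + 1) by ring.
have -> : 40 * (r ^+ 2) ^+ 2 = 20 * r ^+ 2 * (2 * r ^+ 2) by ring.
by rewrite ler_pM2l; lra.
Qed.

End Chebyshev.

(** * Elements of prime norm *)

Section PrimeNorms.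
Variables (R : realType) (T : normUFD).
Hypothesis Lam_ppower : forall a : T, Lam R a != 0 -> ppower (nm a).
Hypothesis sum_Lam_el : forall n, \sum_(a <- el T n) Lam R a <= 2 * ln n%:R.

Lemma sum_el_nonppower n : ~~ ppower n -> \sum_(a <- el T n) Lam R a = 0.
Proof.
move=> nn; rewrite big_seq big1 // => a; rewrite mem_el => /eqP an.
by apply/eqP; apply: contraNT nn => /Lam_ppower; rewrite an.
Qed.

Lemma sum_Lam_nonprime x :
  \sum_(a <- ball T x | ~~ prime (nm a)) Lam R a / (nm a)%:R <= 320.
Proof.
rewrite big_mkcond /=.
rewrite (eq_bigr (fun a => Lam R a * ((~~ prime (nm a))%:R / (nm a)%:R))); last first.
  by move=> a _; case: ifP; rewrite ?mul0r ?mulr0 // mul1r.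
rewrite (sum_ball_psum (fun a => Lam R a) (fun n => (~~ prime n)%:R / n%:R)).
have := sum_ppower_nonprime R x => h.
apply: (@le_trans _ _ (2 * psum (fun n => (ppower n && ~~ prime n)%:R * (ln n%:R / n%:R)) x)); last by lra.
rewrite -psumZ; apply: ler_psum => n _.
case: (boolP (ppower n)) => pn; last by rewrite sum_el_nonppower // !mul0r mulr0.
rewrite /= mulrA [2 * _]mulrC -mulrA; case: (~~ prime n); rewrite ?mul0r ?mulr0 //.
by rewrite !mul1r mulrA ler_wpM2r ?invr_ge0.
Qed.

(** Prime norms contribute at most [2 * theta x], hence [8 * x]; for the others [Lam R a] is at most
    [x] times [Lam R a / nm a], and [sum_Lam_nonprime] gives [320 * x]. *)
Lemma sum_Lam_le x : \sum_(a <- ball T x) Lam R a <= 328 * x%:R.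
Proof.
rewrite (bigID (fun a => prime (nm a))) /=.
have h1 : \sum_(a <- ball T x | prime (nm a)) Lam R a <= 8 * x%:R.
  rewrite big_mkcond /=.
  rewrite (eq_bigr (fun a => Lam R a * (prime (nm a))%:R)); last first.
    by move=> a _; case: ifP; rewrite ?mulr0 ?mulr1.
  rewrite (sum_ball_psum (fun a => Lam R a) (fun n => (prime n)%:R)).
  have := theta_le R x; rewrite /theta => h.
  apply: (@le_trans _ _ (2 * psum (fun n => (prime n)%:R * ln n%:R) x)); last by lra.
  rewrite -psumZ; apply: ler_psum => n _.
  by case: (prime n); rewrite ?mulr0 ?mul0r ?mulr0 // mulr1 mul1r.
have h2 : \sum_(a <- ball T x | ~~ prime (nm a)) Lam R a <= 320 * x%:R.
  apply: (@le_trans _ _ ((\sum_(a <- ball T x | ~~ prime (nm a)) Lam R a / (nm a)%:R) * x%:R)).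
    rewrite mulr_suml big_seq_cond [leRHS]big_seq_cond; apply: ler_sum => a /andP[]; rewrite mem_ball => ax _.
    rewrite mulrAC ler_pdivlMr ?ltr0n ?nm_gt0 // ler_wpM2l ?Lam_ge0 // ler_nat //.
  by rewrite ler_wpM2r // sum_Lam_nonprime.
lra.
Qed.

Lemma charged_prime_sum (gT : finGroupType) (cl : T -> gT) g : charged R cl g ->
  forall B : R, exists x,
    B < \sum_(a <- ball T x | (cl a == g) && prime (nm a)) Lam R a / (nm a)%:R.
Proof.
move=> cg B; have [x] := cg (B + 320); rewrite /Rcl (bigID (fun a => prime (nm a))) /= => h.
exists x; move: h.
have : \sum_(a <- ball T x | (cl a == g) && ~~ prime (nm a)) Lam R a / (nm a)%:R <= 320.
  apply: le_trans (sum_Lam_nonprime x); rewrite [leRHS](bigID (fun a => cl a == g)) /=.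
  rewrite [X in _ <= X + _](eq_bigl (fun a => (cl a == g) && ~~ prime (nm a))); last by move=> a; rewrite andbC.
  by rewrite lerDl sumr_ge0 // => a _; exact: Lam_div_ge0.
lra.
Qed.

End PrimeNorms.

(** * Dirichlet's theorem *)

Section CoprimeIntegers.
Variable M : nat.

Definition zok n := (0 < n)%N && coprime n M.
Definition zcar := {n : nat | zok n}.
Definition zmk n (zn : zok n) : zcar := exist _ n zn.
Implicit Types a b c p : zcar.

Lemma zokM m n : zok (m * n) = zok m && zok n.
Proof. by rewrite /zok muln_gt0 coprimeMl; exact: andbACA. Qed.

Lemma zmul_subproof a b : zok (val a * val b).
Proof. by rewrite zokM (valP a) (valP b). Qed.
Definition zmul a b : zcar := zmk (zmul_subproof a b).

Lemma zone_subproof : zok 1. Proof. by rewrite /zok coprime1n. Qed.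
Definition zone : zcar := zmk zone_subproof.

Definition zel n : seq zcar := pmap insub [:: n].

Lemma zmulA : associative zmul. Proof. by move=> a b c; apply: val_inj; rewrite /= mulnA. Qed.
Lemma zmulC : commutative zmul. Proof. by move=> a b; apply: val_inj; rewrite /= mulnC. Qed.
Lemma zmul1 : left_id zone zmul. Proof. by move=> a; apply: val_inj; rewrite /= mul1n. Qed.
Lemma z_gt0 a : (0 < val a)%N. Proof. by case/andP: (valP a). Qed.
Lemma zmulI : right_injective zmul.
Proof.
move=> a b c /(congr1 val)/eqP /=; rewrite eqn_pmul2l ?z_gt0 // => /eqP; exact: val_inj.
Qed.
Lemma zval_eq1 a : val a = 1%N -> a = zone. Proof. by move=> h; apply: val_inj. Qed.
Lemma zel_uniq n : uniq (zel n). Proof. by rewrite pmap_sub_uniq. Qed.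
Lemma mem_zel n a : (a \in zel n) = (val a == n).
Proof. by rewrite mem_pmap_sub inE. Qed.

Lemma z_irr_prime p : irreducible_in zmul zone p -> prime (val p).
Proof.
move=> [p1 H]; apply/primeP; split.
  rewrite ltn_neqAle z_gt0 andbT; apply/eqP => /esym h; apply: p1; exact: zval_eq1.
move=> d /dvdnP[q e]; have := valP p; rewrite e zokM => /andP[zq zd].
have [h|h] : zmk zq = zone \/ zmk zd = zone.
- by apply: H; apply: val_inj; rewrite /= e.
- by move/(congr1 val): h => /= ->; rewrite mul1n eqxx orbT.
- by move/(congr1 val): h => /= ->; rewrite eqxx.
Qed.

Lemma z_dvd a b : (val a %| val b)%N -> exists d, b = zmul a d.
Proof.
move=> /dvdnP[q e]; have := valP b; rewrite e zokM => /andP[zq _].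
by exists (zmk zq); apply: val_inj; rewrite /= e mulnC.
Qed.

Lemma z_euclid p a b c : irreducible_in zmul zone p -> zmul a b = zmul p c ->
  (exists d, a = zmul p d) \/ (exists d, b = zmul p d).
Proof.
move=> /z_irr_prime pp /(congr1 val) /= e.
have : (val p %| val a * val b)%N by rewrite e dvdn_mulr.
by rewrite Euclid_dvdM // => /orP[]/z_dvd; [left|right].
Qed.

Definition TZ : normUFD := @NormUFD zcar zmul zone val zel zmulA zmulC zmul1 zmulI
  (fun _ _ => erefl) z_gt0 zval_eq1 zel_uniq mem_zel z_euclid.

Lemma zel_ok n (zn : zok n) : zel n = [:: zmk zn].
Proof. by rewrite /zel /= (insubT _ zn). Qed.

Lemma zel_nok n : ~~ zok n -> zel n = [::].
Proof. by move=> zn; rewrite /zel /= insubF // (negbTE zn). Qed.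

Lemma sum_zel (V : nmodType) (F : nat -> V) n :
  \sum_(a <- el TZ n) F (val a) = if zok n then F n else 0.
Proof.
rewrite -[el TZ n]/(zel n); case: ifP => zn; first by rewrite (zel_ok zn) big_seq1.
by rewrite zel_nok ?zn // big_nil.
Qed.

Variable R : realType.

Lemma z_uirr (p : TZ) : uirr p -> prime (val p).
Proof. by move/asboolP/z_irr_prime. Qed.

Lemma z_Lam_ppower (a : TZ) : Lam R a != 0 -> ppower (nm a).
Proof.
move=> /Lam_neq0 [p [k [pp ->]]]; rewrite nm_upow; apply/asboolP.
by exists (nm p), k; split => //; exact: z_uirr.
Qed.

Lemma Lam_le_ln (T : normUFD) (a : T) : Lam R a <= ln (nm a)%:R.
Proof.
rewrite -(@sum_divs_Lam R) (bigD1_seq a) ?divs_uniq ?mem_divs ?udvd_refl //=.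
by rewrite lerDl sumr_ge0 // => d _; exact: Lam_ge0.
Qed.

Lemma z_sum_Lam_el n : \sum_(a <- el TZ n) Lam R a <= 2 * ln n%:R.
Proof.
have l0 := lnn_ge0 R n.
rewrite -[el TZ n]/(zel n); case: (boolP (zok n)) => zn; last by rewrite zel_nok // big_nil mulr_ge0.
rewrite (zel_ok zn) big_seq1; have := @Lam_le_ln TZ (zmk zn); rewrite /=; lra.
Qed.

Hypothesis M1 : (1 < M)%N.

Definition zcl (a : TZ) : {unit 'Z_M} := insubd (1%g : {unit 'Z_M}) ((val a)%:R : 'Z_M).

Lemma val_zcl a : val (zcl a) = (val a)%:R :> 'Z_M.
Proof. by rewrite /zcl insubdK // -topredE /= unitZpE // coprime_sym; case/andP: (valP a). Qed.

Lemma zclM (a b : TZ) : zcl (um a b) = (zcl a * zcl b)%g.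
Proof. by apply: val_inj; rewrite /= !val_zcl /= natrM. Qed.

Lemma count_mod r x : (0 < r < M)%N ->
  (\sum_(1 <= n < x.+1) (n %% M == r) = x %/ M + (r <= x %% M))%N.
Proof.
move=> r0; have M0 : (0 < M)%N by lia.
elim: x => [|x IH]; first by rewrite big_geq // div0n mod0n; case/andP: r0; lia.
have e : (M %| x.+1)%N = ((x %% M).+1 == M)%N.
  rewrite {1}(divn_eq x M) -addnS dvdn_addr ?dvdn_mull //.
  by apply/idP/eqP => [/dvdn_leq|-> //]; have := ltn_pmod x M0; lia.
rewrite big_nat_recr //= IH divnS // modnS e.
move: (ltn_pmod x M0); move: (x %/ M)%N (x %% M)%N => q t tM.
case: (eqVneq t.+1 M) => /= [h|/eqP h].
  have -> : (r <= t)%N by lia.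
  have -> : (r <= 0)%N = false by lia.
  have -> : (0%N == r) = false by lia.
  lia.
case: (eqVneq t.+1 r) => /= [h'|/eqP h'].
  by rewrite -h' leqnn ltnn; lia.
have -> : (r <= t.+1)%N = (r <= t)%N by lia.
by lia.
Qed.

Lemma z_count (g : {unit 'Z_M}) x :
  `|\sum_(a <- ball TZ x | zcl a == g) 1 - M%:R^-1 * x%:R| <= 1 :> R.
Proof.
have M0 : (0 < M)%N by lia.
pose r : nat := val (val g).
have gr : val g = r%:R :> 'Z_M by rewrite /r natr_Zp.
have rM : (r < M)%N by rewrite /r -[X in (_ < X)%N](Zp_cast M1) ltn_ord.
have cr : coprime M r by rewrite -(@unitZpE M) // -gr; exact: (valP g).
have r0 : (0 < r)%N.
  by rewrite lt0n; apply/eqP => e; move: cr; rewrite e /coprime gcdn0; lia.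
have -> : \sum_(a <- ball TZ x | zcl a == g) 1 = (x %/ M + (r <= x %% M))%:R :> R.
  rewrite -(@count_mod r) ?r0 // natr_sum big_mkcond sum_ball; apply: eq_bigr => n _.
  rewrite [LHS](eq_bigr (fun a : TZ => (val a %% M == r)%N%:R)); last first.
    move=> a _; have -> : (zcl a == g) = (val a %% M == r)%N; last by case: eqP.
    rewrite -val_eqE /= val_zcl gr; apply/eqP/eqP => [/(congr1 val)|h].
      by rewrite /= !val_Zp_nat // [(r %% M)%N]modn_small.
    by apply: val_inj; rewrite /= !val_Zp_nat // [(r %% M)%N]modn_small.
  rewrite (sum_zel (fun n => (n %% M == r)%N%:R)); case: ifP => // /negbT zn.
  case: eqP => // h; case/negP: zn; rewrite /zok coprime_sym -coprime_modr h cr andbT.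
  by rewrite lt0n; apply/eqP => n0; move: h; rewrite n0 mod0n; lia.
have p : 0 < M%:R :> R by rewrite ltr0n.
have h1 := divn_eq x M; have h2 := ltn_pmod x M0.
rewrite -(ler_pM2r p) -[X in _ * X <= _](gtr0_norm p) -normrM mul1r mulrBl mulrAC mulVf ?gt_eqF // mul1r.
rewrite -natrM mulnDl ler_norml; apply/andP; split.
  by rewrite lerNl opprB lerBlDr -natrD ler_nat; case: (r <= _)%N; rewrite ?mul1n ?mul0n; lia.
by rewrite lerBlDr -natrD ler_nat; case: (r <= _)%N; rewrite ?mul1n ?mul0n; lia.
Qed.

Lemma z_mulgC (g h : {unit 'Z_M}) : (g * h = h * g)%g.
Proof. by apply: val_inj; rewrite /= mulrC. Qed.

End CoprimeIntegers.

(** * Estimates for the hyperbola method *)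

Section MoreRealEstimates.
Variable R : realType.
Implicit Types (s phi : nat -> R) (x y z n m : nat).

Lemma psum_cat s x y : (x <= y)%N ->
  psum s y = psum s x + \sum_(x.+1 <= n < y.+1) s n.
Proof. by move=> xy; rewrite /psum -big_cat_nat. Qed.

Lemma psum_abel_tail s phi (S0 : R) y z :
  (forall n, `|psum s n| <= S0) ->
  (forall n, (0 < n)%N -> phi n.+1 <= phi n) -> (forall n, 0 <= phi n) -> (y <= z)%N ->
  `|psum (fun n => s n * phi n) z - psum (fun n => s n * phi n) y| <= 2 * S0 * phi y.+1.
Proof.
move=> H dec pos yz; rewrite (psum_abel s phi z) (psum_abel s phi y) [X in _ + X - _](psum_cat _ yz).
have S00 : 0 <= S0 by apply: le_trans (H 0%N).
set P := psum _ y; set D := \sum_(y.+1 <= n < z.+1) _.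
have hD : `|D| <= S0 * (phi y.+1 - phi z.+1).
  have -> : S0 * (phi y.+1 - phi z.+1) = \sum_(y.+1 <= n < z.+1) S0 * (phi n - phi n.+1).
    rewrite -mulr_sumr; congr (_ * _); move/subnKC: yz => <-.
    elim: (z - y)%N => [|k IH]; first by rewrite addn0 subrr big_geq.
    by rewrite addnS big_nat_recr /= -?IH; [ring | lia].
  apply: le_trans (ler_norm_sum _ _ _) _; apply: ler_sum_nat => n /andP[yn _].
  have d : 0 <= phi n - phi n.+1 by rewrite subr_ge0 dec //; lia.
  by rewrite normrM [X in _ * X]ger0_norm // ler_wpM2r.
have h1 : `|psum s z * phi z.+1| <= S0 * phi z.+1 by rewrite normrM [X in _ * X]ger0_norm // ler_wpM2r.
have h2 : `|psum s y * phi y.+1| <= S0 * phi y.+1 by rewrite normrM [X in _ * X]ger0_norm // ler_wpM2r.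
move: h1 h2; set U := psum s z * _; set V := psum s y * _ => h1 h2.
have -> : U + (P + D) - (V + P) = U + D - V by ring.
have := ler_normB (U + D) V; have := ler_normD U D; lra.
Qed.

Lemma rtM m n : rt R (m * n) = rt R m * rt R n.
Proof. by rewrite /rt natrM sqrtrM. Qed.

Lemma rt_sq n : rt R (n * n) = n%:R.
Proof. by rewrite rtM -expr2 rt_sqr. Qed.

(** The difference [u] decreases while [u] minus the inverse of [rt] increases, so both enclose a
    common limit. The constant is the value of the zeta function at 1/2. *)
Lemma psum_rtV_asymp : exists ze : R, forall n, (0 < n)%N ->
  `|psum (fun k => (rt R k)^-1) n - 2 * rt R n - ze| <= (rt R n)^-1.
Proof.
apply: limit_of_mutual_error => m n.
pose u k := psum (fun k => (rt R k)^-1) k - 2 * rt R k.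
suff W a b : (0 < a)%N -> (a <= b)%N -> `|u a - u b| <= (rt R a)^-1.
  have inv0 k : 0 <= (rt R k)^-1 by rewrite invr_ge0 rt_ge0.
  move=> m0 n0; case: (leqP m n) => [mn|/ltnW nm].
    by apply: le_trans (W _ _ m0 mn) _; rewrite lerDl.
  by rewrite distrC; apply: le_trans (W _ _ n0 nm) _; rewrite lerDr.
move=> a0 ab.
suff [h1 h2] : u b <= u a /\ u a - u b <= (rt R a)^-1 - (rt R b)^-1.
  by rewrite ger0_norm ?subr_ge0 //; have := rt_ge0 R b; rewrite -invr_ge0; lra.
move/subnKC: ab => <-; elim: (b - a)%N => [|k [IH1 IH2]]; first by rewrite addn0; split; lra.
set c := (a + k)%N in IH1 IH2 *; have c0 : (0 < c)%N by rewrite /c; lia.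
have us : u c.+1 = u c + (rt R c.+1)^-1 - 2 * (rt R c.+1 - rt R c).
  by rewrite /u psumS; ring.
rewrite addnS us.
have p := rt_gt0 R c0; have q := rt_gt0 R (ltn0Sn c); have pq := ler_rt R (leqnSn c).
have e1 := rt_sqr R c; have e2 := rt_sqr R c.+1; rewrite -natr1 -e1 in e2.
have k1 : (rt R c.+1)^-1 <= 2 * (rt R c.+1 - rt R c).
  by rewrite -[leLHS]div1r ler_pdivrMr //; nra.
have k2 : 2 * (rt R c.+1 - rt R c) <= (rt R c)^-1.
  by rewrite -[leRHS]div1r ler_pdivlMr //; nra.
by split; lra.
Qed.

Lemma harmonic_ge_ln y : ln y.+1%:R <= psum (fun n => n%:R^-1) y :> R.
Proof.
elim: y => [|y IH]; first by rewrite psum0 ln1.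
rewrite psumS; apply: le_trans (lerD IH (lexx _)); rewrite -lerBlDl; exact: ln_succ_le.
Qed.

(** Pairs with product at most [y * y] are split by whether the first member exceeds [y]; if it
    does, the second is at most [y] and becomes the outer variable. *)
Lemma sum_hyperbola (F G : nat -> R) y :
  psum (fun a => F a * psum G (y * y %/ a)) (y * y) =
  psum (fun a => F a * psum G (y * y %/ a)) y +
  psum (fun b => G b * (psum F (y * y %/ b) - psum F y)) y.
Proof.
have yy : (y <= y * y)%N by case: y => // y; rewrite leq_pmull.
rewrite (psum_cat _ yy); congr (_ + _).
transitivity (\sum_(y.+1 <= a < (y * y).+1) \sum_(1 <= b < y.+1 | (a * b <= y * y)%N) F a * G b).
  rewrite big_seq [RHS]big_seq; apply: eq_bigr => a; rewrite mem_index_iota => /andP[ya _].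
  have a0 : (0 < a)%N by lia.
  rewrite /psum (@big_nat_widen _ _ _ _ _ y.+1) ?mulr_sumr; last first.
    by rewrite ltnS -[leqRHS](mulnK _ a0) leq_div2r // leq_mul2l ltnW ?orbT.
  by apply: eq_bigl => b; rewrite ltnS leq_divRL // mulnC.
rewrite (exchange_big_dep xpredT) //=; apply: eq_big_nat => b /andP[b0 by_].
rewrite ltnS in by_.
have Ky : (y <= y * y %/ b)%N by rewrite leq_divRL // leq_mul2l by_ orbT.
rewrite (psum_cat _ Ky) addrAC subrr add0r mulr_sumr.
rewrite [RHS](@big_nat_widen _ _ _ _ _ (y * y).+1); last by rewrite ltnS leq_div.
rewrite (eq_bigl (fun a => (a < (y * y %/ b).+1)%N)) => [|a]; last by rewrite ltnS leq_divRL.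
by apply: eq_bigr => a _; rewrite mulrC.
Qed.

End MoreRealEstimates.

(** * No real character is vanishing *)

Section RealCharacter.
Variables (R : realType) (M : nat).
Hypothesis M1 : (1 < M)%N.
Variable lam : {unit 'Z_M} -> R.
Hypothesis lamM : forall g h, lam (g * h)%g = lam g * lam h.
Hypothesis lam_sq : forall g, lam g ^+ 2 = 1.
Hypothesis lam_van : vanishing (@zcl M) lam.

(** The Dirichlet character of [lam]: the sum has at most one term, and it is empty when [n] is not
    a positive integer prime to [M]. *)
Definition chi n : R := \sum_(a <- zel M n) lam (zcl a).

Lemma chiE n (zn : zok M n) : chi n = lam (zcl (zmk zn)).
Proof. by rewrite /chi (zel_ok zn) big_seq1. Qed.

Lemma chi0 n : ~~ zok M n -> chi n = 0.
Proof. by move=> zn; rewrite /chi zel_nok // big_nil. Qed.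

Lemma chiM m n : chi (m * n) = chi m * chi n.
Proof.
case: (boolP (zok M m)) => zm; last by rewrite [chi m]chi0 // mul0r chi0 // zokM (negbTE zm).
case: (boolP (zok M n)) => zn; last by rewrite [chi n]chi0 // mulr0 chi0 // zokM (negbTE zn) andbF.
have zmn : zok M (m * n) by rewrite zokM zm.
rewrite (chiE zm) (chiE zn) (chiE zmn) -lamM -zclM //; congr (lam (zcl _)); exact: val_inj.
Qed.

Lemma lam1 : lam 1%g = 1.
Proof. by have := lamM 1%g 1%g; have := lam_sq 1%g; rewrite mulg1 expr2 => -> . Qed.

Lemma chi1 : chi 1 = 1.
Proof.
rewrite (chiE (zone_subproof M)); suff -> : zcl (zmk (zone_subproof M)) = 1%g by exact: lam1.
by apply: val_inj; rewrite val_zcl.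
Qed.

Lemma chi_cases n : [\/ chi n = 0, chi n = 1 | chi n = -1].
Proof.
case: (boolP (zok M n)) => zn; last by constructor 1; exact: chi0.
rewrite (chiE zn); have /eqP := lam_sq (zcl (zmk zn)); rewrite sqrf_eq1.
by case/orP => /eqP ->; [constructor 2|constructor 3].
Qed.

Lemma chiX m k : chi (m ^ k) = chi m ^+ k.
Proof. by elim: k => [|k IH]; [exact: chi1 | rewrite expnS chiM IH exprS]. Qed.

(** The convolution of 1 and [chi], taken on [TZ 1], the monoid of all positive integers, because
    the factor 1 does not vanish on integers that share a divisor with [M]. *)
Definition rchi (a : TZ 1) := \sum_(d <- divs a) chi (nm d).

Lemma geom_chi_ge p k : (~~ odd k)%:R <= \sum_(0 <= j < k.+1) chi p ^+ j.
Proof.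
case: (chi_cases p) => ->.
- rewrite big_ltn // expr0 big1_seq ?addr0; first by case: odd.
  by move=> [|j] /andP[_]; rewrite mem_index_iota // exprS mul0r.
- under eq_bigr do rewrite expr1n.
  by rewrite sumr_const_nat subn0 -[1 *+ _]/(_%:R) ler_nat; case: odd.
- suff -> : \sum_(0 <= j < k.+1) (-1) ^+ j = (~~ odd k)%:R :> R by [].
  elim: k => [|k IH]; first by rewrite big_nat1.
  rewrite big_nat_recr //= IH -signr_odd /=.
  by case: (odd k) => /=; rewrite ?expr0 ?expr1 ?add0r ?subrr.
Qed.

Lemma rchi_decomp p k b : uirr p -> ~~ udvd p b ->
  rchi (um (upow p k) b) = (\sum_(0 <= j < k.+1) chi (nm p) ^+ j) * rchi b.
Proof.
move=> pp nb; rewrite /rchi big_divs_decomp // mulr_suml; apply: eq_bigr => j _.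
by rewrite mulr_sumr; apply: eq_bigr => d _; rewrite nmM chiM nm_upow chiX.
Qed.

(** [rchi] is multiplicative, and its factor at [p ^ k] is nonnegative, and at least 1 for even
    [k]. *)
Lemma rchi_ge (a : TZ 1) : 0 <= rchi a /\ 1 <= rchi (um a a).
Proof.
have [n] := ubnP (nm a); elim: n a => // n IH a an.
case: (eqVneq a (u1 _)) => [->|/eqP a1].
  by rewrite u1m /rchi divs1 big_seq1 nm1 chi1.
have [p pp pa] := exists_uirr a1.
have [k [b [e nb]]] := upow_decomp a (uirr_neq1 pp).
case: k e => [e|k e]; first by move: pa; rewrite e u1m (negbTE nb).
have [|h1 h2] := IH b.
  move: an; rewrite e nmM nm_upow expnS; have := nm_gt1 (uirr_neq1 pp); have := nm_gt0 b.
  have : (0 < nm p ^ k)%N by rewrite expn_gt0 nm_gt0.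
  move: (nm p) (nm b) (nm p ^ k)%N => A B C C0 B0 A1.
  have : (2 * 1 * B <= A * C * B)%N by rewrite !leq_mul.
  lia.
have g1 := geom_chi_ge (nm p) k.+1; have g2 := geom_chi_ge (nm p) (k.+1 + k.+1)%N.
split.
  rewrite e rchi_decomp // mulr_ge0 //; apply: le_trans g1; exact: ler0n.
have -> : um a a = um (upow p (k.+1 + k.+1)) (um b b).
  by rewrite e upowD; move: (upow p k.+1) => P; rewrite -!umA (umCA b).
have nbb : ~~ udvd p (um b b) by rewrite uirr_euclid // negb_or nb.
rewrite rchi_decomp //.
rewrite oddD addbb /= in g2.
have h3 : 0 <= rchi (um b b) by exact: le_trans h2.
by apply: le_trans h2 _; rewrite ler_peMl.
Qed.

Let S0 : R := l1 lam.

Lemma chi_sum_bound n : `|psum chi n| <= S0.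
Proof.
have -> : psum chi n = \sum_(a <- ball (TZ M) n) 1 * lam (zcl a).
  rewrite sum_ball; apply: eq_bigr => k _; rewrite /chi.
  by apply: eq_bigr => a _; rewrite mul1r.
rewrite sum_ball_class.
have -> : \sum_g lam g * \sum_(a <- ball (TZ M) n | zcl a == g) 1 =
   \sum_g lam g * (\sum_(a <- ball (TZ M) n | zcl a == g) 1 - M%:R^-1 * n%:R).
  under [RHS]eq_bigr do rewrite mulrBr.
  by rewrite sumrB -mulr_suml lam_van.1 mul0r subr0.
apply: le_trans (ler_norm_sum _ _ _) _; apply: ler_sum => g _.
by rewrite normrM ler_piMr // z_count.
Qed.

Lemma S0_ge0 : 0 <= S0. Proof. exact: l1_ge0. Qed.

(** The series has sum 0, so a partial sum is minus a tail, and the bounded partial sums of [chi]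
    make the tail [O(1 / y)]. The rate [1 / rt y] that comes with [vanishing] would be too weak
    against the factor [y] in the hyperbola method. *)
Lemma chi_inv_bound y : `|psum (fun n => chi n / n%:R) y| <= 2 * S0 / y.+1%:R.
Proof.
have [C [C0 HC]] := lam_van.2.
have E z : mean (@zcl M) (shift 1%g lam) z = psum (fun n => chi n / n%:R) z.
  rewrite meanE; apply: eq_bigr => n _; congr (_ / _).
  by apply: eq_bigr => a _; rewrite /shift mul1g.
apply/ler_addgt0Pr => e e0.
(* A square cutoff [w], so large that the bound [C / rt w], which is [C / z], falls below [e]. *)
pose z := maxn y (Num.bound (C / e)).+1; pose w := (z * z)%N.
have z0 : (0 < z)%N by rewrite /z; lia.
have yw : (y <= w)%N.
  by apply: (@leq_trans z); [rewrite leq_maxl | rewrite leq_pmulr].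
have h1 : `|psum (fun n => chi n / n%:R) w| <= e.
  rewrite -E; apply: le_trans (HC _ _ _) _; first by rewrite muln_gt0 z0.
  rewrite rt_sq ler_pdivrMr ?ltr0n // -ler_pdivrMl // mulrC.
  have b0 : 0 <= C / e by rewrite divr_ge0 // ltW.
  apply: le_trans (ltW (archi_boundP b0)) _; rewrite ler_nat /z; lia.
have := psum_abel_tail chi_sum_bound (phi := fun n => n%:R^-1) _ _ yw.
have d1 : forall n, (0 < n)%N -> n.+1%:R^-1 <= n%:R^-1 :> R.
  by move=> n n0; rewrite lef_pV2 ?posrE ?ltr0n // ler_nat.
have d2 : forall n : nat, 0 <= n%:R^-1 :> R by move=> n; rewrite invr_ge0.
move=> /(_ d1 d2); move: h1; set X := psum _ w; set Y := psum _ y => h1 h2.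
have := ler_normB X (X - Y); have -> : X - (X - Y) = Y by ring.
by move/le_trans; apply; rewrite [leRHS]addrC; apply: lerD.
Qed.

Lemma chi_rt_tail y z : (y <= z)%N ->
  `|psum (fun n => chi n / rt R n) z - psum (fun n => chi n / rt R n) y| <= 2 * S0 / rt R y.+1.
Proof.
apply: (psum_abel_tail (phi := fun n => (rt R n)^-1)); first exact: chi_sum_bound.
  by move=> n n0; rewrite lef_pV2 ?posrE ?rt_gt0 // ler_rt.
by move=> n; rewrite invr_ge0 rt_ge0.
Qed.

Lemma sum_rchi x : \sum_(a <- ball (TZ 1) x) rchi a / rt R (nm a) =
  psum (fun n => chi n / rt R n * psum (fun k => (rt R k)^-1) (x %/ n)) x.
Proof.
have sumel (F : nat -> R) n : (0 < n)%N -> \sum_(a <- el (TZ 1) n) F (nm a) = F n.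
  by move=> n0; rewrite (@sum_zel 1 R F n) /zok n0 coprimen1.
under eq_bigr do rewrite /rchi mulr_suml.
rewrite (@sum_ball_divs (TZ 1) R (fun d a => chi (nm d) / rt R (nm a))) sum_ball.
apply: eq_big_nat => n /andP[n0 _].
rewrite -(sumel (fun n => chi n / rt R n * psum (fun k => (rt R k)^-1) (x %/ n)) n n0).
apply: eq_bigr => d _; rewrite sum_ball mulr_sumr; apply: eq_big_nat => m /andP[m0 _].
rewrite -(sumel (fun m => chi (nm d) / rt R (nm d) * (rt R m)^-1) m m0).
by apply: eq_bigr => e _; rewrite nmM rtM invfM mulrA.
Qed.

Lemma sum_rchi_ge y : psum (fun n => n%:R^-1) y <=
  \sum_(a <- ball (TZ 1) (y * y)) rchi a / rt R (nm a).
Proof.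
have F0 (a : TZ 1) : 0 <= rchi a / rt R (nm a) by rewrite divr_ge0 ?rt_ge0 //; case: (rchi_ge a).
apply: (@le_trans _ _ (\sum_(a <- [seq um b b | b <- ball (TZ 1) y]) rchi a / rt R (nm a))).
  rewrite big_map; apply: (@le_trans _ _ (\sum_(b <- ball (TZ 1) y) (nm b)%:R^-1)).
    rewrite sum_ball; apply: ler_sum_nat => n /andP[n0 _].
    by rewrite (@sum_zel 1 R (fun n => n%:R^-1) n) /zok n0 coprimen1.
  apply: ler_sum => b _; rewrite nmM rt_sq ler_peMl ?invr_ge0 //; by case: (rchi_ge b).
apply: sum_subset_le => //.
  rewrite map_inj_in_uniq ?ball_uniq // => a b _ _ /(congr1 (@nm _)); rewrite !nmM => h.
  by apply: val_inj; rewrite -[val a]/(nm a) -[val b]/(nm b); nia.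
move=> a /mapP[b]; rewrite !mem_ball => h ->; rewrite nmM; exact: leq_mul.
Qed.

(* Mertens: [1 * chi] is nonnegative and at least [1] on squares, so its sum against [1 / sqrt n] is at least harmonic, while
   the hyperbola method bounds that sum when the mean of [chi] vanishes. *)
Lemma real_character_nonvanishing : False.
Proof.
have [ze Hze] := psum_rtV_asymp R.
pose Zs := psum (fun k => (rt R k)^-1).
pose X := psum (fun n => chi n / rt R n).
have X_bound y : `|X y| <= 2 * S0.
  have := chi_rt_tail (leq0n y); rewrite psum0 subr0.
  by have -> : rt R 1 = 1 by [rewrite /rt sqrtr1]; rewrite divr1.
suff B y : (0 < y)%N -> psum (fun n => n%:R^-1) y <= 8 * S0 + 2 * `|ze| * S0 + 4.
  have [x x0 hx] := @ln_unbounded R (8 * S0 + 2 * `|ze| * S0 + 4).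
  have := B x x0; have := harmonic_ge_ln R x.
  have := @ler_lnn R x x.+1 x0 (leqnSn x); lra.
move=> y0; apply: le_trans (sum_rchi_ge y) _; rewrite sum_rchi.
rewrite (sum_hyperbola (fun n => chi n / rt R n) (fun k => (rt R k)^-1)) -/Zs -/X.
have py : 0 < y%:R :> R by rewrite ltr0n.
have chi_le n : `|chi n| <= 1 by case: (chi_cases n) => ->; rewrite ?normr0 ?normrN1 ?normr1.
(* The range beyond [y]: the tail of [X] is [O(1 / rt y)], while [Zs y] is [O(rt y)]. *)
have part2 : psum (fun b => (rt R b)^-1 * (X (y * y %/ b)%N - X y)) y <= 4 * S0.
  apply: (@le_trans _ _ (2 * S0 / rt R y.+1 * Zs y)).
    rewrite -psumZ; apply: ler_psum => b /andP[b0 by_].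
    rewrite mulrC ler_wpM2r ?invr_ge0 ?rt_ge0 //; apply: le_trans (ler_norm _) _.
    by apply: chi_rt_tail; rewrite leq_divRL // leq_mul2l by_ orbT.
  have h := psum_rtV R y; have q := rt_gt0 R (ltn0Sn y).
  apply: (@le_trans _ _ (2 * S0 / rt R y.+1 * (2 * rt R y.+1))).
    apply: ler_wpM2l; first by rewrite divr_ge0 ?mulr_ge0 ?S0_ge0 // ltW.
    by apply: le_trans h _; have := ler_rt R (leqnSn y); lra.
  by rewrite le_eqVlt; apply/orP; left; apply/eqP; field; lra.
(* Here [Zs (y * y %/ a)] is [2 * y / rt a + ze] up to [4 * rt a / y]. The leading term yields
   [2 * y] times a partial sum of [chi n / n], which [chi_inv_bound] keeps bounded. *)
have part1 : psum (fun a => chi a / rt R a * Zs (y * y %/ a)%N) y <=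
   2 * y%:R * psum (fun n => chi n / n%:R) y + ze * X y + 4.
  have -> : 2 * y%:R * psum (fun n => chi n / n%:R) y + ze * X y + 4 =
     psum (fun a => 2 * y%:R * (chi a / a%:R) + ze * (chi a / rt R a) + 4 / y%:R) y.
    rewrite /psum !big_split /= -!mulr_sumr; congr (_ + _).
    by rewrite sumr_const_nat subn1 -[X in 4 * X]mulr_natr mulVf ?mulr1 // gt_eqF.
  apply: ler_psum => a /andP[a0 ay].
  have pa := rt_gt0 R a0; have aa := rt_sqr R a.
  have N0 : (0 < y * y %/ a)%N.
    by rewrite divn_gt0 //; apply: leq_trans ay _; rewrite leq_pmulr.
  have key : `|Zs (y * y %/ a)%N - 2 * (y%:R / rt R a) - ze| <= 4 * rt R a / y%:R.
    have h1 := Hze _ N0; rewrite -/Zs in h1.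
    have h2 : (rt R (y * y %/ a))^-1 <= 2 * rt R a / y%:R.
      rewrite -(rt_sq R y); apply: rt_divn; rewrite a0 /=.
      by apply: leq_trans ay _; rewrite leq_pmulr.
    have pN := rt_gt0 R N0; have eN := rt_sqr R (y * y %/ a).
    set N := (y * y %/ a)%N in N0 h1 h2 pN eN *.
    pose t := y%:R / rt R a.
    have pt : 0 < t by rewrite divr_gt0.
    have et : t ^+ 2 = y%:R ^+ 2 / a%:R by rewrite /t expr_div_n aa.
    have paR : 0 < a%:R :> R by rewrite ltr0n.
    have lo : N%:R <= t ^+ 2 by rewrite et ler_pdivlMr // -natrX -natrM ler_nat leq_divM.
    have hi : t ^+ 2 <= N%:R + 1.
      by rewrite et ler_pdivrMr // natr1 -natrX -natrM ler_nat ltnW // ltn_ceil.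
    rewrite -eN in lo hi.
    have tN : rt R N <= t by rewrite -(@ler_pXn2r _ 2) ?nnegrE ?rt_ge0 //; exact: ltW.
    have tN2 : t - rt R N <= t^-1.
      rewrite -[leRHS]div1r ler_pdivlMr //; nra.
    have tV : t^-1 = rt R a / y%:R by rewrite /t invf_div.
    rewrite -/t -mulrA -tV; rewrite -mulrA -tV in h2.
    move: h1; rewrite !ler_norml => /andP[h3 h4]; apply/andP; split; lra.
  have -> : 2 * y%:R * (chi a / a%:R) + ze * (chi a / rt R a) + 4 / y%:R =
      chi a / rt R a * (2 * (y%:R / rt R a) + ze) + 4 / y%:R.
    by rewrite -aa; field; lra.
  have -> : Zs (y * y %/ a)%N = (2 * (y%:R / rt R a) + ze) + (Zs (y * y %/ a)%N - 2 * (y%:R / rt R a) - ze) by ring.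
  rewrite mulrDr lerD2l; apply: le_trans (ler_norm _) _.
  rewrite 2!normrM normfV [`|rt R a|]gtr0_norm //.
  have -> : 4 / y%:R = 1 / rt R a * (4 * rt R a / y%:R) by field; lra.
  by apply: ler_pM => //; [rewrite mulr_ge0 // invr_ge0 ltW | rewrite ler_wpM2r // invr_ge0 ltW].
have h3 : 2 * y%:R * psum (fun n => chi n / n%:R) y <= 4 * S0.
  have := chi_inv_bound y; have := S0_ge0; set E := psum _ y => s0 h.
  apply: (@le_trans _ _ (2 * y%:R * (2 * S0 / y.+1%:R))).
    apply: ler_wpM2l; first by rewrite mulr_ge0.
    exact: le_trans (ler_norm _) h.
  have -> : 2 * y%:R * (2 * S0 / y.+1%:R) = 4 * S0 * (y%:R / y.+1%:R) by ring.
  rewrite ler_piMr ?mulr_ge0 // ler_pdivrMr ?ltr0n // mul1r ler_nat //.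
have h4 : ze * X y <= 2 * `|ze| * S0.
  apply: le_trans (ler_norm _) _; rewrite normrM.
  have := ler_wpM2l (normr_ge0 ze) (X_bound y); lra.
lra.
Qed.

End RealCharacter.

(** * Primes in arithmetic progressions *)

Section Dirichlet.
Variables (R : realType) (M : nat).
Hypothesis M1 : (1 < M)%N.
Let cl := @zcl M.

Let A0 : 0 < M%:R^-1 :> R. Proof. by rewrite invr_gt0 ltr0n; lia. Qed.
Let clM : forall a b : TZ M, cl (um a b) = (cl a * cl b)%g := @zclM M M1.
Let cnt g x : `|\sum_(a <- ball (TZ M) x | cl a == g) 1 - M%:R^-1 * x%:R| <= 1 * rt R x.
Proof.
case: (posnP x) => [->|x0]; last by rewrite mul1r; apply: le_trans (z_count R M1 g x) (rt_ge1 R x0).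
by rewrite /ball big_nil mulr0 subrr normr0 mul1r rt_ge0.
Qed.
Let cheb x : \sum_(a <- ball (TZ M) x) Lam R a <= 328 * x%:R.
Proof. by apply: sum_Lam_le; [exact: z_Lam_ppower | exact: z_sum_Lam_el]. Qed.

Theorem z_all_charged g : charged R cl g.
Proof.
have h328 : 0 <= 328 :> R by [].
apply: (all_charged clM A0 ler01 cnt h328 cheb) => f vf.
have chg := vanishing_charged (@z_mulgC M) clM A0 ler01 cnt h328 cheb.
(* The classes acting on [f] by a sign form a subgroup that contains every charged class, hence
   everything; then [f] divided by its value at 1 is multiplicative with values 1 and -1. *)
pose Hs := [set h | `[< (forall k, f (h * k)%g = f k) \/ (forall k, f (h * k)%g = - f k) >]]%SET.
have HsE h : (h \in Hs) <-> (forall k, f (h * k)%g = f k) \/ (forall k, f (h * k)%g = - f k).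
  by rewrite finset.inE; split=> [/asboolW|/asboolT].
have gH : group_set Hs.
  apply/group_setP; split; first by apply/HsE; left=> k; rewrite mul1g.
  move=> h1 h2 /HsE H1 /HsE H2; apply/HsE.
  by case: H1 => H1; case: H2 => H2; [left|right|right|left] => k; rewrite -mulgA H1 H2 ?opprK.
have gen := charged_gen (@z_mulgC M) clM A0 ler01 cnt h328 cheb (H := Group gH).
have {}gen h : (forall k, f (h * k)%g = f k) \/ (forall k, f (h * k)%g = - f k).
  by apply/HsE; apply: gen => c cc; apply/HsE; right=> k; exact: chg.
have f1 h : f h = f 1%g \/ f h = - f 1%g.
  by have [H|H] := gen h; [left|right]; rewrite -{1}[h]mulg1 H.
case: (eqVneq (f 1%g) 0) => [f10 g1|nz].
  by case: (f1 g1) => ->; rewrite f10 ?oppr0.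
exfalso; pose lam h := f h / f 1%g.
have lam_sq h : lam h ^+ 2 = 1.
  by rewrite /lam; case: (f1 h) => ->; rewrite ?mulNr divff // ?sqrrN expr1n.
apply: (@real_character_nonvanishing R M M1 lam) => //.
  move=> h k; rewrite /lam; have [H|H] := gen h.
    by rewrite -{2}[h]mulg1 !H divff // mul1r.
  by rewrite -{2}[h]mulg1 !H !mulNr divff // mul1r.
have [f0 [C [C0 HC]]] := vf; split; first by rewrite -mulr_suml f0 mul0r.
exists (C / `|f 1%g|); split; first by rewrite divr_ge0.
move=> k x x0.
have -> : mean cl (shift k lam) x = mean cl (shift k f) x / f 1%g.
  by rewrite /mean mulr_suml; apply: eq_bigr => a _; rewrite /shift /lam mulrAC.
by rewrite normrM normfV mulrAC; apply: ler_wpM2r; [rewrite invr_ge0 | exact: HC].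
Qed.

Theorem dirichlet_sum r : coprime r M -> forall B : R, exists x,
  B < psum (fun n => (prime n && (n == r %[mod M]))%N%:R * (ln n%:R / n%:R)) x.
Proof.
move=> cr B; have zr : zok M r.
  by rewrite /zok cr andbT lt0n; apply/eqP => r0; move: cr; rewrite r0 /coprime gcd0n; lia.
have [||x hx] := @charged_prime_sum R (TZ M) _ _ _ cl (zcl (zmk zr)) (z_all_charged _) B.
- exact: z_Lam_ppower.
- exact: z_sum_Lam_el.
exists x; apply: lt_le_trans hx _.
rewrite big_mkcond sum_ball; apply: ler_sum_nat => n /andP[n0 _].
apply: (@le_trans _ _ (\sum_(a <- el (TZ M) n) (prime (val a) && (val a == r %[mod M]))%N%:R * (ln (val a)%:R / (val a)%:R))).
  apply: ler_sum => a _.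
  have -> : (cl a == zcl (zmk zr)) = (val a == r %[mod M])%N.
    rewrite -val_eqE /= !val_zcl //; apply/eqP/eqP => [/(congr1 val)|h].
      by rewrite /= !val_Zp_nat.
    by apply: val_inj; rewrite /= !val_Zp_nat.
  rewrite andbC -[nm a]/(val a); case: ifP => _; last by rewrite mul0r.
  by rewrite mul1r ler_wpM2r ?invr_ge0 //; exact: Lam_le_ln.
rewrite (@sum_zel M R (fun n => (prime n && (n == r %[mod M]))%N%:R * (ln n%:R / n%:R))).
by case: ifP => // _; rewrite mulr_ge0 // divr_ge0 // lnn_ge0.
Qed.

End Dirichlet.

(** * Counting lattice points by the form u^2 + 3 v^2 *)

Definition qf (z : int * int) : nat := absz (z.1 ^+ 2 + 3 * z.2 ^+ 2).

Lemma qform_ge0 (u v : int) : 0 <= u ^+ 2 + 3 * v ^+ 2.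
Proof. by apply: addr_ge0; [exact: sqr_ge0 | apply: mulr_ge0 => //; exact: sqr_ge0]. Qed.

Lemma qfE z : (qf z)%:Z = z.1 ^+ 2 + 3 * z.2 ^+ 2.
Proof. by rewrite /qf gez0_abs // qform_ge0. Qed.

Definition irange (n : nat) : seq int := [seq i%:Z - n%:Z | i <- iota 0 (n.*2.+1)].

Lemma mem_irange n (u : int) : (u \in irange n) = (`|u| <= n)%N.
Proof.
apply/mapP/idP => [[i]|h]; first by rewrite mem_iota => h ->; lia.
by exists (absz (u + n%:Z)); [rewrite mem_iota; lia | lia].
Qed.

Lemma irange_uniq n : uniq (irange n).
Proof. by rewrite map_inj_uniq ?iota_uniq // => i j; lia. Qed.

Definition disc (x : nat) : seq (int * int) :=
  [seq z <- [seq (u, v) | u <- irange x, v <- irange x] | (qf z <= x)%N].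

Lemma absz_sqr_le (u : int) (x : nat) : u ^+ 2 <= x%:Z -> (`|u| <= x)%N.
Proof. by move=> h; nia. Qed.

Lemma mem_disc x z : (z \in disc x) = (qf z <= x)%N.
Proof.
rewrite mem_filter andb_idr //; case: z => u v h; apply: allpairs_f; rewrite mem_irange;
  apply: absz_sqr_le; have := qfE (u, v); move: h; move: (qf _) => q h /=;
  have := sqr_ge0 u; have := sqr_ge0 v; lia.
Qed.

Lemma disc_uniq x : uniq (disc x).
Proof. by rewrite filter_uniq // allpairs_uniq ?irange_uniq // => -[? ?] [? ?]. Qed.

Definition rclass (k : nat) (i j : int) (z : int * int) :=
  ((z.1 == i %[mod k])%Z && (z.2 == j %[mod k])%Z).

Definition rcount k i j x := count (rclass k i j) (disc x).
Definition dcount (n : nat) := size (disc (n * n)).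

Lemma cauchy_schwarz (u v i j : int) :
  (u * i + 3 * (v * j)) ^+ 2 <= (u ^+ 2 + 3 * v ^+ 2) * (i ^+ 2 + 3 * j ^+ 2).
Proof. by have := sqr_ge0 (u * j - v * i); nia. Qed.

(** The triangle inequality for the norm with square [u^2 + 3 v^2], squared to stay within the
    integers. *)
Lemma qf_add_le (a b i j m r : int) : 0 <= m -> 0 <= r ->
  a ^+ 2 + 3 * b ^+ 2 <= m ^+ 2 -> i ^+ 2 + 3 * j ^+ 2 <= r ^+ 2 ->
  (a + i) ^+ 2 + 3 * (b + j) ^+ 2 <= (m + r) ^+ 2.
Proof.
move=> m0 r0 h1 h2; have cs := cauchy_schwarz a b i j.
have h3 : (a * i + 3 * (b * j)) ^+ 2 <= (m * r) ^+ 2.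
  apply: le_trans cs _; rewrite exprMn; by apply: ler_pM => //; exact: qform_ge0.
have h4 : a * i + 3 * (b * j) <= m * r.
  case: (lerP (a * i + 3 * (b * j)) 0) => [h|h]; first by apply: le_trans h _; exact: mulr_ge0.
  by rewrite -(@ler_pXn2r _ 2) ?nnegrE ?mulr_ge0 // ltW.
have -> : (a + i) ^+ 2 + 3 * (b + j) ^+ 2 = a ^+ 2 + 3 * b ^+ 2 + (i ^+ 2 + 3 * j ^+ 2) + 2 * (a * i + 3 * (b * j)) by ring.
have -> : (m + r) ^+ 2 = m ^+ 2 + r ^+ 2 + 2 * (m * r) by ring.
lra.
Qed.

Lemma leq_qf z (m : nat) : (qf z <= m * m)%N = (z.1 ^+ 2 + 3 * z.2 ^+ 2 <= m%:Z ^+ 2).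
Proof. by rewrite -qfE expr2 -PoszM lez_nat. Qed.

Section ResidueCounts.
Variables (k : nat).
Hypothesis k0 : (0 < k)%N.
Let p2 : 0 <= 2 * k%:Z. Proof. by []. Qed.

Lemma mod_sqr_le (a b : int) :
  (a %% k)%Z ^+ 2 + 3 * (b %% k)%Z ^+ 2 <= (2 * k%:Z) ^+ 2.
Proof.
set i := (a %% k)%Z; set j := (b %% k)%Z; have i0 : 0 <= i < k%:Z by rewrite modz_ge0 ?ltz_pmod //; lia.
have j0 : 0 <= j < k%:Z by rewrite modz_ge0 ?ltz_pmod //; lia.
nia.
Qed.

(** Subtracting the residues moves a point by at most [2 * k] in this norm, and division by [k]
    leaves a point of radius at most [n + 2]. Within one residue class the quotients determine the
    point. *)
Lemma rcount_le (i j : int) n : (rcount k i j ((k * n) * (k * n)) <= dcount (n + 2))%N.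
Proof.
rewrite /rcount -size_filter /dcount.
pose h (z : int * int) := ((z.1 %/ k)%Z, (z.2 %/ k)%Z).
rewrite -(size_map h); apply: uniq_leq_size.
  rewrite map_inj_in_uniq ?(filter_uniq _ (disc_uniq _)) // => -[u v] [u' v'].
  rewrite !mem_filter => /andP[/andP[/eqP/= c1 /eqP/= c2] _] /andP[/andP[/eqP/= c3 /eqP/= c4] _] [e1 e2].
  by rewrite (divz_eq u k) (divz_eq u' k) (divz_eq v k) (divz_eq v' k) e1 e2 c1 c2 c3 c4.
move=> w /mapP[[u v]]; rewrite mem_filter => /andP[_]; rewrite !mem_disc !leq_qf /= => H ->.
rewrite /h /=; have m := mod_sqr_le u v.
have := @qf_add_le u v (- (u %% k)%Z) (- (v %% k)%Z) (k * n)%N%:Z (2 * k%:Z).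
rewrite !sqrrN => /(_ isT p2 H m).
have -> : u - (u %% k)%Z = (u %/ k)%Z * k%:Z by rewrite {1}(divz_eq u k) addrK.
have -> : v - (v %% k)%Z = (v %/ k)%Z * k%:Z by rewrite {1}(divz_eq v k) addrK.
move: (u %/ k)%Z (v %/ k)%Z => q1 q2.
have -> : (q1 * k%:Z) ^+ 2 + 3 * (q2 * k%:Z) ^+ 2 = (q1 ^+ 2 + 3 * q2 ^+ 2) * k%:Z ^+ 2 by ring.
have -> : ((k * n)%N%:Z + 2 * k%:Z) ^+ 2 = (n + 2)%N%:Z ^+ 2 * k%:Z ^+ 2.
  by rewrite PoszM PoszD; ring.
by rewrite ler_pM2r // exprn_gt0 // ltz_nat.
Qed.

Lemma rcount_ge (i j : int) n : (dcount n <= rcount k i j ((k * (n + 2)) * (k * (n + 2))))%N.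
Proof.
rewrite /rcount -size_filter /dcount.
pose h (z : int * int) := (z.1 * k%:Z + (i %% k)%Z, z.2 * k%:Z + (j %% k)%Z).
have kz : k%:Z != 0 by lia.
have nk : 0 <= n%:Z * k%:Z by rewrite -PoszM.
rewrite -(size_map h); apply: uniq_leq_size.
  rewrite map_inj_uniq ?disc_uniq // => -[u v] [u' v'] [] /addIr/(mulIf kz) -> /addIr/(mulIf kz) -> //.
move=> w /mapP[[u v]]; rewrite mem_disc leq_qf /= => H ->; rewrite mem_filter mem_disc leq_qf.
rewrite /rclass /h /= !modzMDl !modz_mod !eqxx /=.
have m := mod_sqr_le i j.
have := @qf_add_le (u * k%:Z) (v * k%:Z) (i %% k)%Z (j %% k)%Z (n%:Z * k%:Z) (2 * k%:Z) nk p2.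
have -> : (k * (n + 2))%N%:Z = n%:Z * k%:Z + 2 * k%:Z by rewrite PoszM PoszD; ring.
apply => //.
have -> : (u * k%:Z) ^+ 2 + 3 * (v * k%:Z) ^+ 2 = (u ^+ 2 + 3 * v ^+ 2) * k%:Z ^+ 2 by ring.
by rewrite exprMn ler_wpM2r // exprn_ge0.
Qed.

Lemma residue_sum (u : int) : (\sum_(i < k) (u == i%:Z %[mod k])%Z = 1)%N.
Proof.
have kz : k%:Z != 0 by lia.
have h : (`|(u %% k)%Z| < k)%N by have := modz_ge0 u kz; have := ltz_pmod u (ltac:(lia) : 0 < k%:Z); lia.
rewrite (bigD1 (Ordinal h)) //= gez0_abs ?modz_ge0 // modz_mod eqxx big1 // => i /eqP ne.
apply/eqP; rewrite eqb0; apply/eqP => e; apply: ne; apply: val_inj => /=.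
by rewrite e modz_nat /= modn_small.
Qed.

Lemma size_disc_rcount x : size (disc x) = (\sum_(i < k) \sum_(j < k) rcount k i%:Z j%:Z x)%N.
Proof.
under eq_bigr do under eq_bigr do rewrite /rcount -sum1_count big_mkcond.
under eq_bigr do rewrite exchange_big.
rewrite exchange_big /= -sum1_size; apply: eq_bigr => z _.
rewrite -[LHS](residue_sum z.1); apply: eq_bigr => i _.
case: (boolP (z.1 == i%:Z %[mod k])%Z) => h /=.
  rewrite -[LHS](residue_sum z.2); apply: eq_bigr => j _.
  by rewrite /rclass h /=; case: eqP.
by rewrite big1 // => j _; rewrite /rclass (negbTE h).
Qed.

Lemma dcount_mul_le n : (dcount (k * n) <= k * k * dcount (n + 2))%N.
Proof.
rewrite {1}/dcount size_disc_rcount.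
apply: (@leq_trans (\sum_(i < k) \sum_(j < k) dcount (n + 2))%N).
  by apply: leq_sum => i _; apply: leq_sum => j _; exact: rcount_le.
by rewrite !sum_nat_const !card_ord mulnA.
Qed.

Lemma dcount_mul_ge n : (k * k * dcount n <= dcount (k * (n + 2)))%N.
Proof.
rewrite {2}/dcount size_disc_rcount.
apply: (@leq_trans (\sum_(i < k) \sum_(j < k) dcount n)%N).
  by rewrite !sum_nat_const !card_ord mulnA.
by apply: leq_sum => i _; apply: leq_sum => j _; exact: rcount_ge.
Qed.

End ResidueCounts.

Lemma dcount_le n : (dcount n <= n.*2.+1 * n.*2.+1)%N.
Proof.
have sz : size (irange n) = n.*2.+1 by rewrite size_map size_iota.
rewrite -sz -(size_allpairs pair); apply: uniq_leq_size; first exact: disc_uniq.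
move=> [u v]; rewrite mem_disc leq_qf -[(u, v).1]/u -[(u, v).2]/v => h; apply/allpairsP; exists (u, v).
have hu := sqr_ge0 u; have hv := sqr_ge0 v.
rewrite -[(u, v).1]/u -[(u, v).2]/v !mem_irange; split => //; nia.
Qed.

Lemma dcount_ge1 n : (0 < dcount n)%N.
Proof. by rewrite /dcount -has_predT; apply/hasP; exists (0, 0); rewrite // mem_disc. Qed.

Lemma exists_isqrt x : exists s, (s * s <= x < s.+1 * s.+1)%N.
Proof.
elim: x => [|x [s h]]; first by exists 0%N.
by case: (ltnP x.+1 (s.+1 * s.+1)) => h'; [exists s | exists s.+1]; nia.
Qed.

Section Density.
Variable R : realType.

(** The density is not computed as an area. Scaling compares [s n] with [s (k * (n + 2))] and
    [s (k * m)] with [s (m + 2)]; linking two radii through a common multiple shows that [s] is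
    Cauchy with explicit errors. *)
Lemma dcount_asymp : exists2 a : R, 0 < a &
  forall n, (0 < n)%N -> `|(dcount n)%:R - a * n%:R ^+ 2| <= 216 * n%:R.
Proof.
pose s n : R := (dcount n)%:R / n%:R ^+ 2.
have s9 n : (0 < n)%N -> s n <= 9.
  move=> n0; rewrite ler_pdivrMr ?exprn_gt0 ?ltr0n // -natrX -natrM ler_nat.
  by apply: leq_trans (dcount_le n) _; nia.
have s0 n : 0 <= s n by rewrite divr_ge0 // exprn_ge0.
(* Passing from radius [n] to [n + 2] multiplies areas by at most [1 + 8 / n]; with the bound 9 on
   the density this costs [72 / n]. *)
have bump n (z : R) : (0 < n)%N -> 0 <= z <= 9 -> z * ((n + 2)%N%:R / n%:R) ^+ 2 <= z + 72 / n%:R.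
  move=> n0 /andP[z0 z9]; have p : 1 <= n%:R :> R by rewrite ler1n.
  have -> : (n + 2)%N%:R / n%:R = 1 + 2 / n%:R :> R by rewrite natrD; field; lra.
  have w0 : 0 < n%:R^-1 :> R by rewrite invr_gt0; lra.
  have w1 : n%:R^-1 <= 1 :> R by rewrite invf_le1; lra.
  move: (n%:R^-1) w0 w1 => w w0 w1.
  have -> : z * (1 + 2 * w) ^+ 2 = z + z * (4 * w + 4 * w ^+ 2) by ring.
  have h : 4 * w + 4 * w ^+ 2 <= 8 * w by nra.
  have : z * (4 * w + 4 * w ^+ 2) <= 9 * (8 * w) by apply: ler_pM => //; nra.
  lra.
have up n k : (0 < n)%N -> (0 < k)%N -> s n <= s (k * (n + 2))%N + 72 / n%:R.
  move=> n0 k0; have pn : 0 < n%:R :> R by rewrite ltr0n.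
  have pk : 0 < k%:R :> R by rewrite ltr0n.
  have kn : (0 < k * (n + 2))%N by lia.
  apply: le_trans (bump n _ n0 _); last by rewrite s0 s9.
  have -> : s (k * (n + 2))%N * ((n + 2)%N%:R / n%:R) ^+ 2 = (dcount (k * (n + 2)))%:R / (k%:R ^+ 2 * n%:R ^+ 2).
    by rewrite /s natrM; field; lra.
  rewrite /s ler_pdivrMr ?exprn_gt0 // mulrAC ler_pdivlMr ?mulr_gt0 ?exprn_gt0 //.
  rewrite mulrA ler_pM2r ?exprn_gt0 // mulrC -natrX -natrM ler_nat -mulnn.
  exact: dcount_mul_ge.
have dn m k : (0 < m)%N -> (0 < k)%N -> s (k * m)%N <= s (m + 2)%N + 72 / m%:R.
  move=> n0 k0; have pn : 0 < m%:R :> R by rewrite ltr0n.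
  have pk : 0 < k%:R :> R by rewrite ltr0n.
  have kn : (0 < m + 2)%N by lia.
  apply: le_trans (bump m _ n0 _); last by rewrite s0 s9.
  have -> : s (m + 2)%N * ((m + 2)%N%:R / m%:R) ^+ 2 = (dcount (m + 2))%:R / m%:R ^+ 2.
    by rewrite /s; field; lra.
  rewrite /s natrM ler_pdivrMr ?exprn_gt0 ?mulr_gt0 //.
  have -> : (dcount (m + 2))%:R / m%:R ^+ 2 * (k%:R * m%:R) ^+ 2 = k%:R * k%:R * (dcount (m + 2))%:R :> R by field; lra.
  by rewrite -!natrM ler_nat; exact: dcount_mul_le.
have main n m : (0 < n)%N -> (0 < m)%N -> s n <= s m + 216 / n%:R + 216 / m%:R.
  move=> n0 m0; have pn : 0 < n%:R :> R by rewrite ltr0n.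
  have pm : 0 < m%:R :> R by rewrite ltr0n.
  have in0 : 0 < n%:R^-1 :> R by rewrite invr_gt0.
  have im0 : 0 < m%:R^-1 :> R by rewrite invr_gt0.
  case: (leqP m 2) => [m2|m2].
    have : 2^-1 <= m%:R^-1 :> R by rewrite lef_pV2 ?posrE // ler_nat.
    have := s9 n n0; have := s0 m; lra.
  (* The common radius is [l * (n + 2)]. Since [m >= 3] here, [m <= 3 * l], which turns 72 into
     216. *)
  pose l := (m - 2)%N; have l0 : (0 < l)%N by rewrite /l; lia.
  have pl : 0 < l%:R :> R by rewrite ltr0n.
  have h1 := up n l n0 l0; have h2 := dn l (n + 2)%N l0 (ltac:(lia)).
  have e : (l + 2 = m)%N by rewrite /l; lia.
  rewrite mulnC e in h2.
  have : 72 / l%:R <= 216 / m%:R :> R.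
    rewrite ler_pdivrMr // mulrAC ler_pdivlMr // -!natrM ler_nat /l; lia.
  lra.
have [|a Ha] := @limit_of_mutual_error R s (fun n => 216 / n%:R).
  by move=> m n m0 n0; rewrite ler_norml; have := main m n m0 n0; have := main n m n0 m0 => h1 h2; apply/andP; split; lra.
have Ha' n : (0 < n)%N -> `|(dcount n)%:R - a * n%:R ^+ 2| <= 216 * n%:R.
  move=> n0; have pn : 0 < n%:R :> R by rewrite ltr0n.
  have -> : (dcount n)%:R - a * n%:R ^+ 2 = (s n - a) * n%:R ^+ 2 by rewrite /s; field; lra.
  rewrite normrM [`|n%:R ^+ 2|]ger0_norm ?exprn_ge0 //.
  apply: le_trans (ler_wpM2r (exprn_ge0 2 (ltW pn)) (Ha n n0)) _.
  by rewrite le_eqVlt; apply/orP; left; apply/eqP; field; lra.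
exists a => //.
(* Positivity of [a]: at radius 3000 the error is 0.072, less than the lower bound 1/9 that results
   from scaling radius 1 by 1000. *)
have := Ha (1000 * 3)%N isT; rewrite ler_norml => /andP[h1 h2].
have : 9^-1 <= s (1000 * 3)%N.
  have h := @dcount_mul_ge 1000 isT 1; have h3 := dcount_ge1 1.
  rewrite /s ler_pdivlMr; last by apply: exprn_gt0; rewrite ltr0n.
  have -> : 9^-1 * (1000 * 3)%N%:R ^+ 2 = (1000 * 1000)%N%:R :> R by rewrite !natrM; field.
  by rewrite ler_nat; apply: leq_trans h; rewrite leq_pmulr.
have e : 216 / (1000 * 3)%N%:R = 72 / 1000 :> R by rewrite natrM; field.
rewrite e in h1 h2; lra.
Qed.

(** [x] lies between the squares of [k * m] and [k * m.+1], where residue counts are comparable with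
    [dcount] near [m]. The resulting density is the same for all residues. *)
Lemma rcount_asymp k : (0 < k)%N -> exists a C : R, [/\ 0 < a, 0 <= C &
  forall i j x, (0 < x)%N -> `|(rcount k i j x)%:R - a * x%:R| <= C * rt R x].
Proof.
move=> k0; have [a a0 Ha] := dcount_asymp.
have pk : 0 < k%:R :> R by rewrite ltr0n.
exists (a / k%:R ^+ 2), (15 * a + 864); split; [by rewrite divr_gt0 ?exprn_gt0 | lra | ].
move=> i j x x0; have [s /andP[s1 s2]] := exists_isqrt x.
pose m := (s %/ k)%N.
have ms : (k * m <= s)%N by rewrite mulnC leq_divM.
have sm : (s < k * m.+1)%N by rewrite mulnC ltn_ceil.
have kmx : (k * m * (k * m) <= x)%N := leq_trans (leq_mul ms ms) s1.
have xkm : (x <= k * m.+1 * (k * m.+1))%N := ltnW (leq_trans s2 (leq_mul sm sm)).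
have mono y z : (y <= z)%N -> (rcount k i j y <= rcount k i j z)%N.
  move=> yz; rewrite /rcount -!size_filter; apply: uniq_leq_size; first by rewrite filter_uniq // disc_uniq.
  by move=> w; rewrite mem_filter mem_disc => /andP[c h]; rewrite mem_filter mem_disc c; exact: leq_trans h yz.
have r1 := rt_ge1 R x0; have rx := rt_sqr R x.
have mr : m%:R <= rt R x.
  rewrite -(@ler_pXn2r _ 2) ?nnegrE ?rt_ge0 // rx -natrX ler_nat -mulnn.
  by apply: leq_trans s1; apply: leq_mul; apply: leq_trans ms; rewrite leq_pmull.
have lo : m%:R ^+ 2 <= x%:R / k%:R ^+ 2 :> R.
  by rewrite ler_pdivlMr ?exprn_gt0 // -!natrX -natrM ler_nat -expnMn mulnC -mulnn.
have hi : x%:R / k%:R ^+ 2 <= (m%:R + 1) ^+ 2 :> R.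
  by rewrite ler_pdivrMr ?exprn_gt0 // natr1 -!natrX -natrM ler_nat -expnMn mulnC -mulnn.
have -> : a / k%:R ^+ 2 * x%:R = a * (x%:R / k%:R ^+ 2) by ring.
move: (x%:R / k%:R ^+ 2) lo hi => t lo hi.
have m0 : 0 <= m%:R :> R by [].
have up : (rcount k i j x)%:R <= a * (m%:R + 3) ^+ 2 + 216 * (m%:R + 3) :> R.
  have h : (rcount k i j x <= dcount (m + 3))%N.
    apply: leq_trans (_ : rcount k i j ((k * m.+1) * (k * m.+1)) <= _)%N; first exact: mono.
    by have := rcount_le k0 i j m.+1; rewrite addn2 addn3.
  have := Ha (m + 3)%N (ltn_addl m (isT : 0 < 3)%N); rewrite ler_norml natrD => /andP[_ h2].
  have : (rcount k i j x)%:R <= (dcount (m + 3))%:R :> R by rewrite ler_nat.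
  lra.
have a_lo := ler_wpM2l (ltW a0) lo; have a_hi := ler_wpM2l (ltW a0) hi.
have C1 : a * rt R x >= a by rewrite ler_peMr // ltW.
have C2 : a * m%:R <= a * rt R x by rewrite ler_pM2l.
rewrite ler_norml; apply/andP; split.
  case: (leqP 2 m) => m2; last first.
    have mm : m%:R <= 1 :> R by rewrite (ler_nat R m 1) -ltnS.
    have : a * (m%:R + 1) ^+ 2 <= a * 4 by rewrite ler_pM2l //; nra.
    have : 0 <= (rcount k i j x)%:R :> R by [].
    lra.
  have h : (dcount (m - 2) <= rcount k i j x)%N.
    apply: leq_trans (mono _ _ kmx).
    by have := rcount_ge k0 i j (m - 2); rewrite subnK.
  have h3 : a * (m%:R - 2) ^+ 2 - 216 * (m%:R - 2) <= (dcount (m - 2))%:R.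
    case: (posnP (m - 2)%N) => [e|p].
      have -> : m = 2%N by apply/eqP; rewrite eqn_leq m2 -subn_eq0 e.
      by rewrite subrr expr0n /= !mulr0 subrr.
    by have := Ha _ p; rewrite natrB // ler_norml => /andP[]; lra.
  have : (dcount (m - 2))%:R <= (rcount k i j x)%:R :> R by rewrite ler_nat.
  have : a * (m%:R + 1) ^+ 2 = a * m%:R ^+ 2 + 2 * (a * m%:R) + a by ring.
  have : a * (m%:R - 2) ^+ 2 = a * m%:R ^+ 2 - 4 * (a * m%:R) + 4 * a by ring.
  lra.
have : a * (m%:R + 3) ^+ 2 = a * m%:R ^+ 2 + 6 * (a * m%:R) + 9 * a by ring.
lra.
Qed.

End Density.

(** * The monoid of primary elements of Z[sqrt(-3)] *)

(** The pair [(u, v)] stands for u + v sqrt(-3). Only the additive structure is copied from the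
    product; the alias carries a multiplication that is not componentwise. *)
Definition qint := (int * int)%type.
HB.instance Definition _ := GRing.Zmodule.copy qint (int * int)%type.

Definition qmul (x y : qint) : qint := (x.1 * y.1 - 3 * (x.2 * y.2), x.1 * y.2 + x.2 * y.1).
Definition qone : qint := (1, 0).

Lemma qmulA : associative qmul.
Proof. by move=> x y z; congr pair; rewrite /=; ring. Qed.
Lemma qmulC : commutative qmul.
Proof. by move=> x y; congr pair; rewrite /=; ring. Qed.
Lemma qmul1 : left_id qone qmul.
Proof. by case=> a b; congr pair; rewrite /=; ring. Qed.
Lemma qmulDl : left_distributive qmul +%R.
Proof. by move=> x y z; congr pair; rewrite /=; ring. Qed.
Lemma qone_neq0 : qone != 0. Proof. by []. Qed.

HB.instance Definition _ :=
  GRing.Zmodule_isComNzRing.Build qint qmulA qmulC qmul1 qmulDl qone_neq0.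

Section QuadraticIntegers.
Implicit Types x y z a b c r : qint.

Definition qc (n : int) : qint := (n, 0).
Definition qconj z : qint := (z.1, - z.2).

Lemma qcM m n : qc (m * n) = qc m * qc n.
Proof. by congr pair; rewrite /=; ring. Qed.
Lemma qcD m n : qc (m + n) = qc m + qc n.
Proof. by congr pair; rewrite /=; ring. Qed.
Lemma qc1 : qc 1 = 1. Proof. by []. Qed.

Lemma qfM x y : qf (x * y) = (qf x * qf y)%N.
Proof. by apply/eqP; rewrite -eqz_nat PoszM !qfE /=; apply/eqP; ring. Qed.

Lemma qf_conj z : qf (qconj z) = qf z.
Proof. by rewrite /qf /= sqrrN. Qed.

Lemma qf_qc (n : int) : qf (qc n) = (`|n| * `|n|)%N.
Proof. by apply/eqP; rewrite -eqz_nat PoszM !qfE /=; apply/eqP; lia. Qed.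

Lemma mul_qconj z : z * qconj z = qc (qf z)%:Z.
Proof. by rewrite qfE; congr pair; rewrite /=; ring. Qed.

Lemma qconjM x y : qconj (x * y) = qconj x * qconj y.
Proof. by congr pair; rewrite /=; ring. Qed.

Lemma qf_eq0 z : qf z = 0%N -> z = 0.
Proof.
case: z => u v h; have := qfE (u, v); rewrite h /= => e.
by congr pair; nia.
Qed.

Lemma nearest (n x : int) : 0 < n -> exists q, - n <= 2 * (x - q * n) <= n.
Proof.
move=> n0; exists ((2 * x + n) %/ (2 * n))%Z.
have := divz_eq (2 * x + n) (2 * n); have := modz_ge0 (2 * x + n) (ltac:(lia) : 2 * n != 0).
have := ltz_pmod (2 * x + n) (ltac:(lia) : 0 < 2 * n).
by move: (_ %/ _)%Z (_ %% _)%Z => q t; lia.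
Qed.

(** Rounding both coordinates of [a * qconj b] divided by [n] leaves errors of at most 1/2, so the
    norm of the remainder is at most 1/4 + 3/4 times that of [b]. Equality would need errors of
    exactly 1/2, which an odd [n] excludes. *)
Lemma qdiv a b : odd (qf b) -> exists q r, a = q * b + r /\ (qf r < qf b)%N.
Proof.
move=> ob; set n := (qf b)%:Z.
have n0 : 0 < n by rewrite /n; lia.
have [q1 h1] := nearest (a * qconj b).1 n0.
have [q2 h2] := nearest (a * qconj b).2 n0.
pose q : qint := (q1, q2); exists q, (a - q * b); split; first by rewrite addrC subrK.
have e : (a - q * b) * qconj b = a * qconj b - q * qc n.
  by rewrite mulrBl -mulrA mul_qconj.
suff : (qf (a - q * b)%R * qf b < qf b * qf b)%N by rewrite ltn_pmul2r //; lia.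
rewrite -[X in (_ * X < _)%N]qf_conj -qfM e -ltz_nat PoszM qfE -/n.
have -> : (a * qconj b - q * qc n).1 = (a * qconj b).1 - q1 * n by rewrite /=; ring.
have -> : (a * qconj b - q * qc n).2 = (a * qconj b).2 - q2 * n by rewrite /=; ring.
move: h1 h2; set X := _ - _; set Y := _ - _ => h1 h2.
have on : n = 2 * (qf b)./2%:Z + 1 by rewrite /n; have := odd_double_half (qf b); rewrite ob; lia.
have h1' : - n < 2 * X < n by lia.
have h2' : - n < 2 * Y < n by lia.
nia.
Qed.

Lemma mod4_cases (u : int) : exists k i : int,
  u = 4 * k + i /\ [\/ i = 0, i = 1, i = 2 | i = 3].
Proof.
exists (u %/ 4)%Z, (u %% 4)%Z; split; first by rewrite mulrC -divz_eq.
have := modz_ge0 u (isT : (4 : int) != 0); have := ltz_pmod u (isT : 0 < (4 : int)).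
move: (u %% 4)%Z => i h1 h2.
have : i = 0 \/ i = 1 \/ i = 2 \/ i = 3 by lia.
by case=> [|[|[|]]] ->; [constructor 1|constructor 2|constructor 3|constructor 4].
Qed.

Section EvenReduction.
(** An ideal from which factors 2 can be cancelled, as is the trace of an ideal of Z[sqrt(-3), 1/2].
    Inverting 2 repairs the failure of unique factorization. *)
Variable J : qint -> Prop.
Hypothesis JM : forall z w, J w -> J (z * w).
Hypothesis JB : forall z w, J z -> J w -> J (z - w).
Hypothesis J2 : forall z, J (qc 2 * z) -> J z.

(* If [u^2 + 3 v^2] is even then [r], or its product with a suitable [1 +- sqrt(-3)] (of norm 4), is divisible by [2], resp. [4]; this divides the norm by 4. *)
Lemma odd_reduction r : J r -> r <> 0 -> exists r', [/\ J r', odd (qf r') & (qf r' <= qf r)%N].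
Proof.
have [n] := ubnP (qf r); elim: n r => // n IH r rn Jr r0.
case: (boolP (odd (qf r))) => o; first by exists r.
have step r1 : J r1 -> (qf r1 * 4 = qf r)%N -> exists r', [/\ J r', odd (qf r') & (qf r' <= qf r)%N].
  move=> J1 e; have p : (0 < qf r)%N by rewrite lt0n; apply/eqP => /qf_eq0.
  have r10 : r1 <> 0 by move=> h; move: e p; rewrite h => <-.
  have [|r' [Jr' o' l]] := IH r1 _ J1 r10; first by lia.
  by exists r'; split => //; lia.
have J4 z : J (qc 4 * z) -> J z.
  by rewrite -[qc 4]/(qc (2 * 2)) qcM -mulrA => /J2/J2.
have half (w : qint) : r = qc 2 * w -> exists r', [/\ J r', odd (qf r') & (qf r' <= qf r)%N].
  move=> e; apply: (step w); first by apply: J2; rewrite -e.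
  by rewrite e qfM qf_qc mulnC.
have quarter (t w : qint) : qf t = 4%N -> t * r = qc 4 * w ->
    exists r', [/\ J r', odd (qf r') & (qf r' <= qf r)%N].
  move=> t4 e; apply: (step w); first by apply: J4; rewrite -e; exact: JM.
  by have := congr1 qf e; rewrite !qfM qf_qc t4 -[(`|4| * `|4|)%N]/(4 * 4)%N; lia.
have := qfE r; case: r Jr r0 rn o step half quarter => u v Jr _ _ o _ half quarter /=.
have [m [i [eu ci]]] := mod4_cases u; have [n1 [j [ev cj]]] := mod4_cases v.
have -> : u ^+ 2 + 3 * v ^+ 2 =
   2 * (8 * m ^+ 2 + 4 * m * i + 24 * n1 ^+ 2 + 12 * n1 * j) + (i ^+ 2 + 3 * j ^+ 2).
  by rewrite eu ev; ring.
move: (_ + 12 * n1 * j) => K eK.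
move: eK half quarter; case: ci => ei; case: cj => ej; rewrite eu ev ei ej => eK half quarter;
  try (by exfalso; move: o eK; rewrite eu ev ei ej; move: (qf _) => q; lia).
(* In the surviving cases [i] and [j] have equal parity. If both are even, 2 is divided out; if both
   are odd, the multiplier is 1 - sqrt(-3) for [i = j] and 1 + sqrt(-3) for [i + j = 4]. *)
- apply: (half (2 * m, 2 * n1)); congr pair; rewrite /=; ring.
- apply: (half (2 * m, 2 * n1 + 1)); congr pair; rewrite /=; ring.
- apply: (quarter (1, -1) (m + 3 * n1 + 1, n1 - m)) => //; congr pair; rewrite /=; ring.
- apply: (quarter (1, 1) (m - 3 * n1 - 2, m + n1 + 1)) => //; congr pair; rewrite /=; ring.
- apply: (half (2 * m + 1, 2 * n1)); congr pair; rewrite /=; ring.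
- apply: (half (2 * m + 1, 2 * n1 + 1)); congr pair; rewrite /=; ring.
- apply: (quarter (1, 1) (m - 3 * n1, m + n1 + 1)) => //; congr pair; rewrite /=; ring.
- apply: (quarter (1, -1) (m + 3 * n1 + 3, n1 - m)) => //; congr pair; rewrite /=; ring.
Qed.

(** An element of minimal odd norm generates. A nonzero remainder may have even norm, but
    [odd_reduction] replaces it by an element of odd norm that is no larger, against minimality. *)
Lemma J_principal p : J p -> odd (qf p) ->
  exists g, [/\ J g, odd (qf g) & forall z, J z -> exists q, z = q * g].
Proof.
move=> Jp op.
have ex : exists n, `[< exists g, [/\ J g, odd (qf g) & qf g = n] >].
  by exists (qf p); apply/asboolP; exists p.
case: (ex_minnP ex) => n /asboolP[g [Jg og gn]] min; exists g; split => // z Jz.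
have [q [r [e rg]]] := qdiv z og; exists q; rewrite e.
case: (pselect (r = 0)) => [->|r0]; first by rewrite addr0.
have Jr : J r.
  have -> : r = z - q * g by rewrite e addrAC subrr add0r.
  by apply: JB => //; exact: JM.
have [r' [Jr' or' lr']] := odd_reduction Jr r0.
have := min (qf r'); rewrite -gn => /(_ _); move=> h; exfalso.
have : (qf g <= qf r')%N by apply: h; apply/asboolP; exists r'.
lia.
Qed.

End EvenReduction.

(** * Unique factorization of primary elements *)

Section Monoid.
Variable M : nat.
Hypothesis M6 : (6 %| M)%N.

(** As 3 divides [M], the first coordinate is prime to 3, so exactly one of [z] and [- z] satisfies
    the congruence; this removes the unit -1. First coordinates multiply modulo 3, so the condition
    is multiplicative. *)
Definition tok z := coprime (qf z) M && (z.1 == 1 %[mod 3])%Z.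
Definition tcar := {z : qint | tok z}.
Definition tmk z (h : tok z) : tcar := exist _ z h.

Lemma mod3P (u : int) : reflect (exists k, u = 3 * k + 1) (u == 1 %[mod 3])%Z.
Proof.
rewrite eqz_mod_dvd; apply: (iffP dvdzP) => -[k e]; exists k; first by rewrite mulrC -e subrK.
by rewrite e addrK mulrC.
Qed.

Lemma tokM x y : tok x -> tok (x * y) = tok y.
Proof.
clear M6; move=> /andP[cx /mod3P[k ek]]; rewrite /tok qfM coprimeMl cx /=; congr (_ && _).
by apply/mod3P/mod3P => -[l]; rewrite ek => e; [exists (l - k * y.1 + x.2 * y.2) | exists (k * y.1 + l - x.2 * y.2)]; lia.
Qed.

Lemma tok_odd z : coprime (qf z) M -> odd (qf z).
Proof. by move=> c; rewrite -coprimen2; apply: coprime_dvdr c; apply: dvdn_trans M6. Qed.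

Lemma tok_sign z : coprime (qf z) M -> tok z \/ tok (- z).
Proof.
move=> c; have c3 : coprime (qf z) 3 by apply: coprime_dvdr c; apply: dvdn_trans M6.
have qN : qf (- z) = qf z by rewrite /qf /= !sqrrN.
rewrite /tok qN c /=.
have h : ~~ (3 %| z.1)%Z.
  apply/negP => /dvdzP[k e]; move: c3; rewrite coprime_sym prime_coprime // => /negP[].
  have := qfE z; rewrite e => h.
  by apply/dvdnP; exists (absz (3 * k ^+ 2 + z.2 ^+ 2)); apply/eqP; rewrite -eqz_nat h PoszM gez0_abs; lia.
have [k [i [e ci]]] : exists k i : int, z.1 = 3 * k + i /\ (i = 0 \/ i = 1 \/ i = 2).
  exists (z.1 %/ 3)%Z, (z.1 %% 3)%Z; split; first by rewrite mulrC -divz_eq.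
  have := modz_ge0 z.1 (isT : (3 : int) != 0); have := ltz_pmod z.1 (isT : 0 < (3 : int)); lia.
case: ci => [i0|[i1|i2]].
- by case/negP: h; rewrite e i0 addr0 dvdz_mulr.
- by left; apply/mod3P; exists k; rewrite e i1.
- by right; apply/mod3P; exists (- k - 1); rewrite /= e i2; lia.
Qed.

Implicit Types p q : tcar.

Lemma tmul_subproof p q : tok (val p * val q).
Proof. by rewrite tokM (valP p, valP q). Qed.
Definition tmul p q : tcar := tmk (tmul_subproof p q).
Lemma tone_subproof : tok 1. Proof. by rewrite /tok coprime1n. Qed.
Definition tone : tcar := tmk tone_subproof.

Lemma tmulA : associative tmul. Proof. by move=> p q r; apply: val_inj; rewrite /= mulrA. Qed.
Lemma tmulC : commutative tmul. Proof. by move=> p q; apply: val_inj; rewrite /= mulrC. Qed.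
Lemma tmul1 : left_id tone tmul. Proof. by move=> p; apply: val_inj; rewrite /= mul1r. Qed.
Lemma tqf_gt0 p : (0 < qf (val p))%N.
Proof. by case/andP: (valP p) => /tok_odd; case: (qf _). Qed.

Lemma qmulI z : (0 < qf z)%N -> injective (fun w => z * w).
Proof.
move=> z0 x y e; apply/eqP; rewrite -subr_eq0; apply/eqP/qf_eq0.
have : qf (z * (x - y)) = 0%N by rewrite mulrBr e subrr.
by move/eqP; rewrite qfM muln_eq0 -leqn0 leqNgt z0 => /eqP.
Qed.

Lemma tmulI : right_injective tmul.
Proof. by move=> p q r /(congr1 val)/(qmulI (tqf_gt0 p)); exact: val_inj. Qed.

Lemma tqfM p q : qf (val (tmul p q)) = (qf (val p) * qf (val q))%N.
Proof. exact: qfM. Qed.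

Lemma tqf_eq1 p : qf (val p) = 1%N -> p = tone.
Proof.
case: p => -[u v] /= h e; apply: val_inj => /=.
have := qfE (u, v); rewrite e /= => h1.
have v0 : v = 0 by nia.
case/andP: h => _ /mod3P[k /= ek]; have /eqP : u ^+ 2 = 1 by move: h1; rewrite v0 expr0n mulr0 addr0 => <-.
rewrite sqrf_eq1 v0 => /orP[/eqP -> //|/eqP]; lia.
Qed.

Definition tel n : seq tcar := pmap insub [seq z <- disc n | qf z == n].

Lemma tel_uniq n : uniq (tel n).
Proof. by rewrite pmap_sub_uniq // (filter_uniq _ (disc_uniq _)). Qed.

Lemma mem_tel n p : (p \in tel n) = (qf (val p) == n).
Proof. by rewrite mem_pmap_sub mem_filter mem_disc; case: eqP => // ->; rewrite leqnn. Qed.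

(** The factors [al] and [be] range over the whole ring, since rational integers and elements x +
    sqrt(-3), which need not be primary, occur later. The ideal of [p] and [al], with 2 inverted,
    has a generator [g] dividing [p], and irreducibility makes [g] a unit or an associate of [p]. In
    the second case [p] divides [al]; in the first, a Bezout relation shows that it divides [be]. *)
Lemma t_euclid_gen p (al be ka : qint) : irreducible_in tmul tone p ->
  al * be = val p * ka ->
  (exists w, al = val p * w) \/ (exists w, be = val p * w).
Proof.
move=> [p1 ip] E.
pose J z := exists k x y, qc (2 ^+ k) * z = x * val p + y * al.
have JM z w : J w -> J (z * w).
  move=> [k [x [y e]]]; exists k, (z * x), (z * y).
  by rewrite mulrCA e; ring.
have JB z w : J z -> J w -> J (z - w).
  move=> [k [x [y e]]] [l [x' [y' e']]].
  exists (k + l)%N, (qc (2 ^+ l) * x - qc (2 ^+ k) * x'), (qc (2 ^+ l) * y - qc (2 ^+ k) * y').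
  rewrite exprD qcM.
  have -> : qc (2 ^+ k) * qc (2 ^+ l) * (z - w) = qc (2 ^+ l) * (qc (2 ^+ k) * z) - qc (2 ^+ k) * (qc (2 ^+ l) * w) by ring.
  by rewrite e e'; ring.
have J2 z : J (qc 2 * z) -> J z.
  by move=> [k [x [y e]]]; exists k.+1, x, y; rewrite exprSr qcM -mulrA e.
have Jp : J (val p) by exists 0%N, 1, 0; rewrite expr0 qc1; ring.
have Ja : J al by exists 0%N, 0, 1; rewrite expr0 qc1; ring.
have cp : coprime (qf (val p)) M by case/andP: (valP p).
have op := tok_odd cp.
have [g [Jg og Hg]] := J_principal JM JB J2 Jp op.
have [q eq] := Hg _ Jp; have [w ew] := Hg _ Ja.
have key (g' q' : qint) : tok g' -> val p = g' * q' -> g' = 1 \/ q' = 1.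
  move=> tg e; have tq : tok q' by rewrite -(tokM q' tg) -e (valP p).
  have [h|h] : tmk tg = tone \/ tmk tq = tone by apply: ip; apply: val_inj.
  - by left; exact: (congr1 val h).
  - by right; exact: (congr1 val h).
have cg : coprime (qf g) M by move: cp; rewrite eq qfM coprimeMl => /andP[].
have [eps [e1 [h|h]]] : exists eps : qint, eps * eps = 1 /\ (eps * g = 1 \/ val p = eps * g).
  case: (tok_sign cg) => tg.
    exists 1; split; first by ring.
    have [h|h] := key g q tg (etrans eq (mulrC _ _)); first by left; rewrite h mul1r.
    by right; rewrite eq h mulrC.
  exists (-1); split; first by ring.
  have [|h|h] := key (- g) (- q) tg; first by rewrite eq; ring.
    by left; rewrite mulN1r.
  by right; rewrite eq -[q]opprK h.
  have [k [x [y e]]] := Jg; right.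
  (* Membership in [J] makes only a power of 2 a combination of [p] and [al]. The norm of [p] is odd
     and a multiple of [p], so a Bezout relation between integers completes this to 1. *)
  have e2 : qc (2 ^+ k) = eps * x * val p + eps * y * al.
    have -> : qc (2 ^+ k) = eps * (qc (2 ^+ k) * g) by rewrite mulrCA h mulr1.
    by rewrite e; ring.
  have cop : coprimez (2 ^+ k) (qf (val p))%:Z.
    by rewrite coprimezE abszX coprimeXl // coprime2n.
  have /coprimezP[[s t] /= est] := cop.
  exists (qc s * (eps * x * be + eps * y * ka) + qc t * qconj (val p) * be).
  transitivity ((qc s * qc (2 ^+ k) + qc t * qc (qf (val p))%:Z) * be).
    by rewrite -!qcM -qcD est qc1 mul1r.
  rewrite e2 -mul_qconj.
  have -> : (qc s * (eps * x * val p + eps * y * al) + qc t * (val p * qconj (val p))) * be =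
    qc s * eps * x * val p * be + qc s * eps * y * (al * be) + qc t * (val p * qconj (val p)) * be by ring.
  by rewrite E -[sval p]/(val p); ring.
left; exists (eps * w); rewrite h ew.
have -> : eps * g * (eps * w) = eps * eps * (w * g) by ring.
by rewrite e1 mul1r.
Qed.

Lemma t_dvd p q (w : qint) : val q = val p * w -> exists d, q = tmul p d.
Proof.
move=> e; have tw : tok w by rewrite -(tokM w (valP p)) -e (valP q).
by exists (tmk tw); apply: val_inj.
Qed.

Lemma t_euclid p q (r c : tcar) : irreducible_in tmul tone p -> tmul q r = tmul p c ->
  (exists d, q = tmul p d) \/ (exists d, r = tmul p d).
Proof.
move=> ip /(congr1 val) /= e.
by have [[w /t_dvd]|[w /t_dvd]] := t_euclid_gen ip e; [left|right].
Qed.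

Definition TQ : normUFD := @NormUFD tcar tmul tone (fun p => qf (val p)) tel tmulA tmulC tmul1 tmulI
  tqfM tqf_gt0 tqf_eq1 tel_uniq mem_tel t_euclid.

Lemma tconj_subproof p : tok (qconj (val p)).
Proof. by rewrite /tok qf_conj; exact: (valP p). Qed.
Definition tconj p : tcar := tmk (tconj_subproof p).

Lemma tconjK : involutive tconj.
Proof. by case=> -[u v] h; apply: val_inj; rewrite /= /qconj /= opprK. Qed.

Lemma tconjM p q : tconj (tmul p q) = tmul (tconj p) (tconj q).
Proof. by apply: val_inj; rewrite /= qconjM. Qed.

Lemma tok_qc (n : nat) : coprime n M -> (n == 1 %[mod 3])%N -> tok (qc n%:Z).
Proof.
move=> c h; rewrite /tok qf_qc /= coprimeMl c /=; apply/mod3P; exists (n %/ 3)%N%:Z.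
by have := divn_eq n 3; rewrite (eqP h); lia.
Qed.

Lemma qf_mod3 z : tok z -> (qf z == 1 %[mod 3])%N.
Proof.
case/andP=> _ /mod3P[k e]; have := qfE z; rewrite e => h.
have : (qf z)%:Z = 3 * (3 * k ^+ 2 + 2 * k + z.2 ^+ 2) + 1 by rewrite h; ring.
by move: (_ + z.2 ^+ 2) (qf z) => K q; lia.
Qed.

Lemma t_dvd_prime (p : TQ) (n : nat) (w : qint) : uirr p -> (0 < n)%N -> qc n%:Z = val p * w ->
  exists q : nat, [/\ prime q, (q %| n)%N & exists w', qc q%:Z = val p * w'].
Proof.
move=> /asboolP ip; have [m] := ubnP n; elim: m n w => // m IH n w nm n0 e.
case: (ltngtP n 1) => [|n1|n1]; first by lia.
  have pd := pdiv_prime n1; have /dvdnP[l el] := pdiv_dvd n.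
  have : qc l%:Z * qc (pdiv n)%:Z = val p * w by rewrite -e -qcM -PoszM -el.
  move/(t_euclid_gen ip) => [[w' e']|[w' e']]; last first.
    by exists (pdiv n); split => //; [exact: pdiv_dvd | exists w'].
  have p1 := prime_gt1 pd; have l0 : (0 < l)%N by rewrite lt0n; apply/eqP => l0; rewrite el l0 in n0.
  have [|q [pq ql ex]] := IH l w' _ l0 e'; last by exists q; split => //; rewrite el dvdn_mulr.
  apply: (@leq_trans n); last by [].
  by rewrite [X in (_ < X)%N]el ltn_Pmulr.
have := congr1 qf e; rewrite n1 qfM /= => /esym/eqP; rewrite muln_eq1 => /andP[/eqP/tqf_eq1 h _].
by case: ip.
Qed.

(** An irreducible divides its own norm, hence some rational prime [q]; taking norms, its norm
    divides [q ^ 2]. *)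
Lemma t_uirr_nm (p : TQ) : uirr p -> exists (q j : nat), prime q /\ nm p = (q ^ j.+1)%N.
Proof.
move=> ip; have p0 := nm_gt0 p.
have e : qc (nm p)%:Z = val p * qconj (val p) by rewrite mul_qconj.
have [q [pq _ [w /(congr1 qf)]]] := t_dvd_prime ip p0 e.
rewrite qf_qc qfM mulnn /= => h.
have /(dvdn_pfactor _ _ pq)[j _ ej] : (nm p %| q ^ 2)%N by rewrite h dvdn_mulr.
case: j ej => [|j] ej; last by exists q, j.
by have := nm_gt1 (uirr_neq1 ip); rewrite ej.
Qed.

Variable R : realType.

Lemma t_Lam_ppower (p : TQ) : Lam R p != 0 -> ppower (nm p).
Proof.
move=> /Lam_neq0 [q [k [qq ->]]]; have [l [j [pl e]]] := t_uirr_nm qq.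
rewrite nm_upow e -expnM; apply/asboolP; exists l, (j.+1 * k.+1).-1; split => //.
Qed.

(** An element times its conjugate is its norm, so all elements of norm [n] divide the integer [n].
    If there are any, [n] is primary, of norm [n ^ 2], and [Lam] summed over its divisors gives
    [2 * ln n]. *)
Lemma t_sum_Lam_el n : \sum_(p <- el TQ n) Lam R p <= 2 * ln n%:R.
Proof.
case E: (el TQ n) => [|p0 s]; first by rewrite big_nil mulr_ge0 ?lnn_ge0.
have np0 : nm p0 = n by apply/eqP; rewrite -mem_el E mem_head.
have tn : tok (qc n%:Z).
  have := valP p0; rewrite -np0 => tp0; apply: tok_qc; first by case/andP: tp0.
  exact: qf_mod3.
rewrite -E; apply: (@le_trans _ _ (\sum_(p <- divs (tmk tn : TQ)) Lam R p)).
  apply: sum_subset_le; [exact: el_uniq | | by move=> p; exact: Lam_ge0].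
  move=> p; rewrite mem_el => /eqP np; rewrite mem_divs; apply/udvdP; exists (tconj p).
  by apply: val_inj; rewrite /= mul_qconj -np.
rewrite sum_divs_Lam; have -> : nm (tmk tn : TQ) = (n ^ 2)%N by rewrite /= qf_qc mulnn.
have n0 : (0 < n)%N by rewrite -np0 nm_gt0.
by rewrite natrX lnXn ?ltr0n // mulr2n; lra.
Qed.

(** If [p] were irreducible, it would divide x + sqrt(-3) or x - sqrt(-3), whose product is a
    multiple of [p], although their second coordinates are 1 and -1. So [p], of norm [p ^ 2], has
    two nontrivial factors, and each has norm [p]. *)
Lemma t_split (p x : nat) : prime p -> coprime p M -> (p == 1 %[mod 3])%N -> (p %| x ^ 2 + 3)%N ->
  exists a : TQ, nm a = p.
Proof.
move=> pp cp p3 /dvdnP[l el].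
pose tp : TQ := tmk (tok_qc cp p3).
have ntp : nm tp = (p * p)%N by rewrite /= qf_qc.
have p1 := prime_gt1 pp.
have vtp : val tp = qc p%:Z by [].
have nirr : ~ uirr tp.
  move=> /asboolP ip.
  have : ((x%:Z, 1) : qint) * ((x%:Z, -1) : qint) = val tp * qc l%:Z.
    rewrite -[val tp]/(qc p%:Z); congr pair; rewrite /=; last by ring.
    have : (x ^ 2 + 3)%N%:Z = (l * p)%N%:Z by rewrite el.
    rewrite PoszD -mulnn !PoszM => h; rewrite mul0r mulr0 subr0 [_ * l%:Z]mulrC -h; ring.
  by move/(t_euclid_gen ip) => [[w]|[w]]; rewrite vtp => /(congr1 snd) /=; nia.
have tp1 : tp <> u1 TQ by move=> h; have := congr1 (@nm TQ) h; rewrite ntp nm1; nia.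
have [a [b [e a1 b1]]] : exists a b : TQ, [/\ tp = um a b, a <> u1 TQ & b <> u1 TQ].
  apply: contrapT => H; apply: nirr; apply/asboolP; split => // a b e.
  apply: contrapT => /not_orP[a1 b1]; apply: H; by exists a, b.
exists a; have := congr1 (@nm TQ) e; rewrite ntp nmM => h.
have /(dvdn_pfactor _ _ pp)[j j2 ej] : (nm a %| p ^ 2)%N by rewrite -mulnn h dvdn_mulr.
have na := nm_gt1 a1; have nb := nm_gt1 b1.
case: j j2 ej => [|[|[|]]] // _ ej; first by rewrite ej in na.
by move: h; rewrite ej -mulnn; nia.
Qed.

End Monoid.

End QuadraticIntegers.

Lemma natZp_id m : (1 < m)%N -> m%:R = 0 :> 'Z_m.
Proof. by move=> m1; apply: val_inj; rewrite /= val_Zp_nat // modnn. Qed.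

Lemma intrZp_eq m (u v : int) : (1 < m)%N ->
  (u%:~R == v%:~R :> 'Z_m) = (u == v %[mod m])%Z.
Proof.
move=> m1; have m0 : m%:R = 0 :> 'Z_m by exact: natZp_id.
have E (w : int) : w%:~R = (absz (w %% m)%Z)%:R :> 'Z_m.
  rewrite {1}(divz_eq w m) rmorphD rmorphM /= -[(Posz m)%:~R]/(m%:R) m0 mulr0 add0r.
  by have : 0 <= (w %% m)%Z by [apply: modz_ge0; lia]; case: (w %% m)%Z.
have lt w : (absz (w %% m)%Z < m)%N.
  have := @modz_ge0 w m; have := @ltz_pmod w m; lia.
rewrite !E; apply/eqP/eqP => [/(congr1 val)|->] //.
rewrite /= !val_Zp_nat // !modn_small // => h.
by have := @modz_ge0 u m; have := @modz_ge0 v m; lia.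
Qed.

Lemma odd_sum (z : qint) : odd (qf z) -> exists m : int, z.1 + z.2 = 2 * m + 1.
Proof.
move=> o; have [m [i [e ci]]] : exists m i : int, z.1 + z.2 = 2 * m + i /\ (i = 0 \/ i = 1).
  exists ((z.1 + z.2) %/ 2)%Z, ((z.1 + z.2) %% 2)%Z; split; first by rewrite mulrC -divz_eq.
  have := modz_ge0 (z.1 + z.2) (isT : (2 : int) != 0); have := ltz_pmod (z.1 + z.2) (isT : 0 < (2 : int)); lia.
case: ci => [i0|i1]; last by exists m; rewrite e i1.
exfalso; have := qfE z; have -> : z.1 = 2 * m - z.2 by rewrite i0 addr0 in e; rewrite -e addrK.
have -> : (2 * m - z.2) ^+ 2 + 3 * z.2 ^+ 2 = 2 * (2 * m ^+ 2 - 2 * m * z.2 + 2 * z.2 ^+ 2) by ring.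
by move: (_ + 2 * z.2 ^+ 2) => K; lia.
Qed.

(** * Classes of primary elements and their equidistribution *)

Section Classes.
Implicit Types z w y : qint.
Variable M : nat.
Hypothesis M12 : (12 %| M)%N.
Hypothesis M0 : (0 < M)%N.

Lemma M6 : (6 %| M)%N. Proof. exact: dvdn_trans M12. Qed.
Lemma M_gt1 : (1 < M)%N. Proof. by have := dvdn_leq M0 M12; lia. Qed.
Let M1 := M_gt1.

Definition cong (z w : qint) := exists t : qint, z = w + qc M%:Z * t.

Lemma congM z w z' w' : cong z w -> cong z' w' -> cong (z * z') (w * w').
Proof.
by move=> [t ->] [t' ->]; exists (t * w' + w * t' + qc M%:Z * t * t'); ring.
Qed.

Lemma cong_refl z : cong z z. Proof. by exists 0; ring. Qed.
Lemma cong_sym z w : cong z w -> cong w z.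
Proof. by move=> [t ->]; exists (- t); ring. Qed.
Lemma cong_trans z w y : cong z w -> cong w y -> cong z y.
Proof. by move=> [t ->] [t' ->]; exists (t + t'); ring. Qed.

Definition nres (z : qint) : 'Z_M := (qf z)%:R.
(* The ring morphism [Z[sqrt(-3)] -> Z/4] sending [sqrt(-3)] to [1], as [4] divides [1 + 3]. *)
Definition sres (z : qint) : 'Z_4 := (z.1 + z.2)%:~R.

Lemma cong_fst z w : cong z w -> exists k, z.1 = w.1 + M%:Z * k.
Proof. by move=> [t ->]; exists t.1; rewrite /=; ring. Qed.
Lemma cong_snd z w : cong z w -> exists k, z.2 = w.2 + M%:Z * k.
Proof. by move=> [t ->]; exists t.2; rewrite /=; ring. Qed.

Lemma nres_cong z w : cong z w -> nres z = nres w.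
Proof.
move=> c; have [k ek] := cong_fst c; have [l el] := cong_snd c.
rewrite /nres -[(qf z)%:R]/((qf z)%:Z%:~R) -[(qf w)%:R]/((qf w)%:Z%:~R) !qfE ek el.
have -> : (w.1 + M%:Z * k) ^+ 2 + 3 * (w.2 + M%:Z * l) ^+ 2 =
   w.1 ^+ 2 + 3 * w.2 ^+ 2 + M%:Z * (2 * w.1 * k + M%:Z * k ^+ 2 + 6 * w.2 * l + 3 * M%:Z * l ^+ 2) by ring.
by rewrite [LHS]rmorphD [X in _ + X]rmorphM /= -[(Posz M)%:~R]/(M%:R) natZp_id // mul0r addr0.
Qed.

Lemma sres_cong z w : cong z w -> sres z = sres w.
Proof.
move=> c; have [k ek] := cong_fst c; have [l el] := cong_snd c.
have /dvdnP[m em] := M12.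
rewrite /sres ek el.
have -> : w.1 + M%:Z * k + (w.2 + M%:Z * l) = w.1 + w.2 + 4 * (3 * m%:Z * (k + l)).
  by rewrite em PoszM; ring.
by rewrite [LHS]rmorphD [X in _ + X]rmorphM /= -[(Posz 4)%:~R]/(4%:R) natZp_id // mul0r addr0.
Qed.

Lemma tok_cong z w : cong z w -> tok M z = tok M w.
Proof.
move=> c; rewrite /tok; congr (_ && _).
  by rewrite ![coprime _ M]coprime_sym -!(@unitZpE M) // -!/(nres _) (nres_cong c).
have [k ek] := cong_fst c; have /dvdnP[m em] := M12.
by apply/mod3P/mod3P => -[l e]; [exists (l - 4 * m%:Z * k) | exists (l + 4 * m%:Z * k)]; move: ek; rewrite em PoszM; lia.
Qed.

Lemma nresM z w : nres (z * w) = nres z * nres w.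
Proof. by rewrite /nres qfM natrM. Qed.

Lemma sresM z w : sres (z * w) = sres z * sres w.
Proof.
rewrite /sres -rmorphM /=.
have -> : z.1 * w.1 - 3 * (z.2 * w.2) + (z.1 * w.2 + z.2 * w.1) =
   (z.1 + z.2) * (w.1 + w.2) + 4 * (- (z.2 * w.2)) by ring.
by rewrite [LHS]rmorphD [X in _ + X]rmorphM /= -[(Posz 4)%:~R]/(4%:R) natZp_id // mul0r addr0.
Qed.

Lemma nres_unit z : tok M z -> nres z \is a GRing.unit.
Proof. by case/andP=> c _; rewrite /nres unitZpE // coprime_sym. Qed.

Lemma sres_unit z : tok M z -> sres z \is a GRing.unit.
Proof.
case/andP=> c _; have [m e] := odd_sum (tok_odd M6 c).
apply/unitrPr; exists (sres z); rewrite /sres -rmorphM /= e.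
have -> : (2 * m + 1) * (2 * m + 1) = 1 + 4 * (m ^+ 2 + m) by ring.
by rewrite rmorphD rmorphM /= -[(Posz 4)%:~R]/(4%:R) natZp_id // mul0r addr0.
Qed.

Definition clq z : {unit 'Z_M} * {unit 'Z_4} :=
  (insubd (1%g : {unit 'Z_M}) (nres z), insubd (1%g : {unit 'Z_4}) (sres z)).

Lemma clq1E z : tok M z -> val (clq z).1 = nres z.
Proof. by move=> t; rewrite /clq insubdK // -topredE /= nres_unit. Qed.
Lemma clq2E z : tok M z -> val (clq z).2 = sres z.
Proof. by move=> t; rewrite /clq insubdK // -topredE /= sres_unit. Qed.

Lemma clq_eq z w : tok M z -> tok M w ->
  nres z = nres w -> sres z = sres w -> clq z = clq w.
Proof. by move=> tz tw e1 e2; rewrite /clq e1 e2. Qed.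

Lemma clqM z w : tok M z -> tok M w -> clq (z * w) = (clq z * clq w)%g.
Proof.
move=> tz tw; have tzw : tok M (z * w) by rewrite tokM.
rewrite [RHS]/mulg /=; congr pair; apply: val_inj => /=.
  by rewrite !(insubdK, clq1E) -?topredE /= ?nres_unit // nresM.
by rewrite !insubdK -?topredE /= ?sres_unit // sresM.
Qed.

Local Notation T := (TQ M6).

Definition clT (a : T) := clq (val a).

Lemma clTM (a b : T) : clT (um a b) = (clT a * clT b)%g.
Proof. exact: clqM (valP a) (valP b). Qed.

(** Only the classes that occur: norms of primary elements are 1 modulo 3, so not every pair is
    attained. On the image all classes have the same positive density. *)
Definition Gset := [set g | `[< exists a : T, clT a = g >]]%SET.

Lemma GsetP g : (g \in Gset) <-> exists a : T, clT a = g.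
Proof. by rewrite finset.inE; split=> [/asboolW|/asboolT]. Qed.

Lemma Gset_group : group_set Gset.
Proof.
apply/group_setP; split.
  apply/GsetP; exists (u1 T); apply: (mulgI (clT (u1 T))).
  by rewrite -clTM u1m mulg1.
by move=> g h /GsetP[a <-] /GsetP[b <-]; apply/GsetP; exists (um a b); rewrite clTM.
Qed.
Canonical Ggroup := Group Gset_group.

Local Notation gT := [subg Ggroup].

Lemma clT_in a : clT a \in Ggroup. Proof. by apply/GsetP; exists a. Qed.

Definition tcl (a : T) : gT := subg Ggroup (clT a).

Lemma sgval_tcl a : sgval (tcl a) = clT a.
Proof. by rewrite /tcl subgK // clT_in. Qed.

Lemma tclM (a b : T) : tcl (um a b) = (tcl a * tcl b)%g.
Proof. by rewrite /tcl clTM subgM // clT_in. Qed.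

Lemma tcl_surj g : exists a, tcl a = g.
Proof.
have /GsetP[a e] := subgP g; exists a; rewrite /tcl e; exact: sgvalK.
Qed.

Lemma tcl_mulgC (g h : gT) : (g * h = h * g)%g.
Proof.
have [a <-] := tcl_surj g; have [b <-] := tcl_surj h.
by rewrite -!tclM umC.
Qed.

Definition res (z : qint) : 'Z_M * 'Z_M := (z.1%:~R, z.2%:~R).
Definition rep (p : 'Z_M * 'Z_M) : qint := ((val p.1)%:Z, (val p.2)%:Z).

Lemma repK p : res (rep p) = p.
Proof. by case: p => i j; rewrite /res /rep /= -[(Posz i)%:~R]/((i : nat)%:R) -[(Posz j)%:~R]/((j : nat)%:R) !natr_Zp. Qed.

Lemma res_eqP z w : (res z == res w) = rclass M w.1 w.2 z.
Proof. by rewrite xpair_eqE !intrZp_eq. Qed.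

Lemma res_congP z w : res z = res w <-> cong z w.
Proof.
split=> [/eqP|[t ->]].
  rewrite res_eqP => /andP[]; rewrite !eqz_mod_dvd => /dvdzP[k ek] /dvdzP[l el].
  exists (k, l); case: z w ek el => u v [u' v'] /= ek el.
  by congr pair; rewrite /= ?mul0r ?mulr0 ?subr0 ?addr0; lia.
apply/eqP; rewrite xpair_eqE !intrZp_eq // !eqz_mod_dvd; apply/andP.
by split; apply/dvdzP; [exists t.1 | exists t.2]; rewrite /=; ring.
Qed.

Definition good (g : gT) (z : qint) := tok M z && (clq z == sgval g).

Lemma good_cong g z w : cong z w -> good g z = good g w.
Proof.
move=> c; rewrite /good (tok_cong c).
by rewrite /clq (nres_cong c) (sres_cong c).
Qed.

Definition goodset g := [set p | good g (rep p)]%SET.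

(** Multiplication by an element of class [h * g^-1] maps residues of class [g] to residues of class
    [h]; it is injective because the norm of that element is invertible modulo [M]. By symmetry all
    classes consist of equally many residues. *)
Lemma goodset_le g h : (#|goodset g| <= #|goodset h|)%N.
Proof.
have [a ea] := tcl_surj (h * g^-1)%g.
pose f p := res (rep p * val a).
have ta := valP a; case/andP: (ta) => ca _.
have injf : injective f.
  move=> p p' /res_congP c.
  have {}c := congM c (cong_refl (qconj (val a))).
  rewrite -!mulrA !mul_qconj in c.
  have /coprimezP[[s t] /= est] : coprimez (qf (val a))%:Z M%:Z by rewrite coprimezE.
  have {}c := congM c (cong_refl (qc s)).
  have fin q : cong (q * qc (qf (val a))%:Z * qc s) q.
    exists (- qc t * q).
    have -> : q * qc (qf (val a))%:Z * qc s = q * (qc s * qc (qf (val a))%:Z) by ring.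
    have -> : qc s * qc (qf (val a))%:Z = 1 - qc t * qc M%:Z.
      by rewrite -!qcM -qc1 -est qcD addrK.
    by ring.
  rewrite -(repK p) -(repK p'); apply/res_congP.
  exact: cong_trans (cong_trans (cong_sym (fin _)) c) (fin _).
rewrite -(card_imset _ injf); apply: subset_leq_card; apply/fintype.subsetP => q /imsetP[p].
rewrite finset.inE => /andP[tp /eqP cp] ->; rewrite finset.inE.
have cf : cong (rep (f p)) (rep p * val a) by apply/res_congP; rewrite repK.
rewrite (good_cong h cf) /good tokM // ta clqM // cp.
apply/eqP; rewrite -[clq (val a)]/(clT a) -sgval_tcl ea.
have -> : sgval h = sgval (g * (h * g^-1))%g by rewrite tcl_mulgC mulgKV.
by [].
Qed.

Lemma goodset_gt0 g : (0 < #|goodset g|)%N.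
Proof.
have [a ea] := tcl_surj g; apply/card_gt0P; exists (res (val a)); rewrite finset.inE.
have c : cong (rep (res (val a))) (val a) by apply/res_congP; rewrite repK.
by rewrite (good_cong g c) /good (valP a) -ea sgval_tcl eqxx.
Qed.

Variable R : realType.

Lemma t_count : exists A C : R, [/\ 0 < A, 0 <= C & forall (g : gT) x,
  `|\sum_(a <- ball T x | tcl a == g) 1 - A * x%:R| <= C * rt R x].
Proof.
have [a [C [a0 C0 H]]] := @rcount_asymp R M M0.
pose K := #|goodset 1%g|.
have K0 : 0 < K%:R :> R by rewrite ltr0n goodset_gt0.
have KE g : #|goodset g| = K by apply/eqP; rewrite eqn_leq !goodset_le.
exists (a * K%:R), (C * K%:R); split; [by rewrite mulr_gt0 | by rewrite mulr_ge0 | ].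
move=> g x; case: (posnP x) => [->|x0].
  by rewrite /ball big_nil mulr0 subrr normr0 mulr_ge0 ?rt_ge0 ?mulr_ge0.
have -> : \sum_(b <- ball T x | tcl b == g) 1 = \sum_(p in goodset g) (rcount M (rep p).1 (rep p).2 x)%:R :> R.
  transitivity (\sum_(z <- disc x | good g z) 1 : R).
    rewrite -[RHS]big_filter.
    have pe : perm_eq [seq z <- disc x | good g z] [seq val b | b <- ball T x & tcl b == g].
      apply: uniq_perm; first by rewrite (filter_uniq _ (disc_uniq _)).
        by rewrite map_inj_uniq; [apply: filter_uniq; exact: ball_uniq | exact: val_inj].
      move=> z; rewrite mem_filter mem_disc; apply/andP/mapP => [[/andP[tz cz] zx]|[b]].
        have hb : (tmk tz : T) \in ball T x := etrans (mem_ball x (tmk tz : T)) zx.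
        exists (tmk tz : T) => //; rewrite mem_filter; apply/andP; split; last exact: hb.
        apply/eqP/val_inj; rewrite -[LHS]/(sgval (tcl (tmk tz : T))) sgval_tcl; exact/eqP.
      rewrite mem_filter => /andP[/eqP eb bx] ->.
      have bx' : (nm (b : T) <= x)%N by rewrite -mem_ball; exact: bx.
      split; last exact: bx'.
      by rewrite /good (valP b) -eb sgval_tcl eqxx.
    by rewrite (perm_big _ pe) big_map big_filter.
  rewrite (partition_big res (fun p => p \in goodset g)) /=; last first.
    move=> z gz; rewrite finset.inE.
    by have c : cong (rep (res z)) z by [apply/res_congP; rewrite repK]; rewrite (good_cong g c).
  apply: eq_bigr => p; rewrite finset.inE => gp.
  rewrite /rcount -sum1_count natr_sum; apply: eq_bigl => z.
  rewrite -[rclass _ _ _ z]/(rclass M (rep p).1 (rep p).2 z) -res_eqP repK; case: eqP => [e|]; rewrite ?andbF // andbT.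
  by have c : cong z (rep p) by [apply/res_congP; rewrite repK]; rewrite (good_cong g c).
have -> : a * K%:R * x%:R = \sum_(p in goodset g) a * x%:R.
  by rewrite sumr_const KE -[RHS]mulr_natr; ring.
rewrite -sumrB; apply: le_trans (ler_norm_sum _ _ _) _.
have -> : C * K%:R * rt R x = \sum_(p in goodset g) C * rt R x.
  by rewrite sumr_const KE -[RHS]mulr_natr; ring.
by apply: ler_sum => p _; exact: H.
Qed.

End Classes.

(** * Quadratic reciprocity *)

Lemma natFp_eq0 p n : prime p -> (n%:R == 0 :> 'F_p) = (p %| n)%N.
Proof. by move=> pp; rewrite -(dvdn_pcharf (pchar_Fp pp)). Qed.

(** As 3 divides [p - 1], there is a cube root of unity [w] other than 1, and [2 * w + 1] is a
    square root of -3. *)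
Lemma exists_sqrt_m3 p : prime p -> (p == 1 %[mod 3])%N -> exists z : 'F_p, z ^+ 2 = - 3.
Proof.
move=> pp p3.
have c : #|[set: {unit 'F_p}]%G| = p.-1.
  by rewrite card_finField_unit card_Fp.
have d3 : (3 %| #|[set: {unit 'F_p}]%G|)%N.
  by rewrite c -subn1 -eqn_mod_dvd ?prime_gt0.
have [w _ ow] := Cauchy (isT : prime 3) d3.
have w3 : val w ^+ 3 = 1 :> 'F_p by rewrite -FinRing.val_unitX -ow expg_order.
have w1 : val w - 1 != 0 :> 'F_p.
  rewrite subr_eq0; apply/eqP => h.
  by have : w = 1%g by [apply: val_inj]; move/eqP; rewrite -order_eq1 ow.
exists (2 * val w + 1).
have /eqP : (val w - 1) * (val w ^+ 2 + val w + 1) = 0.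
  have -> : (val w - 1) * (val w ^+ 2 + val w + 1) = val w ^+ 3 - 1 by ring.
  by rewrite w3 subrr.
rewrite mulf_eq0 (negbTE w1) /= => /eqP h.
have -> : (2 * val w + 1) ^+ 2 = 4 * (val w ^+ 2 + val w + 1) - 3 by ring.
by rewrite h mulr0 sub0r.
Qed.

(** * Euler's criterion *)

Section HalfPower.
Variable p : nat.
Hypothesis pp : prime p.
Hypothesis op : odd p.
Local Notation h := (p.-1./2).

Lemma half_double : (h * 2 = p.-1)%N.
Proof. by have := odd_double_half p.-1; have := prime_gt1 pp; move: op; case: p => // n; rewrite /= muln2; lia. Qed.

Lemma Fp_fermat (a : 'F_p) : a != 0 -> a ^+ p.-1 = 1.
Proof.
move=> a0; apply: (mulfI a0); rewrite mulr1 -exprS prednK ?prime_gt0 //.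
by rewrite -{2}(expf_card a) card_Fp.
Qed.

Lemma half_sqr (a : 'F_p) : a != 0 -> (a ^+ h) ^+ 2 = 1.
Proof. by move=> a0; rewrite -exprM half_double Fp_fermat. Qed.

Lemma half_of_sqr (a : 'F_p) : a != 0 -> (a ^+ 2) ^+ h = 1.
Proof. by move=> a0; rewrite -exprM mulnC half_double Fp_fermat. Qed.

Lemma half_cases (a : 'F_p) : a != 0 -> a ^+ h = 1 \/ a ^+ h = -1.
Proof. by move=> /half_sqr/eqP; rewrite sqrf_eq1 => /orP[]/eqP; [left|right]. Qed.

Lemma Fp_two_neq0 : 2 != 0 :> 'F_p.
Proof. by rewrite natFp_eq0 // dvdn_prime2 //; apply/eqP => h; move: op; rewrite h. Qed.

Lemma Fp_1N1 : 1 != -1 :> 'F_p.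
Proof. by rewrite -subr_eq0 opprK; exact: Fp_two_neq0. Qed.

Lemma exists_nonresidue : exists2 a : 'F_p, a != 0 & a ^+ h = -1.
Proof.
have p1 := prime_gt1 pp.
have h0 : (0 < h)%N by have := half_double; lia.
have [a /andP[a0 ah]|none] := pickP (fun a : 'F_p => (a != 0) && (a ^+ h != 1)).
  by exists a => //; case: (half_cases a0) => // e; rewrite e eqxx in ah.
have : (size (enum (predC1 (0 : 'F_p)%R)) <= h)%N.
  apply: max_unity_roots => //; last exact: enum_uniq.
  apply/allP => a; rewrite mem_enum inE => a0; apply/unity_rootP.
  by have := none a; rewrite a0 /= => /negbFE/eqP.
by rewrite -cardE cardC1 card_Fp //; have := half_double; lia.
Qed.

Lemma half_sqrt (a : 'F_p) : (p == 3 %[mod 4])%N -> a ^+ h = 1 -> exists b, b ^+ 2 = a.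
Proof.
move=> p4 e; exists (a ^+ (p %/ 4).+1); rewrite -exprM.
have -> : ((p %/ 4).+1 * 2 = h.+1)%N.
  by have := half_double; have := divn_eq p 4; rewrite (eqP p4); have := prime_gt0 pp; lia.
by rewrite exprS e mulr1.
Qed.

Lemma exists_sqrt_m1 : (p == 1 %[mod 4])%N -> exists i : 'F_p, i ^+ 2 = -1.
Proof.
move=> p4; have [a a0 e] := exists_nonresidue; exists (a ^+ (p %/ 4)).
rewrite -exprM -e; congr (_ ^+ _).
by have := half_double; have := divn_eq p 4; rewrite (eqP p4); have := prime_gt0 pp; lia.
Qed.

Lemma sqrt_m1_mod4 (i : 'F_p) : i ^+ 2 = -1 -> (p == 1 %[mod 4])%N.
Proof.
move=> ei; have i0 : i != 0.
  by apply/eqP => i0; move/eqP: ei; rewrite i0 expr0n /= eq_sym oppr_eq0 oner_eq0.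
have := half_of_sqr i0; rewrite ei => e.
have oh : ~~ odd h.
  by apply/negP => oh; move: e; rewrite -signr_odd oh expr1 => /esym/eqP; rewrite (negbTE Fp_1N1).
by have := half_double; have := odd_double_half h; have := prime_gt1 pp; rewrite (negbTE oh); lia.
Qed.

Lemma half_m1 : (p == 1 %[mod 4])%N -> (-1) ^+ h = 1 :> 'F_p.
Proof.
move=> p4; rewrite -signr_odd; have -> : odd h = false; last by rewrite expr0.
by have := half_double; have := divn_eq p 4; rewrite (eqP p4); have := prime_gt0 pp; lia.
Qed.

(** If [i ^+ 2 = -1], then [2 * i] is the square of [1 + i], so 2 and [i] have the same quadratic
    character, and that of [i] is [(-1) ^+ (p %/ 4)]. *)
Lemma half_two : (p == 1 %[mod 4])%N -> (2 : 'F_p) ^+ h = if (p == 1 %[mod 8])%N then 1 else -1.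
Proof.
move=> p4; have [i ei] := exists_sqrt_m1 p4.
have i1 : 1 + i != 0.
  apply/eqP => /eqP; rewrite addrC addr_eq0 => /eqP e; move/eqP: ei; rewrite e sqrrN expr1n.
  by rewrite (negbTE Fp_1N1).
have E : 2 ^+ h * i ^+ h = 1.
  rewrite -exprMn; have -> : 2 * i = (1 + i) ^+ 2; last exact: half_of_sqr.
  have -> : (1 + i) ^+ 2 = 1 + i ^+ 2 + 2 * i by ring.
  by rewrite ei subrr add0r.
have d4 := divn_eq p 4; rewrite (eqP p4) in d4.
have hp : h = (2 * (p %/ 4))%N by have := half_double; have := prime_gt0 pp; lia.
move: E; rewrite {2}hp exprM ei -signr_odd.
have -> : (p == 1 %[mod 8])%N = ~~ odd (p %/ 4).
  by have := divn_eq p 8; have := ltn_pmod p (isT : 0 < 8)%N; lia.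
by case: (odd _) => /=; rewrite ?expr0 ?expr1 ?mulr1 // mulrN1 => /eqP; rewrite eqr_oppLR => /eqP.
Qed.

End HalfPower.

(** * Quadratic reciprocity by Gauss sums *)

Section Reciprocity.
Variables p q : nat.
Hypotheses (pp : prime p) (qp : prime q) (oq : odd q) (p4 : (p == 1 %[mod 4])%N) (pq : p != q).
Local Notation h := (p.-1./2).

Let op : odd p.
Proof. by have := divn_eq p 4; rewrite (eqP p4); lia. Qed.

Section GaussSum.
Variables (K : closedFieldType) (iota : {rmorphism 'F_q -> K}).

Lemma K_pchar : q \in [pchar K].
Proof. exact: rmorph_pchar iota _ (pchar_Fp qp). Qed.

Lemma K_natr_eq0 n : (n%:R == 0 :> K) = (q %| n)%N.
Proof. by rewrite -(dvdn_pcharf K_pchar). Qed.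

Lemma K_p_neq0 : p%:R != 0 :> K.
Proof. by rewrite K_natr_eq0 dvdn_prime2 // eq_sym. Qed.

Lemma K_two_neq0 : 2 != 0 :> K.
Proof. by rewrite K_natr_eq0 dvdn_prime2 //; apply/eqP => e; move: oq; rewrite e. Qed.

Lemma exists_zeta : exists z : K, \sum_(i < p) z ^+ i = 0 /\ z ^+ p = 1.
Proof.
pose P : {poly K} := \sum_(i < p) 'X^i.
have sP : size P = p.
  have p0 := prime_gt0 pp; have -> : P = \poly_(i < p) 1.
    by rewrite poly_def; apply: eq_bigr => i _; rewrite scale1r.
  by rewrite size_poly_eq // oner_neq0.
have /closed_rootP[z /rootP ez] : size P != 1%N by rewrite sP; have := prime_gt1 pp; lia.
have ez' : \sum_(i < p) z ^+ i = 0.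
  by rewrite -[RHS]ez /P horner_sum; apply: eq_bigr => i _; rewrite hornerXn.
exists z; split => //.
by have := subrX1 z p; rewrite ez' mulr0 => /eqP; rewrite subr_eq0 => /eqP.
Qed.

Variable z : K.
Hypotheses (z_sum : \sum_(i < p) z ^+ i = 0) (zp : z ^+ p = 1).

Definition ez (a : 'F_p) : K := z ^+ (val a).

Lemma ez_nat n : ez n%:R = z ^+ n.
Proof. by rewrite /ez /= val_Fp_nat // expr_mod. Qed.

Lemma Fp_natE (a : 'F_p) : a = (val a)%:R.
Proof. by apply: val_inj; rewrite /= val_Fp_nat // modn_small // -[X in (_ < X)%N](Fp_cast pp). Qed.

Lemma ezD (a b : 'F_p) : ez (a + b) = ez a * ez b.
Proof. by rewrite {1}(Fp_natE a) {1}(Fp_natE b) -natrD ez_nat exprD. Qed.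

Lemma sum_ez : \sum_a ez a = 0.
Proof.
rewrite -[RHS]z_sum; transitivity (\sum_(0 <= i < (Zp_trunc (pdiv p)).+2) z ^+ i); first by rewrite big_mkord.
by rewrite (Fp_cast pp) big_mkord.
Qed.

Lemma sum_ezM (c : 'F_p) : \sum_a ez (a * c) = if c == 0 then p%:R else 0.
Proof.
case: eqP => [->|/eqP c0].
  under eq_bigr do rewrite mulr0 /ez expr0.
  by rewrite sumr_const card_Fp.
by rewrite -(reindex_inj (mulIf c0) (P := xpredT) (F := ez)) sum_ez.
Qed.

Definition leg (a : 'F_p) : K := if a == 0 then 0 else if a ^+ h == 1 then 1 else -1.

Lemma leg_neq0 a : a != 0 -> leg a = if a ^+ h == 1 then 1 else -1.
Proof. by rewrite /leg => /negbTE ->. Qed.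

Lemma legM a b : leg (a * b) = leg a * leg b.
Proof.
case: (eqVneq a 0) => [->|a0]; first by rewrite mul0r /leg eqxx mul0r.
case: (eqVneq b 0) => [->|b0]; first by rewrite mulr0 /leg eqxx mulr0.
have n1 : (-1 == 1 :> 'F_p) = false by rewrite eq_sym; apply/negbTE; exact: Fp_1N1.
rewrite !leg_neq0 ?mulf_neq0 // exprMn.
case: (half_cases pp op a0) => ->; case: (half_cases pp op b0) => ->;
  by rewrite ?mulr1 ?mul1r ?mulrNN ?mulr1 ?eqxx ?n1 ?mulr1 ?mul1r ?mulrNN ?mulr1.
Qed.

Lemma leg_sqr a : a != 0 -> leg a * leg a = 1.
Proof. by move=> a0; rewrite leg_neq0 //; case: ifP => _; rewrite ?mulrNN mulr1. Qed.

Lemma legN1 : leg (-1) = 1.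
Proof. by rewrite leg_neq0 ?oppr_eq0 ?oner_neq0 // half_m1 // eqxx. Qed.

Lemma sum_leg : \sum_a leg a = 0.
Proof.
have [n n0 en] := exists_nonresidue pp op.
have e : \sum_a leg a = - \sum_a leg a.
  rewrite {1}(reindex_inj (mulfI n0)) /= -sumrN; apply: eq_bigr => a _.
  rewrite legM leg_neq0 // en eq_sym (negbTE (Fp_1N1 pp op)); exact: mulN1r.
have : 2 * \sum_a leg a = 0 by rewrite mulr_natl mulr2n {1}e addNr.
by move/eqP; rewrite mulf_eq0 (negbTE K_two_neq0) /= => /eqP.
Qed.

Definition tau := \sum_a leg a * ez a.

(** After the substitution [b = a * c] the inner sum of [ez (a * (1 + c))] over [a] is nonzero only
    for [c = -1]. As [p] is 1 modulo 4, [leg (-1)] is 1 and no sign appears. *)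
Lemma tau_sqr : tau ^+ 2 = p%:R.
Proof.
have -> : tau ^+ 2 = \sum_a \sum_c leg c * ez (a * (1 + c)).
  rewrite expr2 {1}/tau mulr_suml; apply: eq_bigr => a _.
  case: (eqVneq a 0) => [->|a0].
    rewrite {1}/leg eqxx !mul0r; under eq_bigr do rewrite mul0r /ez expr0 mulr1.
    by rewrite sum_leg.
  rewrite /tau (reindex_inj (mulfI a0)) /= mulr_sumr; apply: eq_bigr => c _.
  rewrite legM mulrDr mulr1 ezD.
  have -> : leg a * ez a * (leg a * leg c * ez (a * c)) = (leg a * leg a) * (leg c * (ez a * ez (a * c))) by ring.
  by rewrite leg_sqr // mul1r.
rewrite exchange_big /= (bigD1 (-1)) //= [X in _ + X]big1 => [|c c1].
  by rewrite -mulr_sumr sum_ezM subrr eqxx legN1 mul1r addr0.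
by rewrite -mulr_sumr sum_ezM addrC addr_eq0 (negbTE c1) mulr0.
Qed.

(** Raising to the power [q] fixes the values of [leg] and sends [ez a] to [ez (q * a)]; reindexing
    the sum extracts the factor [leg q]. *)
Lemma tau_frobenius : leg q%:R * tau ^+ q = tau.
Proof.
have q0 : q%:R != 0 :> 'F_p by rewrite natFp_eq0 // dvdn_prime2.
rewrite -(pFrobenius_autE K_pchar) /tau rmorph_sum mulr_sumr /=.
rewrite [RHS](reindex_inj (mulfI q0)) /=; apply: eq_bigr => a _.
rewrite rmorphM /= !pFrobenius_autE legM -mulrA; congr (_ * _); congr (_ * _).
  rewrite /leg; case: ifP => _; first by rewrite expr0n; case: q qp.
  by case: ifP => _; rewrite ?expr1n // -signr_odd oq expr1.
by rewrite {1}/ez -exprM -(ez_nat (val a * q)) natrM -Fp_natE mulrC.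
Qed.

Lemma tau_neq0 : tau != 0.
Proof. by apply: contraNneq K_p_neq0 => e; rewrite -tau_sqr e expr0n. Qed.

Lemma Fq_exp (x : 'F_q) : x ^+ q = x.
Proof. by rewrite -[X in _ ^+ X](card_Fp qp) expf_card. Qed.

Lemma frobenius_fixed (x : K) : x ^+ q = x -> exists y, x = iota y.
Proof.
move=> ex; have := finField_genPoly 'F_q; rewrite card_Fp // => /(congr1 (map_poly iota)).
rewrite rmorphB /= map_polyXn map_polyX => /(congr1 (horner^~ x)).
rewrite !hornerE ex subrr rmorph_prod /= horner_prod => /esym/eqP.
rewrite prodf_seq_eq0 => /hasP[y _] /=.
rewrite rmorphB /= map_polyX map_polyC /= !hornerE subr_eq0 => /eqP ->; by exists y.
Qed.

(** [tau] is a square root of [p] in [K], and it comes from 'F_q exactly when Frobenius fixes it,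
    that is, when [leg q] is 1. *)
Lemma reciprocity_closed : reflect (exists x : 'F_q, x ^+ 2 = p%:R) ((q%:R : 'F_p) ^+ h == 1).
Proof.
have q0 : q%:R != 0 :> 'F_p by rewrite natFp_eq0 // dvdn_prime2.
have := tau_frobenius; rewrite leg_neq0 //; case: ifP => e ht; constructor.
  have [x ex] := frobenius_fixed (etrans (esym (mul1r _)) ht).
  by exists x; apply: (fmorph_inj iota); rewrite rmorphXn /= -ex tau_sqr rmorph_nat.
case=> x ex; have : tau ^+ 2 == iota x ^+ 2 by rewrite tau_sqr -rmorphXn ex rmorph_nat.
have tq : tau ^+ q = tau -> False.
  move=> et; move: ht; rewrite et mulN1r => /eqP; rewrite eq_sym -addr_eq0 -mulr2n -mulr_natl mulf_eq0.
  by rewrite (negbTE K_two_neq0) (negbTE tau_neq0).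
rewrite eqf_sqr => /orP[] /eqP et; apply: tq; rewrite et.
  by rewrite -rmorphXn /= Fq_exp.
by rewrite exprNn -signr_odd oq expr1 mulN1r -rmorphXn /= Fq_exp.
Qed.

End GaussSum.

Lemma reciprocity : reflect (exists x : 'F_q, x ^+ 2 = p%:R) ((q%:R : 'F_p) ^+ h == 1).
Proof.
suff R0 : (q%:R : 'F_p) ^+ h == 1 <-> exists x : 'F_q, x ^+ 2 = p%:R by apply: (iffP idP) => /R0.
have [K [iota _]] := countable_algebraic_closure 'F_q.
have [z [z_sum zp]] := exists_zeta K.
by split=> /(reciprocity_closed iota z_sum zp).
Qed.

End Reciprocity.

(** * Primes of the form u^2 + 3 v^2 *)

Lemma exists_dvd_sqr3 p : prime p -> (p == 1 %[mod 3])%N -> exists x, (p %| x ^ 2 + 3)%N.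
Proof.
move=> pp p3; have [z ez] := exists_sqrt_m3 pp p3.
exists (val z); rewrite -natFp_eq0 // natrD natrX.
have -> : (val z)%:R = z :> 'F_p by apply: val_inj; rewrite /= val_Fp_nat // modn_small // -[X in (_ < X)%N](Fp_cast pp).
by rewrite ez addNr.
Qed.

Section EisensteinPrimes.
Variables (R : realType) (M : nat).
Hypothesis M12 : (12 %| M)%N.
Hypothesis M0 : (0 < M)%N.
Local Notation M6 := (M6 M12).
Local Notation T := (TQ M6).
Local Notation tcl := (@tcl M M12 M0).
Local Notation gT := [subg Ggroup M12 M0].
Let M1 : (1 < M)%N := M_gt1 M12 M0.

Lemma uirr_prime_nm (a : T) : prime (nm a) -> uirr a.
Proof.
move=> pa; apply/asboolP; split=> [a1|b c e].
  by move: pa; rewrite a1 nm1.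
move: pa; rewrite e nmM => /primeP[_ /(_ (nm b))].
rewrite dvdn_mulr // => /(_ isT) /orP[/eqP/nm_eq1|/eqP h]; first by left.
by right; apply: nm_eq1; have := nm_gt0 b; nia.
Qed.

Lemma Lam_prime_nm (a : T) : prime (nm a) -> Lam R a = ln (nm a)%:R.
Proof.
by move=> /uirr_prime_nm pa; have := @Lam_upow R _ a 0 pa; rewrite -[upow a 1]/(um a (u1 _)) um1.
Qed.

(** Were all classes over [r] uncharged, [Lam R a / nm a] summed over the elements of norm [r]
    modulo [M] would be bounded. But every prime [n] in this progression is 1 modulo 3, hence the
    norm of an element, which contributes [ln n / n], against [dirichlet_sum]. *)
Lemma split_charged r : coprime r M -> (r == 1 %[mod 3])%N ->
  exists g : gT, charged R tcl g /\ val (sgval g).1 = r%:R :> 'Z_M.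
Proof.
move=> cr r3; apply: contrapT => H.
have /choice[B HB] (g : gT) : exists B : R, 0 <= B /\
    (val (sgval g).1 = r%:R :> 'Z_M -> forall x, Rcl R tcl g x <= B).
  case: (pselect (charged R tcl g)) => [cg|ncg].
    by exists 0; split => // e; case: H; exists g.
  by have [B B0 hB] := not_charged ncg; exists B.
have [x hx] := dirichlet_sum M1 cr (\sum_g B g); move: hx; rewrite ltNge => /negP; apply.
apply: (@le_trans _ _ (\sum_(a <- ball T x | val (sgval (tcl a)).1 == r%:R :> 'Z_M) Lam R a / (nm a)%:R)).
  rewrite big_mkcond sum_ball; apply: ler_sum_nat => n /andP[n0 nx].
  have pos : 0 <= \sum_(a <- el T n) (if val (sgval (tcl a)).1 == r%:R :> 'Z_M then Lam R a / (nm a)%:R else 0).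
    by apply: sumr_ge0 => a _; case: ifP => // _; exact: Lam_div_ge0.
  case: (boolP (prime n)) => pn /=; last by rewrite mul0r.
  case: (eqVneq (n %% M)%N (r %% M)%N) => e; last by rewrite mul0r.
  rewrite mul1r.
  have cn : coprime n M by rewrite -coprime_modl e coprime_modl.
  have n3 : (n == 1 %[mod 3])%N.
    have d3 : (3 %| M)%N by apply: dvdn_trans M12.
    by rewrite -(eqP r3) -(modn_dvdm n d3) -(modn_dvdm r d3) e.
  have [y hy] := exists_dvd_sqr3 pn n3.
  have [a na] := t_split M6 pn cn n3 hy.
  have ae : a \in el T n by rewrite mem_el na.
  rewrite (bigD1_seq a) ?el_uniq //= sgval_tcl /clT clq1E ?(valP a) //.
  have -> : nres M (val a) = r%:R :> 'Z_M.
    have -> : nres M (val a) = n%:R by rewrite /nres -[qf (val a)]/(nm a) na.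
    by apply: val_inj; rewrite /= !val_Zp_nat.
  rewrite eqxx Lam_prime_nm na // -[qf (sval a)]/(nm a) na lerDl; apply: sumr_ge0 => b _.
  by case: ifP => // _; exact: (@Lam_div_ge0 R T b).
rewrite (partition_big tcl (fun g => val (sgval g).1 == r%:R :> 'Z_M)) //=.
apply: (@le_trans _ _ (\sum_(g : gT | val (sgval g).1 == r%:R :> 'Z_M) B g)).
  apply: ler_sum => g /eqP eg; apply: le_trans ((HB g).2 eg x).
  rewrite le_eqVlt; apply/orP; left; apply/eqP; apply: eq_bigl => a.
  by case: (eqVneq (tcl a) g) => [->|_]; rewrite ?andbF ?andbT //; apply/eqP.
rewrite [leRHS](bigID (fun g : gT => val (sgval g).1 == r%:R :> 'Z_M)) /= lerDl.
by apply: sumr_ge0 => g _; exact: (HB g).1.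
Qed.

Definition tconjT (a : T) : T := tconj a.

Lemma uirr_conj (p : T) : uirr p -> uirr (tconjT p).
Proof.
move=> /asboolP[p1 H]; apply/asboolP; split.
  move=> /(congr1 tconjT); rewrite /tconjT tconjK => h; apply: p1; rewrite h.
  by apply: val_inj; rewrite /= /qconj /= oppr0.
move=> a b /(congr1 tconjT); rewrite /tconjT tconjK => e.
have c1 : tconjT (u1 T) = u1 T by apply: val_inj; rewrite /= /qconj /= oppr0.
have [|h|h] := H (tconjT a) (tconjT b); first by rewrite e; exact: tconjM.
  by left; rewrite -(tconjK a) -[tconj a]/(tconjT a) h -[tconj _]/(tconjT (u1 T)).
by right; rewrite -(tconjK b) -[tconj b]/(tconjT b) h -[tconj _]/(tconjT (u1 T)).
Qed.

Lemma nm_conj (a : T) : nm (tconjT a) = nm a.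
Proof. exact: qf_conj. Qed.

Lemma Lam_conj_ge (a : T) : Lam R a <= Lam R (tconjT a).
Proof.
case: (eqVneq (Lam R a) 0) => [->|/Lam_neq0[p [k [pp ->]]]]; first exact: Lam_ge0.
have -> : tconjT (upow p k.+1) = upow (tconjT p) k.+1.
  elim: k.+1 => [|n IH] /=; first by apply: val_inj; rewrite /= /qconj /= oppr0.
  by rewrite -IH; exact: tconjM.
by rewrite !Lam_upow ?uirr_conj // nm_conj.
Qed.

(** The images of [z] and its conjugate in Z/4 multiply to the norm, and a unit of Z/4 is its own
    inverse. *)
Lemma sres_conj (z : qint) : tok M z -> sres (qconj z) = (qf z)%:R * sres z.
Proof.
case/andP=> c _; have [m e] := odd_sum (tok_odd M6 c).
rewrite /sres /= -[(qf z)%:R]/((qf z)%:Z%:~R) -rmorphM qfE /=.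
have e1 : z.1 = 2 * m + 1 - z.2 by rewrite -e addrK.
have -> : (z.1 ^+ 2 + 3 * z.2 ^+ 2) * (z.1 + z.2) =
  (z.1 - z.2) + 4 * ((z.1 - z.2) * (m ^+ 2 + m) + z.2 ^+ 2 * (z.1 + z.2)) by rewrite e1; ring.
by rewrite [RHS]rmorphD [X in _ = _ + X]rmorphM /= -[(Posz 4)%:~R]/(4%:R) natZp_id // mul0r addr0.
Qed.

Lemma charged_conj (a : T) : charged R tcl (tcl a) -> charged R tcl (tcl (tconjT a)).
Proof.
move=> ca B; have [x hx] := ca B; exists x; apply: lt_le_trans hx _.
rewrite /Rcl -[leLHS]big_filter -[leRHS]big_filter.
apply: (@le_trans _ _ (\sum_(b <- [seq tconjT b | b <- ball T x & tcl b == tcl a]) Lam R b / (nm b)%:R)).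
  rewrite big_map; apply: ler_sum => b _; rewrite nm_conj ler_wpM2r ?invr_ge0 //; exact: Lam_conj_ge.
apply: sum_subset_le; last by move=> b; exact: Lam_div_ge0.
  rewrite map_inj_uniq; first by apply: filter_uniq; exact: ball_uniq.
  exact: (can_inj (@tconjK M)).
move=> b /mapP[b']; rewrite mem_filter mem_ball => /andP[/eqP eb bx] ->.
rewrite mem_filter mem_ball nm_conj bx andbT; apply/eqP.
have : sgval (tcl b') = sgval (tcl a) by rewrite eb.
rewrite !sgval_tcl /clT => h.
have tb := valP b'; have ta := valP a; have tb' := valP (tconjT b'); have ta' := valP (tconjT a).
have n1 : nres M (val b') = nres M (val a) by rewrite -!(clq1E M12 M0) // h.
have s1 : sres (val b') = sres (val a) by rewrite -!(clq2E M12) // h.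
apply: val_inj; rewrite -[LHS]/(sgval (tcl (tconjT b'))) -[RHS]/(sgval (tcl (tconjT a))) !sgval_tcl /clT.
apply: clq_eq => //; first by rewrite /nres -![qf (val (tconjT _))]/(nm (tconjT _)) !nm_conj; exact: n1.
rewrite -![val (tconjT _)]/(qconj _) !sres_conj // s1; congr (_ * _).
move: n1 => /(congr1 val); rewrite /= !val_Zp_nat // => n1.
have d4 : (4 %| M)%N by apply: dvdn_trans M12.
apply: val_inj; rewrite /= !val_Zp_nat //.
by rewrite -(modn_dvdm (qf (sval b')) d4) -(modn_dvdm (qf (sval a)) d4) n1.
Qed.

Lemma sgval_fstM (x y : gT) : val (sgval (x * y)%g).1 = val (sgval x).1 * val (sgval y).1.
Proof. by []. Qed.

Lemma sgval_sndM (x y : gT) : val (sgval (x * y)%g).2 = val (sgval x).2 * val (sgval y).2.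
Proof. by []. Qed.

Lemma unitZ4_cases (s : {unit 'Z_4}) : val s = 1 \/ val s = - 1.
Proof.
have h : coprime 4 (val (val s)) by rewrite -(@unitZpE 4) // natr_Zp; exact: (valP s).
by move: h; case: (val s) => -[|[|[|[|n]]]] //= i _; [left|right]; exact: val_inj.
Qed.

(** With [d] the part of [M] prime to 6, the number [16 + 27 * d ^ 2] is odd, is 1 modulo 3, and is
    16 modulo every prime divisor of [d]. As [d ^ 2] is 1 modulo 4, it is 3 modulo 4. *)
Lemma exists_norm3mod4 : exists n, [/\ coprime n M, (n == 1 %[mod 3])%N & (n == 3 %[mod 4])%N].
Proof.
pose pi : nat_pred := [pred p : nat | (3 < p)%N].
pose d := partn M pi.
have d_primes q : prime q -> (q %| d)%N = (3 < q)%N && (q %| M)%N.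
  move=> pq; have := mem_primes q d; rewrite pq part_gt0 /= => <-.
  by rewrite primes_part mem_filter mem_primes pq M0.
have od : odd d.
  by have := d_primes 2 isT; rewrite dvdn2 => /negbFE.
have [k ek] : exists k, d = k.*2.+1 by exists d./2; have := odd_double_half d; rewrite od; lia.
exists (16 + 27 * (d * d))%N; split.
- set n := (16 + _)%N; rewrite /coprime; apply: contraT => ne.
  have g1 : (1 < gcdn n M)%N by have := gcdn_gt0 n M; rewrite M0 orbT; lia.
  pose q := pdiv (gcdn n M); have pq : prime q := pdiv_prime g1.
  have qn : (q %| n)%N := dvdn_trans (pdiv_dvd _) (dvdn_gcdl _ _).
  have qM : (q %| M)%N := dvdn_trans (pdiv_dvd _) (dvdn_gcdr _ _).
  case: (leqP q 3) => [q3|q3]; last first.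
    have qd : (q %| d)%N by rewrite d_primes // q3.
    have : (q %| 2 ^ 4)%N.
      by move: qn; rewrite /n dvdn_addl // mulnA dvdn_mull.
    by rewrite Euclid_dvdX // dvdn_prime2 //= andbT => /eqP q2; rewrite q2 in q3.
  have /orP[/eqP q2|/eqP q3'] : (q == 2%N) || (q == 3%N) by have := prime_gt1 pq; lia.
    by move: qn; rewrite q2 dvdn2 /n oddD !oddM od.
  by move: qn; rewrite q3' /n dvdn_addl // dvdn_mulr.
- by rewrite -[27%N]/(3 * 9)%N -mulnA mulnC -modnDmr modnMl.
- have -> : (16 + 27 * (d * d) = 3 + 4 * (27 * (k * k + k) + 10))%N by rewrite ek -mul2n; nia.
  by rewrite addnC mulnC modnMDl.
Qed.

Lemma conj_quotient (a : T) n : nres M (val a) = n%:R -> (n == 3 %[mod 4])%N ->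
  let z := (tcl (tconjT a) * (tcl a)^-1)%g in
  val (sgval z).1 = 1 :> 'Z_M /\ val (sgval z).2 = -1 :> 'Z_4.
Proof.
move=> en n4 z.
have E : clT (tconjT a) = (sgval z * clT a)%g.
  by rewrite -!sgval_tcl -[RHS]/(sgval (z * tcl a)%g) /z mulgKV.
have ta := valP a; have ta' := valP (tconjT a).
have E1 : nres M (val (tconjT a)) = val (sgval z).1 * nres M (val a).
  by rewrite -!(clq1E M12 M0) // -[clq M (val (tconjT a))]/(clT (tconjT a)) E.
have E2 : sres (val (tconjT a)) = val (sgval z).2 * sres (val a).
  by rewrite -!(clq2E M12) // -[clq M (val (tconjT a))]/(clT (tconjT a)) E.
split.
  apply: (mulIr (nres_unit M12 M0 ta)); rewrite -E1 mul1r.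
  by rewrite /nres -[qf (val (tconjT a))]/(nm (tconjT a)) nm_conj.
apply: (mulIr (sres_unit M12 ta)); rewrite -E2 -[val (tconjT a)]/(qconj (val a)) sres_conj //.
congr (_ * _); move: en => /(congr1 val); rewrite /= !val_Zp_nat // => qn.
have d4 : (4 %| M)%N by apply: dvdn_trans M12.
by apply: val_inj; rewrite /= val_Zp_nat // -(modn_dvdm _ d4) qn (modn_dvdm _ d4) (eqP n4).
Qed.

Theorem t_all_charged g : charged R tcl g.
Proof.
have [A [C [A0 C0 cnt]]] := @t_count M M12 M0 R.
have h328 : 0 <= 328 :> R by [].
have cheb : forall x, \sum_(a <- ball T x) Lam R a <= 328 * x%:R.
  by apply: sum_Lam_le; [exact: t_Lam_ppower | exact: t_sum_Lam_el].
have clM := @tclM M M12 M0.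
apply: (all_charged clM A0 C0 cnt h328 cheb) => f vf k.
have chg := vanishing_charged (@tcl_mulgC M M12 M0) clM A0 C0 cnt h328 cheb (f := f).
have [c0 [ch0 e0]] := split_charged (coprime1n M) (eqxx _).
have [n [cn n3 n4]] := exists_norm3mod4.
have [c1 [ch1 e1]] := split_charged cn n3.
have [a ea] := tcl_surj c1.
have ch1' : charged R tcl (tcl (tconjT a)) by apply: charged_conj; rewrite ea.
pose z := (tcl (tconjT a) * c1^-1)%g.
(* [z] is a quotient of two charged classes, so two sign changes cancel. *)
have fz h : f (z * h)%g = f h.
  rewrite /z -mulgA (chg _ _ vf ch1').
  by have := chg c1 (c1^-1 * h)%g vf ch1; rewrite mulKVg => ->.
have [z1 z2] : val (sgval z).1 = 1 :> 'Z_M /\ val (sgval z).2 = -1 :> 'Z_4.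
  by rewrite /z -ea; apply: (conj_quotient (n := n)) => //; rewrite -(clq1E M12 M0) ?(valP a) // -e1 -ea sgval_tcl.
(* A class over norm 1 has second component 1 or -1, so it is 1 or [z]. Both leave [f] unchanged,
   while [c0], being charged, changes its sign. *)
suff [h|h] : c0 = 1%g \/ c0 = z.
- by have := chg c0 k vf ch0; rewrite h mul1g; lra.
- by have := chg c0 k vf ch0; rewrite h fz; lra.
have eqg (x y : gT) : val (sgval x).1 = val (sgval y).1 -> val (sgval x).2 = val (sgval y).2 -> x = y.
  move=> h1 h2; apply: val_inj; rewrite -[LHS]/(sgval x) -[RHS]/(sgval y).
  by case: (sgval x) (sgval y) h1 h2 => [x1 x2] [y1 y2] /= /val_inj -> /val_inj ->.
have [s|s] := unitZ4_cases (sgval c0).2; [left|right]; apply: eqg; rewrite ?e0 ?s ?z1 ?z2 //.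
Qed.

(** All classes of the group being charged, it remains to see that the class with components [r] and
    -1 occurs: [split_charged] provides a class over [r], and the quotient in [conj_quotient]
    corrects its second component. *)
Theorem exists_prime_qf r : coprime r M -> (r == 1 %[mod 3])%N ->
  exists z : qint, [/\ prime (qf z), (qf z == r %[mod M])%N, tok M z & sres z = -1].
Proof.
move=> cr r3; have [g [_ eg]] := split_charged cr r3.
suff [h [h1 h2]] : exists h : gT, val (sgval h).1 = r%:R :> 'Z_M /\ val (sgval h).2 = -1 :> 'Z_4.
  have [||x] := @charged_prime_sum R T _ _ _ tcl h (t_all_charged h) 0.
  - exact: t_Lam_ppower.
  - exact: t_sum_Lam_el.
  rewrite -big_filter; case E: [seq _ <- _ | _] => [|a s]; first by rewrite big_nil ltxx.
  have : a \in a :: s by rewrite mem_head.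
  rewrite -E mem_filter => /andP[/andP[/eqP ea pa] _] _.
  have ta := valP a; exists (val a); split => //.
    have : nres M (val a) = r%:R by rewrite -(clq1E M12 M0) // -[clq M _]/(clT a) -sgval_tcl ea.
    by move=> /(congr1 val); rewrite /= !val_Zp_nat // => ->.
  by rewrite -(clq2E M12) // -[clq M _]/(clT a) -sgval_tcl ea.
have [s|s] := unitZ4_cases (sgval g).2; last by exists g.
have [n [cn n3 n4]] := exists_norm3mod4.
have [c1 [_ e1]] := split_charged cn n3.
have [a ea] := tcl_surj c1.
have [|//|z1 z2] := @conj_quotient a n.
  by rewrite -(clq1E M12 M0) ?(valP a) // -e1 -ea sgval_tcl.
move: (_ * _)%g z1 z2 => z z1 z2.
exists (z * g)%g; split.
  by rewrite sgval_fstM z1 eg mul1r.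
by rewrite sgval_sndM z2 s mulr1.
Qed.

End EisensteinPrimes.

(** * Fourth powers modulo p *)

Lemma sqrt_m3_mod3 q (x : 'F_q) : prime q -> (3 < q)%N -> x ^+ 2 = - 3 -> (q == 1 %[mod 3])%N.
Proof.
move=> qp q3 ex.
have oq : odd q by case: (even_prime qp) => // e; rewrite e in q3.
have n2 := Fp_two_neq0 qp oq; set w := (x - 1) / 2.
have n3 : 3 != 0 :> 'F_q by rewrite natFp_eq0 // dvdn_prime2 //; apply/eqP; lia.
have ew : w ^+ 2 + w + 1 = 0.
  have -> : w ^+ 2 + w + 1 = (x ^+ 2 + 3) / 4 by rewrite /w; field; rewrite (natrM _ 2 2) mulf_neq0 n2.
  by rewrite ex addNr mul0r.
have w3 : w ^+ 3 = 1.
  by apply/eqP; rewrite -subr_eq0; have -> : w ^+ 3 - 1 = (w - 1) * (w ^+ 2 + w + 1) by [ring]; rewrite ew mulr0.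
have w0 : w != 0 by apply: contraTneq (oner_neq0 'F_q) => e; rewrite -w3 e expr0n eqxx.
have w1 : w != 1.
  apply: contraNneq n3 => e; rewrite -ew e expr1n; apply/eqP; ring.
have := Fp_fermat qp w0; rewrite (divn_eq q.-1 3) exprD mulnC exprM w3 expr1n mul1r.
have n := divn_eq q.-1 3; have := ltn_pmod q.-1 (isT : 0 < 3)%N.
have nd : ~~ (3 %| q)%N by rewrite dvdn_prime2 //; apply/eqP; lia.
case E : (q.-1 %% 3)%N => [|[|[|//]]] _.
- by move=> _; lia.
- by rewrite expr1 => e; rewrite e eqxx in w1.
- by move=> _; exfalso; lia.
Qed.

(** The kernel of the quadratic character of conductor 12; for a prime above 3 it decides whether 3
    is a square. *)
Definition th12 n := (n %% 12 == 1)%N || (n %% 12 == 11)%N.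

Lemma mod12_cases n : coprime n 6 -> [|| n %% 12 == 1, n %% 12 == 5, n %% 12 == 7 | n %% 12 == 11]%N.
Proof.
rewrite (coprimeMr n 2 3) coprimen2 coprime_sym prime_coprime // => /andP[o d].
by have := ltn_pmod n (isT : 0 < 12)%N; lia.
Qed.

Lemma prime_coprime6 q : prime q -> (3 < q)%N -> coprime q 6.
Proof.
move=> qp q3; rewrite (coprimeMr q 2 3) !prime_coprime // !dvdn_prime2 //; lia.
Qed.

(** 3 is the product of -1 and -3, whose characters depend on [q] modulo 4 and modulo 3. For 11
    modulo 12 both are nonresidues: if 3 were one too, -3 would be a square, as -1 is not. *)
Lemma sqrt3P q : prime q -> (3 < q)%N -> reflect (exists x : 'F_q, x ^+ 2 = 3) (th12 q).
Proof.
move=> qp q3; have oq : odd q by case: (even_prime qp) => // e; rewrite e in q3.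
have n3 : 3 != 0 :> 'F_q by rewrite natFp_eq0 // dvdn_prime2 //; apply/eqP; lia.
have n1 := Fp_1N1 qp oq.
have c12 := mod12_cases (prime_coprime6 qp q3).
apply: (iffP orP) => [|[x ex]].
  case=> /eqP e.
    have [i ei] : exists i : 'F_q, i ^+ 2 = -1 by apply: exists_sqrt_m1 => //; lia.
    have [s es] : exists s : 'F_q, s ^+ 2 = -3 by apply: exists_sqrt_m3 => //; lia.
    by exists (i * s); rewrite exprMn ei es; ring.
  have q4 : (q == 3 %[mod 4])%N by lia.
  case: (half_cases qp oq n3) => h3; first exact: half_sqrt.
  have [|s es] := @half_sqrt q qp oq (- 3) q4.
    rewrite exprNn h3 -signr_odd; have -> : odd (q.-1./2); last by rewrite expr1 mulrNN mulr1.
    have := half_double qp oq; lia.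
  by have := sqrt_m3_mod3 qp q3 es; lia.
case/or4P: c12 => /eqP e; [by left; rewrite e| | |by right; rewrite e].
  have [i ei] : exists i : 'F_q, i ^+ 2 = -1 by apply: exists_sqrt_m1 => //; lia.
  have : (i * x) ^+ 2 = - 3 by rewrite exprMn ei ex mulN1r.
  by move/(sqrt_m3_mod3 qp q3); lia.
have [s es] : exists s : 'F_q, s ^+ 2 = -3 by apply: exists_sqrt_m3 => //; lia.
have : (s / x) ^+ 2 = - 1 by rewrite expr_div_n es ex mulNr divff.
by move/(sqrt_m1_mod4 qp oq); lia.
Qed.

Lemma th12M m n : coprime m 6 -> coprime n 6 -> th12 (m * n) = (th12 m == th12 n).
Proof.
move=> /mod12_cases cm /mod12_cases cn; rewrite /th12 -modnMm.
by case/or4P: cm => /eqP ->; case/or4P: cn => /eqP ->.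
Qed.

Lemma prime_sqrF n : prime (n ^ 2) = false.
Proof.
apply/negbTE/primePns; case: (leqP n 1) => [|n1]; first by case: n => [|[|]] // _; left.
right; exists (pdiv n); split; first exact: pdiv_prime.
  by rewrite leq_exp2r // dvdn_leq ?pdiv_dvd // (ltnW n1).
exact: dvdn_trans (pdiv_dvd n) (dvdn_mulr n (dvdnn n)).
Qed.

Section QuarticResidue.
Variables p u v : nat.
Hypotheses (pp : prime p) (pE : p = (u ^ 2 + 3 * v ^ 2)%N).
Hypotheses (u6 : coprime u 6) (v2 : ~~ odd v).
Local Notation h := (p.-1./2).

Let ou : odd u.
Proof. by move: u6; rewrite (coprimeMr u 2 3) coprimen2 => /andP[]. Qed.

Let u0 : (0 < u)%N. Proof. by move: ou; case: u. Qed.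

Lemma qform_mod4 : (p == 1 %[mod 4])%N.
Proof.
rewrite pE -modnDm -modnMm -modnXm -(modnXm 2 4 v).
have : (u %% 4 = 1 \/ u %% 4 = 3)%N by have := ou; clear; lia.
have : (v %% 4 = 0 \/ v %% 4 = 2)%N by have := v2; clear; lia.
by case=> ->; case=> ->.
Qed.

Let op : odd p.
Proof. by have := qform_mod4; clear; lia. Qed.

Lemma v_gt0 : (0 < v)%N.
Proof.
by rewrite lt0n; apply/eqP => e; move: pp; rewrite pE e muln0 addn0 prime_sqrF.
Qed.

Lemma qform_coprime : coprime u v.
Proof.
rewrite /coprime; set g := gcdn u v.
have g0 : (0 < g)%N by rewrite gcdn_gt0 u0.
have d : (g ^ 2 %| p)%N.
  by rewrite pE; apply: dvdn_add; last apply: dvdn_mull; rewrite dvdn_exp2r ?dvdn_gcdl ?dvdn_gcdr.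
case/primeP: (pp) => _ /(_ _ d) /orP[]; first by rewrite (eqn_exp2r g 1).
by move=> /eqP e; move: pp; rewrite -e prime_sqrF.
Qed.

Lemma prime_dvd_neq q : prime q -> (q %| u * v)%N -> q != p.
Proof.
move=> qp d; apply/eqP => qe; rewrite qe in d.
have v0 := v_gt0.
move: d; rewrite Euclid_dvdM // => /orP[] /dvdn_leq => [/(_ u0)|/(_ v0)] l.
  by have : (u ^ 2 < u)%N by [apply: leq_trans l; rewrite [X in (_ < X)%N]pE; clear -v0; nia]; clear -u0; nia.
by have : (v ^ 2 < v)%N by [apply: leq_trans l; rewrite [X in (_ < X)%N]pE; clear -u0 v0; nia]; clear -v0; nia.
Qed.

(** For a prime [q] dividing [u], [p] is [3 * v ^ 2] modulo [q]; reciprocity turns the character of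
    [q] modulo [p] into that of 3 modulo [q], which [th12 q] decides. Multiplicativity extends this
    to all divisors. *)
Lemma half_dvd_u n : (n %| u)%N -> (n%:R : 'F_p) ^+ h = if th12 n then 1 else -1.
Proof.
have [k] := ubnP n; elim: k n => // k IH n nk du.
have n0 : (0 < n)%N by rewrite (dvdn_gt0 u0 du).
have [n1|n1] := leqP n 1.
  by have -> : n = 1%N by [lia]; rewrite expr1n.
have qp := pdiv_prime n1; have dn := pdiv_dvd n; set q := pdiv n in qp dn.
have [m em] := dvdnP dn.
have m0 : (0 < m)%N by move: n0; rewrite em muln_gt0 => /andP[].
have dqu := dvdn_trans dn du.
have q1 := prime_gt1 qp.
have mu : (m %| u)%N by apply: dvdn_trans du; rewrite em dvdn_mulr.
have m6 := coprime_dvdl mu u6; have q6 := coprime_dvdl dqu u6.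
have q3 : (3 < q)%N by move: q6 q1; case: (q) => [|[|[|[|]]]].
have oq : odd q by move: q6; rewrite (coprimeMr q 2 3) coprimen2 => /andP[].
have qnp : p != q by rewrite eq_sym prime_dvd_neq // dvdn_mulr.
rewrite em natrM exprMn IH //; last by rewrite em in nk; clear -nk m0 q1; nia.
rewrite th12M //.
have dqv : ~~ (q %| v)%N.
  by have := coprime_dvdl dqu qform_coprime; rewrite prime_coprime.
have v0 : v%:R != 0 :> 'F_q by rewrite natFp_eq0.
have pq : p%:R = 3 * v%:R ^+ 2 :> 'F_q.
  rewrite [in LHS]pE natrD natrM !natrX.
  by have -> : u%:R = 0 :> 'F_q by [apply/eqP; rewrite natFp_eq0]; rewrite expr0n add0r.
have -> : (q%:R : 'F_p) ^+ h = if th12 q then 1 else -1.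
  have q0 : q%:R != 0 :> 'F_p by rewrite natFp_eq0 // dvdn_prime2.
  have := half_cases pp op q0; case: sqrt3P => // [[x ex]|nx].
    case=> // e; apply/eqP/(reciprocity pp qp oq qform_mod4 qnp).
    by exists (x * v%:R); rewrite exprMn ex pq.
  case=> // /eqP /(reciprocity pp qp oq qform_mod4 qnp) [x ex]; case: nx.
  by exists (x / v%:R); rewrite expr_div_n ex pq mulfK // expf_neq0.
by case: (th12 m); case: (th12 q); rewrite /= ?mulr1 ?mul1r ?mulrNN ?mulr1.
Qed.

(** For an odd prime [q] dividing [v], [p] is the square [u ^ 2] modulo [q]. *)
Lemma half_dvd_v n : (n %| v)%N -> odd n -> (n%:R : 'F_p) ^+ h = 1.
Proof.
have [k] := ubnP n; elim: k n => // k IH n nk du on.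
have n0 : (0 < n)%N by rewrite (dvdn_gt0 v_gt0 du).
have [n1|n1] := leqP n 1.
  by have -> : n = 1%N by [lia]; rewrite expr1n.
have qp := pdiv_prime n1; have dn := pdiv_dvd n; set q := pdiv n in qp dn.
have [m em] := dvdnP dn.
have m0 : (0 < m)%N by move: n0; rewrite em muln_gt0 => /andP[].
have q1 := prime_gt1 qp.
have mu : (m %| v)%N by apply: dvdn_trans du; rewrite em dvdn_mulr.
have dqv := dvdn_trans dn du.
have /andP[om oq] : odd m && odd q by rewrite -oddM -em.
have qnp : p != q by rewrite eq_sym prime_dvd_neq // dvdn_mull.
rewrite em natrM exprMn IH //; last by rewrite em in nk; clear -nk m0 q1; nia.
rewrite mul1r; apply/eqP/(reciprocity pp qp oq qform_mod4 qnp); exists u%:R.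
rewrite [in RHS]pE natrD natrM !natrX.
by have -> : v%:R = 0 :> 'F_q by [apply/eqP; rewrite natFp_eq0]; rewrite expr0n mulr0 addr0.
Qed.

Hypothesis uv : th12 u = (v %% 4 == 2)%N.

(** Odd divisors of [v] are residues, so the character of [u * v] comes from [u] and the power of 2
    in [v]. If [v] is 2 modulo 4, then [p] is 5 modulo 8, so 2 is a nonresidue and [u] a residue. If
    4 divides [v], then [p] is 1 modulo 8, so 2 is a residue and [u] a nonresidue. *)
Lemma half_uv : (u%:R * v%:R : 'F_p) ^+ h = -1.
Proof.
rewrite exprMn half_dvd_u // uv.
have o3 : (u %% 8 = 1 \/ u %% 8 = 3 \/ u %% 8 = 5 \/ u %% 8 = 7)%N by have := ou; clear; lia.
case: eqP => v4.
  have vE : v = (2 * v./2)%N by have := v2; clear; lia.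
  have o : odd v./2 by have := v4; clear; lia.
  have d : (v./2 %| v)%N by rewrite [X in (_ %| X)%N]vE dvdn_mull.
  rewrite mul1r [v in v%:R]vE natrM exprMn (half_dvd_v d o) mulr1.
  rewrite half_two // ?qform_mod4 //; case: ifP => //; rewrite pE -modnDm -modnMm -modnXm -(modnXm 2 8 v).
  have : (v %% 8 = 2 \/ v %% 8 = 6)%N by have := v4; clear; lia.
  by case=> ->; case: o3 => [|[|[|]]] ->.
have p8 : (p == 1 %[mod 8])%N.
  rewrite pE -modnDm -modnMm -modnXm -(modnXm 2 8 v).
  have : (v %% 8 = 0 \/ v %% 8 = 4)%N by have := v4; have := v2; clear; lia.
  by case=> ->; case: o3 => [|[|[|]]] ->.
have [m om em] := @pfactor_coprime 2 v isT v_gt0.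
rewrite coprime_sym coprimen2 in om.
rewrite em natrM exprMn half_dvd_v ?mul1r //; last by rewrite [X in (_ %| X)%N]em dvdn_mulr.
by rewrite natrX exprAC half_two ?qform_mod4 // p8 expr1n mulr1.
Qed.

(** From [g ^+ 4 = -3] follows [U = g ^+ 2 * V] up to sign, so [U * V] is [(g * V) ^+ 2] up to sign,
    hence a square because -1 is one. *)
Lemma not_fourth_power (g : 'F_p) : g ^+ 4 != -3.
Proof.
apply/eqP => eg; set U := u%:R : 'F_p; set V := v%:R : 'F_p.
have n1 : -1 != 1 :> 'F_p by rewrite eq_sym Fp_1N1.
have uvn : U * V != 0.
  by apply/eqP => e; have := half_uv; rewrite -/U -/V e expr0n; have := half_double pp op; have := prime_gt1 pp; case: (p.-1./2) => [|n _ _ /eqP]; [lia|rewrite eq_sym oppr_eq0 oner_eq0].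
have [i ei] := exists_sqrt_m1 pp op qform_mod4.
have e0 : U ^+ 2 + 3 * V ^+ 2 = 0.
  by rewrite -!natrX -natrM -natrD -pE; apply/eqP; rewrite natFp_eq0.
have /eqP : (g ^+ 2 * V) ^+ 2 = U ^+ 2.
  by rewrite exprMn -exprM eg mulNr; apply/eqP; rewrite eq_sym -addr_eq0 e0.
rewrite eqf_sqr => /orP[] /eqP e.
  have E : U * V = (g * V) ^+ 2 by rewrite -e; ring.
  move: half_uv; rewrite -/U -/V E half_of_sqr // => [/eqP|]; first by rewrite eq_sym (negbTE n1).
  by apply: contraNneq uvn => e1; rewrite E e1 expr0n.
have E : U * V = (i * (g * V)) ^+ 2 by rewrite exprMn ei -[U]opprK -e; ring.
move: half_uv; rewrite -/U -/V E half_of_sqr // => [/eqP|]; first by rewrite eq_sym (negbTE n1).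
by apply: contraNneq uvn => e1; rewrite E e1 expr0n.
Qed.

End QuarticResidue.


Lemma root_P8_fourth_power (p : nat) (y : 'F_p) : prime p -> (p == 1 %[mod 12])%N ->
  root (P8 'F_p) y -> exists g : 'F_p, g ^+ 4 = -3.
Proof.
move=> pp p12; have op : odd p by lia.
have p3 : (3 < p)%N by have := prime_gt1 pp; lia.
have n2 := Fp_two_neq0 pp op.
have [i ei] : exists i : 'F_p, i ^+ 2 = -1 by apply: exists_sqrt_m1 => //; lia.
have [s es] : exists s : 'F_p, s ^+ 2 = -3 by apply: exists_sqrt_m3 => //; lia.
rewrite /root /P8 hornerD hornerN hornerD hornerZ !hornerXn hornerC => /eqP ey.
have [w ew et] : exists2 w : 'F_p, w ^+ 2 = 3 & y ^+ 4 = - 180 + 104 * w.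
  have w3 : (i * s) ^+ 2 = 3 by rewrite exprMn ei es; ring.
  (* Completing the square: [180 ^ 2 + 48 = 3 * 104 ^ 2]. *)
  have /eqP : (y ^+ 4 + 180) ^+ 2 = (104 * (i * s)) ^+ 2.
    apply/eqP; rewrite -subr_eq0 [X in _ - X]exprMn w3 -[X in _ == X]ey; apply/eqP; ring.
  rewrite eqf_sqr => /orP[] /eqP e.
    by exists (i * s) => //; rewrite -e; ring.
  exists (- (i * s)); first by rewrite sqrrN.
  by rewrite mulrN -e; ring.
have w1 : 1 - w != 0.
  apply: contraNneq n2 => e; have w1 : w = 1 by apply/eqP; rewrite eq_sym -subr_eq0 e.
  by move: ew; rewrite w1 expr1n => /eqP; rewrite eq_sym -subr_eq0; have -> : 3 - 1 = 2 :> 'F_p by ring.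
have E : (2 * y ^+ 2 / (1 - w) ^+ 3) ^+ 2 = 2 * w.
  have -> : (2 * y ^+ 2 / (1 - w) ^+ 3) ^+ 2 = 4 * y ^+ 4 / (1 - w) ^+ 6 by field.
  rewrite et; apply: (mulIf (expf_neq0 6 w1)); rewrite divfK ?expf_neq0 //.
  have w6 : (1 - w) ^+ 6 = 208 - 120 * w.
    have -> : (1 - w) ^+ 6 = ((1 - w) ^+ 2) ^+ 3 by rewrite -exprM.
    have -> : (1 - w) ^+ 2 = 4 - 2 * w by have -> : (1 - w) ^+ 2 = 1 + w ^+ 2 - 2 * w by [ring]; rewrite ew; ring.
    have -> : (4 - 2 * w) ^+ 3 = 64 - 96 * w + 48 * w ^+ 2 - 8 * w ^+ 2 * w by ring.
    by rewrite ew; ring.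
  rewrite w6; have -> : 2 * w * (208 - 120 * w) = 416 * w - 240 * w ^+ 2 by ring.
  by rewrite ew; ring.
set e := 2 * y ^+ 2 / (1 - w) ^+ 3 in E.
have i4 : (1 + i) ^+ 4 = -4.
  have -> : (1 + i) ^+ 4 = (1 + i ^+ 2 + 2 * i) ^+ 2 by ring.
  by rewrite ei subrr add0r exprMn ei; ring.
exists (e / (1 + i)); rewrite expr_div_n i4.
have -> : e ^+ 4 = 12 by rewrite (exprM e 2 2) E exprMn ew; ring.
have n4 : 4 != 0 :> 'F_p by rewrite (natrM _ 2 2) mulf_neq0.
by field; rewrite oppr_eq0.
Qed.

Lemma qf_not_fourth_power (z : qint) : prime (qf z) -> (qf z == 1 %[mod 12])%N ->
  (z.1 == 1 %[mod 3])%Z -> sres z = -1 -> forall g : 'F_(qf z), g ^+ 4 != -3.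
Proof.
move=> pp p12 z3 es; have [m em] : exists m : int, z.1 + z.2 = 4 * m + 3.
  have : (z.1 + z.2 == -1 %[mod 4])%Z by rewrite -(@intrZp_eq 4) // -/(sres z) es.
  by move=> e; exists ((z.1 + z.2) %/ 4)%Z; lia.
have pE : qf z = (absz z.1 ^ 2 + 3 * absz z.2 ^ 2)%N.
  apply/eqP; rewrite -eqz_nat /qf gez0_abs ?qform_ge0 // PoszD PoszM.
  by rewrite -!abszX !gez0_abs ?sqr_ge0.
have ox : odd (absz z.1) (+) odd (absz z.2) by clear -em; lia.
(* An even first and an odd second coordinate would give norm 3 modulo 4. *)
have ov : odd (absz z.1) && ~~ odd (absz z.2).
  have : (qf z == 1 %[mod 4])%N by clear -p12; lia.
  rewrite pE -modnDm -modnMm -modnXm -(modnXm 2 4 (absz z.2)).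
  move: ox; case: (boolP (odd (absz z.2))) => //= o2; case: (boolP (odd (absz z.1))) => //= o1 _.
  have : (absz z.1 %% 4 = 0 \/ absz z.1 %% 4 = 2)%N by clear -o1; lia.
  have : (absz z.2 %% 4 = 1 \/ absz z.2 %% 4 = 3)%N by clear -o2; lia.
  by case=> ->; case=> ->.
case/andP: ov => o1 o2.
apply: (@not_fourth_power _ _ _ pp pE) => //.
  by rewrite (coprimeMr _ 2 3) coprimen2 o1 coprime_sym prime_coprime //; clear -z3; lia.
(* As [z.1] is odd and 1 modulo 3, its absolute value is 1 or 11 modulo 12 exactly when [z.1] is 1
   modulo 4; since the coordinates sum to 3 modulo 4, this means that [z.2] is 2 modulo 4. *)
by rewrite /th12; clear -em z3 o2; lia.
Qed.

Theorem theorem5 (c : int) (d : nat) :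
  (1 <= d)%N ->
  (c = 1 %[mod 12])%Z ->
  gcdz c d = 1 ->
  exists p : nat,
    [/\ prime p,
        (p%:Z = c %[mod (12 * d)%:Z])%Z
      & forall y : 'F_p, ~~ root (P8 'F_p) y].
Proof.
move=> d1 c12 cd; set M := (12 * d)%N.
have M0 : (0 < M)%N by rewrite /M; lia.
have M12 : (12 %| M)%N by exact: dvdn_mulr.
pose r := absz (c %% M)%Z.
have rE : r%:Z = (c %% M)%Z by rewrite gez0_abs // modz_ge0 //; lia.
have cE : c = (12 * (c %/ M)%Z) * d%:Z + r%:Z.
  by rewrite rE [LHS](divz_eq c M) /M PoszM; ring.
have r12 : (r == 1 %[mod 12])%N.
  by move: cE c12; rewrite -mulrA; move: (_ * d%:Z) => k; clear; lia.
have rd : coprime r d.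
  have : gcdz d r = 1 by rewrite -cd [RHS]gcdzC cE gcdzMDl.
  by rewrite /coprime gcdnC /gcdz /= => -[->].
have rM : coprime r M.
  by rewrite coprimeMr rd andbT -coprime_modl (eqP r12).
have r3 : (r == 1 %[mod 3])%N by clear -r12; lia.
have [z [pp eM /andP[_ z3] es]] := @exists_prime_qf Rdefinitions.R M M12 M0 r rM r3.
have p12 : (qf z == 1 %[mod 12])%N.
  by rewrite -(eqP r12) -(modn_dvdm (qf z) M12) (eqP eM) modn_dvdm.
exists (qf z); split => //.
  by rewrite modz_nat (eqP eM) -modz_nat rE modz_mod.
move=> y; apply/negP => /(root_P8_fourth_power pp p12)[g /eqP].
by apply/negP; apply: qf_not_fourth_power.
Qed.
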